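(* Suppose conditions (A1)-(A6) listed in the context hold. Then the cross-fit plug-in estimator $\hat\beta=\frac1n\sum_{\ell=1}^L\sum_{i\in I_\ell}m(z_i,\hat\gamma_\ell)$ satisfies $$\sqrt n(\hat\beta-\beta_0)=\frac1{\sqrt n}\sum_{i=1}^n\psi(z_i)+O_p\left(\bar\Delta_n^*+\Delta_n^m+\bar\Delta_n\right),\qquad \bar\Delta_n=\left(\frac{K\ln K}{n}\right)^{1/2}K^{(1/2)-\zeta_\gamma}.$$ If in addition $d_K$ is bounded as a function of $K$ and $\zeta_m=\zeta_\gamma$, then $\Delta_n^m\le C\bar\Delta_n^*$.
   Context: Data $z_1,\dots,z_n$ are i.i.d. with distribution $F_0$; $y_i$ is a scalar component and $x_i$ a subvector of $z_i$; $\gamma_0(x)=E[y_i\mid x_i=x]$. For each data value $z$, $m(z,\gamma)$ is an affine functional of the function $\gamma$ of $x$, i.e. $m(z,\gamma)-m(z,0)$ is linear in $\gamma$. The parameter is $\beta_0=E[m(z_i,\gamma_0)]$ and $\psi(z)=m(z,\gamma_0)-\beta_0+\alpha_0(x)[y-\gamma_0(x)]$ with $\alpha_0$ as in (A1). All limits are as $n\to\infty$; $K=K_n$; $C>0$ denotes a generic constant not depending on $n$ or $K$. Estimator. $p(x)=(p_1(x),\dots,p_K(x))^T$ is a $K\times1$ vector of regression splines. $I_1,\dots,I_L$ is a partition of $\{1,\dots,n\}$ with $L$ fixed, $\hat I_\ell=\{1,\dots,n\}\setminus I_\ell$, and $\hat\gamma_\ell(x)=p(x)^T\hat\Sigma_\ell^-\hat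 h_\ell$, where $\hat\Sigma_\ell=\hat n_\ell^{-1}\sum_{i\in\hat I_\ell}p(x_i)p(x_i)^T$, $\hat h_\ell=\hat n_\ell^{-1}\sum_{i\in\hat I_\ell}p(x_i)y_i$, $\bar n_\ell=|I_\ell|$, $\hat n_\ell=|\hat I_\ell|$, and $A^-$ is any generalized inverse. Let $v(z)=(m(z,p_1)-m(z,0),\dots,m(z,p_K)-m(z,0))^T$. (A1) There is $\alpha_0(x)$ with $E[\alpha_0(x_i)^2]<\infty$ such that $E[m(z_i,\gamma)-m(z_i,0)]=E[\alpha_0(x_i)\gamma(x_i)]$ for all $\gamma$ with $E[\gamma(x_i)^2]<\infty$. (A2) $\bar n_\ell+\hat n_\ell=n$ and $\min_\ell\{\bar n_\ell,\hat n_\ell\}\ge Cn$ for a constant $C>0$; the groups $I_\ell$ are as close as possible to being of equal size. (A3) $p(x)=a\,q(w)$ with $x=(a,w)$, where: (i) the support of $w_i$ is $[0,1]^r$ and $w_i$ is continuously distributed with bounded pdf that is bounded away from zero; (ii) $q(w)$ are tensor product b-splines of order $\kappa$ ($\kappa=0$ being the Haar basis) with knot spacing approximately proportional to the reciprocal of the number of knots; (iii) $q(w)$ is normalized so that $\lambda_{\min}(E[q(w_i)q(w_i)^T])\ge C>0$ and $\sup_{w\in[0,1]^r}\|q(w)\|\le C\sqrt K$; (iv) $a_i$ is bounded and $E[a_i^2\mid w_i]$ is bounded away from zero. (A4) $\gamma_0(x)$ and $\alpha_0(x)$ are Holder of order $s_\gamma$ and $s_\alpha$ respectively, where $g$ is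 Holder of order $s$ if there is a constant $C$ such that $g$ is continuously differentiable of order $\bar s=\mathrm{int}[s]$ and each of its order-$\bar s$ partial derivatives satisfies $|\nabla^{\bar s}g(\tilde x)-\nabla^{\bar s}g(x)|\le C\|\tilde x-x\|^{s-\bar s}$. (A5) $Var(y_i\mid x_i)\le C$, $K\to\infty$, and $K\ln(K)/n\to0$. (A6) $\lambda_{\max}(E[v(z_i)v(z_i)^T])\le Cd_K$ and $\{E[\{m(z_i,\gamma_K)-m(z_i,\gamma_0)\}^2]\}^{1/2}=O(K^{-\zeta_m})$, where $\gamma_K(x)=p(x)^T\Sigma^{-1}E[p(x_i)\gamma_0(x_i)]$ and $\Sigma=E[p(x_i)p(x_i)^T]$. Remainders: with $\zeta_\gamma=\min\{1+\kappa,s_\gamma\}/r$ and $\zeta_\alpha=\min\{1+\kappa,s_\alpha\}/r$, $\bar\Delta_n^*=\sqrt nK^{-\zeta_\gamma-\zeta_\alpha}+K^{-\zeta_\gamma}+K^{-\zeta_\alpha}+\sqrt{K/n}$ and $\Delta_n^m=\sqrt{(d_K+1)K/n}+K^{-\zeta_m}$.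
   Formalization: Condition (A4) is read as: almost surely γ0(x)=a·g(w) and α0(x)=a·h(w) with g, h Hölder of orders s_γ, s_α on [0,1]^r; for arbitrary Hölder functions of x=(a,w) the claim fails, e.g. γ0=α0=1, m(z,γ)=γ(x), a uniform on [1,2] independent of w, ζ_m=0, K~√n. *)

(* Defs.v *)
(* MathComp-Analysis *)
From mathcomp Require Export all_boot all_order all_algebra.
From mathcomp Require Export all_classical all_reals all_analysis.

Set Implicit Arguments.
Unset Strict Implicit.
Unset Printing Implicit Defensive.

Import Order.TTheory GRing.Theory Num.Theory.
Import numFieldNormedType.Exports.

Local Open Scope classical_set_scope.
Local Open Scope ring_scope.

(* The regressor x = (a, w), with a scalar and w in R^r. *)
Notation regressor R r := (R * r.-tuple R)%type.

Section linear_algebra.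
Variable R : realType.

(* Euclidean norm; the library norm on matrices is the sup norm. *)
Definition enorm m n (A : 'M[R]_(m, n)) : R :=
  Num.sqrt (\sum_i \sum_j A i j ^+ 2).

(* Only used on symmetric matrices, whose spectrum is real, finite and (in
   positive dimension) nonempty. *)
Definition lambda_min n (A : 'M[R]_n) : R := inf [set c | eigenvalue A c].
Definition lambda_max n (A : 'M[R]_n) : R := sup [set c | eigenvalue A c].

Definition generalized_inverse n (A G : 'M[R]_n) : Prop := A *m G *m A = A.

End linear_algebra.

Section probability.
Context {R : realType}.

Definition iid d dZ (Om : measurableType d) (Z : measurableType dZ)
    (P : probability Om R) (F : probability Z R)
    (z : nat -> {mfun Om >-> Z}) : Prop :=
  (forall i A, measurable A -> P (z i @^-1` A) = F A) /\
  (forall n (A : nat -> set Z), (forall i, measurable (A i)) ->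
    P (\bigcap_(i in `I_n) (z i @^-1` A i)) =
    (\prod_(i < n) fine (P (z i @^-1` A i)))%:E).

(* h is a version of E[Y | X = .]. *)
Definition is_cond_mean dZ dX (Z : measurableType dZ) (X : measurableType dX)
    (F : probability Z R) (Y : Z -> R) (x : Z -> X) (h : X -> R) : Prop :=
  [/\ F.-integrable setT (EFin \o Y),
      measurable_fun setT h,
      F.-integrable setT (EFin \o (h \o x)) &
      forall B, measurable B ->
        (\int[F]_(u in x @^-1` B) (Y u)%:E =
         \int[F]_(u in x @^-1` B) (h (x u))%:E)%E].

Definition sq_integrable dZ dX (Z : measurableType dZ) (X : measurableType dX)
    (F : probability Z R) (x : Z -> X) (g : X -> R) : Prop :=
  measurable_fun setT g /\
  F.-integrable setT (EFin \o (fun u => g (x u) ^+ 2)).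

(* Entrywise expectation of a random matrix with integrable entries. *)
Definition expectation_mx dZ (Z : measurableType dZ) (F : probability Z R)
    m n (M : Z -> 'M[R]_(m, n)) : 'M[R]_(m, n) :=
  \matrix_(i, j) fine ('E_F[fun u => M u i j]).

(* V_n = O_p(rho_n).  The bad event is only required to be contained in a
   measurable set of small probability, since V may be nonmeasurable (an
   arbitrary generalized inverse is chosen for each outcome); for measurable V
   this is the usual notion. *)
Definition is_Op d (Om : measurableType d) (P : probability Om R)
    (V : nat -> Om -> R) (rho : nat -> R) : Prop :=
  forall eps : R, 0 < eps -> exists M : R, 0 < M /\
    \forall n \near \oo, exists B : set Om,
      [/\ measurable B, (P B <= eps%:E)%E &
          [set o | M * rho n < `|V n o|] `<=` B].

End probability.

Section cube.
Context {R : realType}.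

Definition cube r (w : r.-tuple R) : Prop := forall j, 0 <= tnth w j <= 1.

(* Integral over R^r against Lebesgue measure, as an iterated integral. *)
Fixpoint lebesgue_iint r : (r.-tuple R -> \bar R) -> \bar R :=
  match r return (r.-tuple R -> \bar R) -> \bar R with
  | 0 => fun f => f [tuple]
  | r'.+1 => fun f =>
      (\int[lebesgue_measure]_t lebesgue_iint (fun v => f [tuple of t :: v]))%E
  end.

(* The law of w has a density which is bounded, bounded away from zero on the
   cube, and zero off the cube; in particular its support is the cube. *)
Definition bounded_density_on_cube dZ (Z : measurableType dZ)
    (F : probability Z R) r (w : Z -> r.-tuple R) : Prop :=
  exists (f : r.-tuple R -> R) (c C : R),
    [/\ 0 < c, measurable_fun setT f,
        forall v, cube v -> c <= f v <= C,
        forall v, ~ cube v -> f v = 0 &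
        forall A, measurable A ->
          F (w @^-1` A) = lebesgue_iint (fun v => (f v * \1_A v)%:E)].

Definition tuple_row r (w : r.-tuple R) : 'rV[R]_r := \row_j tnth w j.

(* D_(j_1) ... D_(j_k) g for js = [:: j_1; ...; j_k]. *)
Definition partials r (js : seq 'I_r) (g : 'rV[R]_r -> R) : 'rV[R]_r -> R :=
  foldr (fun j h => fun v => 'D_(delta_mx 0 j) h v) g js.

(* g is Holder of order s on the cube.  Smoothness up to the boundary is
   expressed by g being defined and C^(int s) on all of R^r; the Holder bound is
   only required on the cube. *)
Definition holder r (s : R) (g : 'rV[R]_r -> R) : Prop :=
  let sbar := Num.truncn s in
  [/\ forall js : seq 'I_r, (size js < sbar)%N ->
        forall j v, derivable (partials js g) v (delta_mx 0 j),
      forall js : seq 'I_r, (size js <= sbar)%N -> continuous (partials js g) &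
      exists C : R, forall js : seq 'I_r, size js = sbar ->
        forall v v' : r.-tuple R, cube v -> cube v' ->
          `|partials js g (tuple_row v') - partials js g (tuple_row v)|
            <= C * enorm (tuple_row v' - tuple_row v) `^ (s - sbar%:R)].

(* For regressors x = (a, w) and basis functions of the form a q(w): the
   function of x is a times a Holder function of w, almost surely.  Since a
   function of this form is automatically smooth in a, the order of smoothness
   is that in w, the r-dimensional argument. *)
Definition holder_regression dZ (Z : measurableType dZ) (F : probability Z R) r
    (a : Z -> R) (w : Z -> r.-tuple R) (s : R) (gam : regressor R r -> R)
    : Prop :=
  exists g : 'rV[R]_r -> R, holder s g /\
    {ae F, forall u, gam (a u, w u) = a u * g (tuple_row (w u))}.

End cube.

Section splines.
Context {R : realType}.

(* Cox-de Boor recursion: the i-th B-spline of degree k with knots tau; the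
   convention x / 0 = 0 handles repeated knots.  The pieces are right
   continuous, except that the value at (and beyond) 1 is the left limit, so
   that the splines are continuous up to the right end of [0, 1]. *)
Fixpoint bspline (tau : nat -> R) (k i : nat) (t : R) : R :=
  match k with
  | 0 => ((if t < 1 then tau i <= t < tau i.+1
           else tau i < t <= tau i.+1) : bool)%:R
  | k'.+1 =>
      (t - tau i) / (tau (i + k)%N - tau i) * bspline tau k' i t +
      (tau (i + k.+1)%N - t) / (tau (i + k.+1)%N - tau i.+1) *
        bspline tau k' i.+1 t
  end.

(* tau k = 0 < ... < tau (k + J) = 1 are the breakpoints of J intervals; the k
   outer knots on each side are arbitrary (repeated or not). *)
Definition knot_sequence (k J : nat) (tau : nat -> R) : Prop :=
  [/\ (0 < J)%N, tau k = 0, tau (k + J)%N = 1 &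
      forall i, (i < J + k.*2)%N -> tau i <= tau i.+1].

(* q lists, in some order and up to scale factors, the tensor products of the
   J j + k univariate B-splines of degree k in each coordinate j, with knot
   spacing between c and C times the reciprocal of the number of knots; this
   number has the same order in all coordinates, hence the two indices j, j'. *)
Definition tensor_bspline (k : nat) (c C : R) r K
    (q : r.-tuple R -> 'cV[R]_K) : Prop :=
  exists (J : 'I_r -> nat) (tau : 'I_r -> nat -> R)
    (e : 'I_K -> {dffun forall j : 'I_r, 'I_(J j + k)}) (scale : 'I_K -> R),
  [/\ forall j, knot_sequence k (J j) (tau j),
      forall j j' i, (k <= i < k + J j)%N ->
        c / (J j')%:R <= tau j i.+1 - tau j i <= C / (J j')%:R,
      bijective e &
      forall l v, q v l 0 =
        scale l * \prod_j bspline (tau j) k (e l j) (tnth v j)].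

End splines.

Section estimator.
Context {R : realType} {X : Type}.

Definition sample_gram n K (p : X -> 'cV[R]_K) (xs : 'I_n -> X)
    (S : {set 'I_n}) : 'M[R]_K :=
  (#|S|%:R)^-1 *: \sum_(i in S) p (xs i) *m (p (xs i))^T.

Definition sample_cross n K (p : X -> 'cV[R]_K) (xs : 'I_n -> X)
    (ys : 'I_n -> R) (S : {set 'I_n}) : 'cV[R]_K :=
  (#|S|%:R)^-1 *: \sum_(i in S) ys i *: p (xs i).

Definition series_fun K (p : X -> 'cV[R]_K) (b : 'cV[R]_K) : X -> R :=
  fun x => ((p x)^T *m b) 0 0.

(* The fold I_l, for an assignment of the observations to L groups. *)
Definition fold n L (grp : 'I_n -> 'I_L) (l : 'I_L) : {set 'I_n} :=
  [set i | grp i == l].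

Definition cross_fit_plugin Z n L (m : Z -> (X -> R) -> R) (zs : 'I_n -> Z)
    (grp : 'I_n -> 'I_L) (gamhat : 'I_L -> X -> R) : R :=
  n%:R^-1 * \sum_(l < L) \sum_(i in fold grp l) m (zs i) (gamhat l).

(* The population least squares approximation p^T Sigma^-1 E[p gam]. *)
Definition population_fit dZ (Z : measurableType dZ) (F : probability Z R)
    (x : Z -> X) K (p : X -> 'cV[R]_K) (gam : X -> R) : X -> R :=
  series_fun p
    (invmx (expectation_mx F (fun u => p (x u) *m (p (x u))^T)) *m
     expectation_mx F (fun u => gam (x u) *: p (x u))).

(* The vector (m(z, p_1) - m(z, 0), ..., m(z, p_K) - m(z, 0)). *)
Definition m_basis Z (m : Z -> (X -> R) -> R) K (p : X -> 'cV[R]_K) (u : Z)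
    : 'cV[R]_K :=
  \col_k (m u (fun x => p x k 0) - m u (fun=> 0)).

End estimator.

Section rates.
Context {R : realType}.
Implicit Types (zg za zm : R) (K : nat -> nat) (n : nat).

(* The exponent min(1 + k, s) / r. *)
Definition zeta (k r : nat) (s : R) : R := Num.min (1 + k%:R) s / r%:R.

Definition Delta_star zg za K n : R :=
  Num.sqrt n%:R * (K n)%:R `^ (- zg - za) + (K n)%:R `^ (- zg)
  + (K n)%:R `^ (- za) + Num.sqrt ((K n)%:R / n%:R).

Definition Delta_m zm (d : nat -> R) K n : R :=
  Num.sqrt ((d (K n) + 1) * (K n)%:R / n%:R) + (K n)%:R `^ (- zm).

Definition Delta_bar zg K n : R :=
  Num.sqrt ((K n)%:R * ln (K n)%:R / n%:R) * (K n)%:R `^ (1 / 2 - zg).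

End rates.

(* Main.v *)
From HB Require Import structures.
Require Import Defs.
From mathcomp Require Import finmap measurable_realfun zify ring lra.

Set Implicit Arguments.
Unset Strict Implicit.
Unset Printing Implicit Defensive.

Import Order.TTheory GRing.Theory Num.Theory.
Import numFieldNormedType.Exports.

Local Open Scope classical_set_scope.
Local Open Scope ring_scope.

(** The cross-fit estimator averages an affine functional of a series regression
    that was computed from other observations. Write [eps = y - gamma_0(x)] for
    the noise, [gamma_K] and [alpha_K = p^T da] for the least squares projections
    of [gamma_0] and [alpha_0] on the splines, and [rho = gamma_0 - gamma_K]. When
    the sample second moment matrix of a training set is invertible, the error of
    the estimated coefficients is its inverse applied to the training average of
    [p (eps + rho)]. The functional of a spline with coefficients [b] has mean
    [da^T Sigma b]. Replacing [Sigma] there by the sample matrix cancels the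
    inverse and leaves the training average of [alpha_K (eps + rho)]
    ([population_functional]); summed over the folds its leading part is the
    average of [alpha_0 eps], the correction term of the influence function,
    because cross-fitting with balanced folds uses every observation with total
    weight [1 + O(1 / n)].

    What is left splits into seven terms ([remainder_decomposition]), each
    controlled by a first or second moment. The mean of the functional of
    [gamma_K - gamma_0] is [E[(alpha_K - alpha_0) rho]], a product of two
    approximation errors by orthogonality. The centred functional is averaged over
    observations that are independent of the estimated coefficients, so its
    variance is that of one term times the squared estimation error
    ([heldout_term]). The effect of the error of the second moment matrix has
    conditionally uncorrelated summands where it multiplies [eps] ([noise_term])
    and is bounded by Cauchy-Schwarz where it multiplies [rho] ([bias_term]); the
    latter gives the term [(K ln K / n)^(1/2) K^(1/2 - zeta_gamma)] of the rate.
    The others are averages of independent centred terms. Markov's inequality then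
    yields the expansion ([plug_in_expansion], [remainder_bound_rate]).

    All conditioning is expressed by replacing one observation of the sample by an
    independent copy ([resample_ge0], [resample_mean0]).

    The moments are taken on the event that every entry of the sample second
    moment matrices is close to its mean. A Bernstein bound for each entry and
    [K ln K = o(n)] make the complement negligible ([good_prob],
    [near_union_bound]), and closeness of the entries is enough because each spline
    overlaps with boundedly many others, so that the deviation has small operator
    norm ([sparse_qform_le], [good_gramhat]).

    The approximation rates [K^(- zeta)] come from quasi-interpolation. Marsden's
    identity represents polynomials of degree [k] with products of [k] knots as
    coefficients, and the polarization formula turns these products into
    combinations of point evaluations. The resulting operator has norm bounded in
    terms of [k], reproduces polynomials of degree [k] and is local, so its error
    is that of Taylor's formula; in several variables the operators act one
    coordinate at a time ([qi_error], [qi_ops_error], [spline_approximation]). The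
    point evaluations have to be inside [0, 1] although outer knots need not be;
    moving the outer knots to the end points does not change the spline space on
    [0, 1] ([change_outer_knots]). *)

(** * Means and square-integrable functions *)

Section mean.
Context {R : realType} d (T : measurableType d) (mu : probability T R).
Implicit Types f g : T -> R.

Definition mean f : R := fine (\int[mu]_x (f x)%:E).
Definition integ f : Prop := mu.-integrable setT (EFin \o f).
Definition L2 f : Prop :=
  measurable_fun setT f /\ integ (fun x => f x ^+ 2).

Lemma integ_meas f : integ f -> measurable_fun setT f.
Proof. by move=> /measurable_int /measurable_EFinP. Qed.

Lemma meanE f : integ f -> (\int[mu]_x (f x)%:E)%E = (mean f)%:E.
Proof. by move=> If; rewrite fineK//; exact: integrable_fin_num. Qed.

Lemma eq_mean f g : f =1 g -> mean f = mean g.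
Proof. by move=> fg; congr mean; apply/funext. Qed.

Lemma eq_integ f g : f =1 g -> integ f -> integ g.
Proof. by move=> /funext ->. Qed.

Lemma integD f g : integ f -> integ g -> integ (fun x => f x + g x).
Proof. by move=> If Ig; exact: (integrableD measurableT If Ig). Qed.

Lemma integZ c f : integ f -> integ (fun x => c * f x).
Proof. by move=> If; exact: (integrableZl measurableT c If). Qed.

Lemma integN f : integ f -> integ (fun x => - f x).
Proof. by move=> /(integZ (-1)); apply: eq_integ => x; rewrite mulN1r. Qed.

Lemma integB f g : integ f -> integ g -> integ (fun x => f x - g x).
Proof. by move=> If Ig; exact: integD If (integN Ig). Qed.

Lemma integ_cst c : integ (fun=> c).
Proof. exact: finite_measure_integrable_cst. Qed.

Lemma integ_sum I (s : seq I) (Q : pred I) (f : I -> T -> R) :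
  (forall i, Q i -> integ (f i)) -> integ (fun x => \sum_(i <- s | Q i) f i x).
Proof.
move=> If; have := integrable_sum measurableT s (mu := mu) If.
rewrite /integ; congr (_.-integrable _ _).
by apply/funext => x; rewrite /= sumEFin.
Qed.

Lemma le_integ f g : measurable_fun setT f -> (forall x, `|f x| <= g x) ->
  integ g -> integ f.
Proof.
move=> mf fg Ig; apply: (le_integrable measurableT _ _ Ig).
  exact/measurable_EFinP.
by move=> x _ /=; rewrite lee_fin (le_trans (fg x))// ler_norm.
Qed.

Lemma integ_bounded c f : measurable_fun setT f -> (forall x, `|f x| <= c) ->
  integ f.
Proof. by move=> mf fc; exact: (le_integ mf fc (integ_cst c)). Qed.

Lemma meanD f g : integ f -> integ g ->
  mean (fun x => f x + g x) = mean f + mean g.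
Proof.
move=> If Ig; rewrite /mean -fineD; try exact: integrable_fin_num.
by congr fine; exact: (integralD_EFin measurableT If Ig).
Qed.

Lemma meanZ c f : integ f -> mean (fun x => c * f x) = c * mean f.
Proof.
move=> If; rewrite /mean.
under eq_integral do rewrite EFinM.
rewrite (integralZl measurableT If) fineM//; exact: integrable_fin_num.
Qed.

Lemma meanN f : integ f -> mean (fun x => - f x) = - mean f.
Proof.
by move=> If; rewrite -mulN1r -meanZ//; apply: eq_mean => x; rewrite mulN1r.
Qed.

Lemma meanB f g : integ f -> integ g ->
  mean (fun x => f x - g x) = mean f - mean g.
Proof. by move=> If Ig; rewrite meanD ?meanN//; exact: integN. Qed.

Lemma mean_cst c : mean (fun=> c) = c.
Proof. by rewrite /mean integral_cst//= probability_setT mule1. Qed.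

Lemma mean_sum I (s : seq I) (Q : pred I) (f : I -> T -> R) :
  (forall i, Q i -> integ (f i)) ->
  mean (fun x => \sum_(i <- s | Q i) f i x) = \sum_(i <- s | Q i) mean (f i).
Proof.
move=> If; elim: s => [|i s IH].
  by rewrite big_nil -[RHS](mean_cst 0); apply: eq_mean => x; rewrite big_nil.
rewrite big_cons; case: ifP => Qi.
  rewrite -IH -meanD; [|exact: If|exact: integ_sum].
  by apply: eq_mean => x; rewrite big_cons Qi.
by rewrite -IH; apply: eq_mean => x; rewrite big_cons Qi.
Qed.

Lemma le_mean f g : integ f -> integ g -> (forall x, f x <= g x) ->
  mean f <= mean g.
Proof.
move=> If Ig fg; rewrite -lee_fin -!meanE//.
by apply: (le_integral measurableT If Ig) => x _; rewrite /= lee_fin.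
Qed.

Lemma mean_ge0 f : (forall x, 0 <= f x) -> 0 <= mean f.
Proof.
by move=> f0; apply: fine_ge0; apply: integral_ge0 => x _; rewrite lee_fin.
Qed.

Lemma norm_mean f : integ f -> `|mean f| <= mean (fun x => `|f x|).
Proof.
move=> If; have Ia : integ (fun x => `|f x|).
  exact: (integrable_norm (D := setT) If).
rewrite ler_norml -meanN//; apply/andP; split; apply: le_mean => //.
- exact: integN.
- by move=> x; rewrite lerNl -normrN ler_norm.
- by move=> x; rewrite ler_norm.
Qed.

Lemma markov f (c : R) : integ f -> (forall x, 0 <= f x) -> 0 < c ->
  (mu [set x | (c < f x)%R] <= (mean f / c)%:E)%E.
Proof.
move=> If f0 c0.
have mA : measurable [set x | c < f x].
  rewrite -[X in measurable X]setTI.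
  rewrite (_ : [set x | _] = f @^-1` `]c, +oo[%classic).
    exact: (integ_meas If).
  by apply/seteqP; split => x /=; rewrite in_itv /= andbT.
have I1 : integ (\1_[set x | c < f x]).
  apply: (@integ_bounded 1); first exact: measurable_indic.
  by move=> x; rewrite indicE; case: (_ \in _); rewrite ?normr1 ?normr0.
have -> : mu [set x | c < f x] = (mean (\1_[set x | c < f x]))%:E.
  by rewrite -meanE// integral_indic// setIT.
rewrite lee_fin ler_pdivlMr// mulrC -meanZ// le_mean//; first exact: integZ.
move=> x; rewrite indicE; have [/set_mem /= xA|_] := boolP (_ \in _).
  by rewrite mulr1 ltW.
by rewrite mulr0.
Qed.

Lemma L2_meas f : L2 f -> measurable_fun setT f.
Proof. by case. Qed.

Lemma L2M f g : L2 f -> L2 g -> integ (fun x => f x * g x).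
Proof.
move=> [mf If] [mg Ig]; apply: (le_integ _ _ (integD If Ig)).
  exact: measurable_funM.
move=> x; rewrite normrM -[X in _ <= X + _]real_normK ?num_real//.
rewrite -[X in _ <= _ + X]real_normK ?num_real//.
have := sqr_ge0 (`|f x| - `|g x|).
have : 0 <= `|f x| * `|g x| by rewrite mulr_ge0.
nra.
Qed.

Lemma L2D f g : L2 f -> L2 g -> L2 (fun x => f x + g x).
Proof.
move=> Lf Lg; split; first exact: measurable_funD (L2_meas Lf) (L2_meas Lg).
have := integD (integD (proj2 Lf) (integZ 2 (L2M Lf Lg))) (proj2 Lg).
by apply: eq_integ => x; ring.
Qed.

Lemma L2Z c f : L2 f -> L2 (fun x => c * f x).
Proof.
move=> [mf If]; split; first exact: measurable_funM.
have := integZ (c ^+ 2) If.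
by apply: eq_integ => x; rewrite exprMn.
Qed.

Lemma L2N f : L2 f -> L2 (fun x => - f x).
Proof.
move=> /(L2Z (-1)); rewrite (_ : (fun x => -1 * f x) = (fun x => - f x))//.
by apply/funext => x; rewrite mulN1r.
Qed.

Lemma L2B f g : L2 f -> L2 g -> L2 (fun x => f x - g x).
Proof. by move=> Lf Lg; exact: L2D Lf (L2N Lg). Qed.

Lemma L2_bounded c f : measurable_fun setT f -> (forall x, `|f x| <= c) -> L2 f.
Proof.
move=> mf fc; split=> //; apply: (@integ_bounded (c ^+ 2)).
  exact: measurable_funX.
by move=> x; rewrite normrX ler_pXn2r ?nnegrE// (le_trans _ (fc x)).
Qed.

Lemma L2_cst c : L2 (fun=> c).
Proof. exact: (@L2_bounded `|c|). Qed.

Lemma L2_sum I (s : seq I) (Q : pred I) (f : I -> T -> R) :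
  (forall i, Q i -> L2 (f i)) -> L2 (fun x => \sum_(i <- s | Q i) f i x).
Proof.
move=> Lf; elim: s => [|i s IH].
  have := L2_cst 0; congr L2; apply/funext => x; by rewrite big_nil.
case: (boolP (Q i)) => Qi.
  have := L2D (Lf i Qi) IH; congr L2.
  by apply/funext => x; rewrite big_cons Qi.
by move: IH; congr L2; apply/funext => x; rewrite big_cons (negbTE Qi).
Qed.

Lemma L2_integ f : L2 f -> integ f.
Proof.
move=> Lf; have := L2M Lf (L2_cst 1); apply: eq_integ => x; exact: mulr1.
Qed.

Lemma L2Mb c f g : L2 f -> measurable_fun setT g -> (forall x, `|g x| <= c) ->
  L2 (fun x => g x * f x).
Proof.
move=> [mf If] mg gc; split; first exact: measurable_funM.
apply: (le_integ _ _ (integZ (c ^+ 2) If)).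
  by apply: measurable_funX; exact: measurable_funM.
move=> x; rewrite ger0_norm ?sqr_ge0// exprMn ler_wpM2r ?sqr_ge0//.
rewrite -[X in X <= _]real_normK ?num_real//.
by rewrite ler_pXn2r ?nnegrE// (le_trans _ (gc x)).
Qed.

Lemma integMb c f g : integ f -> measurable_fun setT g ->
  (forall x, `|g x| <= c) -> integ (fun x => g x * f x).
Proof.
move=> If mg gc; have Ia : integ (fun x => `|f x|).
  exact: (integrable_norm (D := setT) If).
apply: (le_integ _ _ (integZ c Ia)).
  exact: measurable_funM (integ_meas If).
by move=> x; rewrite normrM ler_wpM2r.
Qed.

(** Expanding the square leaves only the diagonal. *)
Lemma mean_sq_sum (I : finType) (Q : pred I) (W : I -> T -> R) :
  (forall i, Q i -> L2 (W i)) ->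
  (forall i j, Q i -> Q j -> i != j -> mean (fun x => W i x * W j x) = 0) ->
  mean (fun x => (\sum_(i | Q i) W i x) ^+ 2) =
  \sum_(i | Q i) mean (fun x => W i x ^+ 2).
Proof.
move=> LW W0.
transitivity (mean (fun x => \sum_(i | Q i) \sum_(j | Q j) W i x * W j x)).
  by apply: eq_mean => x; rewrite expr2 mulr_suml; apply: eq_bigr => i _;
    rewrite mulr_sumr.
rewrite mean_sum; last first.
  by move=> i Qi; apply: integ_sum => j Qj; apply: L2M; exact: LW.
apply: eq_bigr => i Qi; rewrite mean_sum; last first.
  by move=> j Qj; apply: L2M; exact: LW.
rewrite (bigD1 i)//= [X in _ + X]big1 ?addr0//.
by move=> j /andP[Qj ji]; rewrite W0// eq_sym.
Qed.

Lemma mean_sqD_le f g : L2 f -> L2 g ->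
  mean (fun x => (f x + g x) ^+ 2) <=
  2 * mean (fun x => f x ^+ 2) + 2 * mean (fun x => g x ^+ 2).
Proof.
move=> Lf Lg; have [mf If] := Lf; have [mg Ig] := Lg.
rewrite -!meanZ// -meanD; try exact: integZ.
apply: le_mean; first exact: (proj2 (L2D Lf Lg)).
  by apply: integD; exact: integZ.
by move=> x; have := sqr_ge0 (f x - g x); nra.
Qed.

Lemma variance_le f : L2 f ->
  mean (fun x => (f x - mean f) ^+ 2) <= mean (fun x => f x ^+ 2).
Proof.
move=> Lf; have [mf If2] := Lf; have If := L2_integ Lf.
rewrite (@eq_mean _ (fun x => f x ^+ 2 + ((- 2 * mean f) * f x + mean f ^+ 2)));
  last by move=> x; ring.
rewrite meanD//; last by apply: integD; [exact: integZ|exact: integ_cst].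
rewrite meanD//; [|exact: integZ|exact: integ_cst].
rewrite meanZ// mean_cst.
have := sqr_ge0 (mean f); lra.
Qed.

(** Cauchy-Schwarz, from [2 |f g| <= (B / A) f ^ 2 + (A / B) g ^ 2]. *)
Lemma mean_prod_le f g (A B : R) : L2 f -> L2 g -> 0 < A -> 0 < B ->
  mean (fun x => f x ^+ 2) <= A ^+ 2 -> mean (fun x => g x ^+ 2) <= B ^+ 2 ->
  mean (fun x => `|f x * g x|) <= A * B.
Proof.
move=> Lf Lg A0 B0 fA gB.
have h : mean (fun x => `|f x * g x|) <=
    mean (fun x => (B / A / 2) * f x ^+ 2 + (A / B / 2) * g x ^+ 2).
  apply: le_mean.
  - exact: (integrable_norm (D := setT) (L2M Lf Lg)).
  - by apply: integD; apply: integZ; [case: Lf|case: Lg].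
  move=> x; rewrite normrM -[X in _ <= _ * X + _]real_normK ?num_real//.
  rewrite -[X in _ <= _ + _ * X]real_normK ?num_real//.
  rewrite -subr_ge0.
  have -> : B / A / 2 * `|f x| ^+ 2 + A / B / 2 * `|g x| ^+ 2 - `|f x| * `|g x|
      = (B * `|f x| - A * `|g x|) ^+ 2 / (2 * A * B) by field; rewrite !gt_eqF.
  by rewrite divr_ge0 ?sqr_ge0// !mulr_ge0 ?ltW.
apply: (le_trans h); rewrite meanD; last 2 first.
- by apply: integZ; case: Lf.
- by apply: integZ; case: Lg.
rewrite !meanZ; [|by case: Lg|by case: Lf].
have -> : A * B = (B / A / 2) * A ^+ 2 + (A / B / 2) * B ^+ 2.
  by field; rewrite !gt_eqF.
apply: lerD; apply: ler_wpM2l => //; rewrite !divr_ge0// ?ltW//.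
Qed.

End mean.

Lemma prob_exists_le {R : realType} d (T : measurableType d) (mu : probability T R)
    (I : finType) (A : I -> set T) (B : R) : (forall i, measurable (A i)) ->
  (forall i, (mu (A i) <= B%:E)%E) ->
  measurable [set o | exists i, A i o] /\ (mu [set o | exists i, A i o] <= (#|I|%:R * B)%:E)%E.
Proof.
move=> mA AB.
have h (s : seq I) : measurable (\big[setU/set0]_(i <- s) A i) /\
    (mu (\big[setU/set0]_(i <- s) A i) <= ((size s)%:R * B)%:E)%E.
  elim: s => [|i s [ms IH]]; first by rewrite big_nil measure0 mul0r.
  rewrite big_cons; split; first exact: measurableU.
  apply: (@le_trans _ _ (mu (A i) + mu (\big[setU/set0]_(j <- s) A j))%E).
    exact: measureU2.
  by rewrite /= -natr1 mulrDl mul1r addrC EFinD leeD.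
have -> : [set o | exists i, A i o] = \big[setU/set0]_(i <- enum I) A i.
  rewrite -bigcup_seq; apply/seteqP; split => o.
    by move=> [i h']; exists i => //=; rewrite mem_enum.
  by move=> [i _ h']; exists i.
by have := h (enum I); rewrite -cardE.
Qed.

(** * Resampling one observation of an independent sample *)

Section resample.
Context {R : realType} d (Z : measurableType d) (F : probability Z R) (n : nat).
Implicit Types (i j : 'I_n) (t : n.-tuple Z) (u : Z).

Definition tset i u t : n.-tuple Z := [tuple if j == i then u else tnth t j | j < n].

Lemma tnth_tset i u t j : tnth (tset i u t) j = if j == i then u else tnth t j.
Proof. by rewrite tnth_mktuple. Qed.

Lemma measurable_tset i :
  measurable_fun setT (fun p : n.-tuple Z * Z => tset i p.2 p.1).
Proof.
apply/measurable_fun_tnthP => j.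
rewrite (_ : _ \o _ = fun p => if j == i then p.2 else tnth p.1 j); last first.
  by apply/funext => p /=; rewrite tnth_tset.
case: eqP => _.
  exact: measurable_snd.
exact: (measurableT_comp (measurable_tnth j) measurable_fst).
Qed.

Definition tbox (A : 'I_n -> set Z) : set (n.-tuple Z) :=
  [set t | forall i, A i (tnth t i)].

Lemma measurable_tbox A : (forall i, measurable (A i)) -> measurable (tbox A).
Proof.
move=> mA; rewrite (_ : tbox A = \bigcap_(i in [set: 'I_n]) ((@tnth _ _ ^~ i) @^-1` A i)).
  apply: fin_bigcap_measurable => // i _; rewrite -[X in measurable X]setTI.
  exact: measurable_tnth.
by apply/seteqP; split => t /= h; [move=> i _; exact: h|move=> i; exact: h].
Qed.

(** Boxes are stable under intersection and generate the measurable sets, so they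
    determine the law of the sample. *)
Definition iid_law (mu : set (n.-tuple Z) -> \bar R) : Prop :=
  forall A : 'I_n -> set Z, (forall i, measurable (A i)) ->
    mu (tbox A) = (\prod_i fine (F (A i)))%:E.

Definition tboxes : set (set (n.-tuple Z)) :=
  [set B | exists2 A : 'I_n -> set Z, forall i, measurable (A i) & B = tbox A].

Lemma tboxes_generate :
  (measurable : set (set (n.-tuple Z))) = <<s tboxes >>.
Proof.
apply/seteqP; split; last first.
  apply: smallest_sub; first exact: sigma_algebra_measurable.
  by move=> _ [A mA ->]; exact: measurable_tbox.
apply: smallest_sub; first exact: smallest_sigma_algebra.
rewrite -bigcup_seq => B [i _ [A mA <-]]; apply: sub_sigma_algebra.
exists (fun j => if j == i then A else setT); first by move=> j; case: ifP.
rewrite setTI; apply/seteqP; split => t /=.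
  by move=> At j; case: eqP => [->|].
by move=> /(_ i); rewrite eqxx.
Qed.

Lemma tboxes_setI : setI_closed tboxes.
Proof.
move=> _ _ [A mA ->] [B mB ->]; exists (fun i => A i `&` B i).
  by move=> i; exact: measurableI.
by apply/seteqP; split => t /=; [move=> [h1 h2] i; split|move=> h; split=> i; case: (h i)].
Qed.

Lemma tboxesT : tboxes setT.
Proof. by exists (fun=> setT) => //; apply/seteqP; split. Qed.

Variable mu : probability (n.-tuple Z) R.
Hypothesis muF : iid_law mu.

(** Both sides are probabilities that agree on boxes. *)
Lemma resample_measure i A : measurable A ->
  mu A = (mu \x F)%E ((fun p : n.-tuple Z * Z => tset i p.2 p.1) @^-1` A).
Proof.
move=> mA.
have mphi := measurable_tset i.
pose mix := isMeasurableFun.Build _ _ _ _ _ mphi.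
pose phi : {mfun _ >-> _} := HB.pack (fun p : n.-tuple Z * Z => tset i p.2 p.1) mix.
transitivity (distribution (mu \x F)%E phi A) => //.
apply: (@measure_unique _ _ _ tboxes (fun=> setT)) => //.
- exact: tboxes_generate.
- exact: tboxes_setI.
- by move=> _; exact: tboxesT.
- by rewrite bigcup_const//; exists 0%N.
- move=> _ [B mB ->]; transitivity (\prod_j fine (F (B j)))%:E; first exact: muF.
  transitivity ((mu \x F)%E
      (tbox (fun j => if j == i then setT else B j) `*` B i)); last first.
    rewrite /= /distribution /pushforward; congr (product_measure1 _ _ _).
    apply/seteqP; split => [[t u]|[t u]] /=.
      by move=> [h1 h2] j; rewrite tnth_tset; have := h1 j; case: eqP => [->|].
    move=> h; split; first by move=> j; have := h j; rewrite tnth_tset; case: eqP.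
    by have := h i; rewrite tnth_tset eqxx.
  rewrite product_measure1E//; last by apply: measurable_tbox => j; case: ifP.
  transitivity ((\prod_j fine (F (if j == i then setT else B j)))%:E * F (B i))%E;
    last by congr (_ * _)%E; apply/esym/muF => j; case: ifP.
  rewrite -[X in (_ = _ * X)%E]fineK ?fin_num_measure// -EFinM; congr _%:E.
  rewrite (bigD1 i)//= [in RHS](bigD1 i)//= eqxx probability_setT/= mul1r mulrC.
  by congr (_ * _); apply: eq_bigr => j /negbTE ->.
- move=> k; exact: (le_lt_trans (probability_le1 _ _) (ltry _)).
Qed.

(** Replacing one observation by an independent copy leaves the law of the
    sample unchanged; independence enters every later computation only in this
    form. *)
Lemma resample_ge0 i (f : n.-tuple Z -> \bar R) :
  measurable_fun setT f -> (forall t, (0 <= f t)%E) ->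
  (\int[mu]_t f t = \int[mu]_t \int[F]_u f (tset i u t))%E.
Proof.
move=> mf f0.
have mphi := measurable_tset i.
transitivity (\int[mu \x F]_p f (tset i p.2 p.1))%E; last first.
  rewrite fubini_tonelli1//.
  exact: (measurableT_comp mf mphi).
rewrite -(@ge0_integral_pushforward _ _ _ _ _ _ mphi (mu \x F)%E setT f)//.
by apply: eq_measure_integral => A mA _; exact: (resample_measure i mA).
Qed.

Lemma resample_integrable i (f : n.-tuple Z -> R) : integ mu f ->
  (mu \x F)%E.-integrable setT (fun p => (f (tset i p.2 p.1))%:E).
Proof.
move=> If; have mphi := measurable_tset i.
have mf : measurable_fun setT (EFin \o f) by exact: measurable_int If.
apply/integrableP; split; first exact: (measurableT_comp mf mphi).
move/integrableP : If => [_].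
rewrite (resample_ge0 i)//; last exact: measurableT_comp.
rewrite fubini_tonelli1//.
by apply: measurableT_comp => //; exact: (measurableT_comp mf mphi).
Qed.

(** A term that is centred given the other observations is centred. *)
Lemma resample_mean0 i (f : n.-tuple Z -> R) : integ mu f ->
  (forall t, mean F (fun u => f (tset i u t)) = 0) -> mean mu f = 0.
Proof.
move=> If f0; have mphi := measurable_tset i.
have Ip := resample_integrable i If.
have -> : mean mu f = fine (\int[mu \x F]_p (f (tset i p.2 p.1))%:E)%E.
  rewrite /mean; congr fine.
  have := integral_pushforward mphi (mu := (mu \x F)%E) (f := EFin \o f) (D := setT).
  rewrite preimage_setT => <- //.
    by apply: eq_measure_integral => A mA _; exact: (resample_measure i mA).
  exact: measurable_int If.
rewrite -integral12_prod_meas1//.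
rewrite (ae_eq_integral (cst 0%E))//.
- by rewrite integral0.
- exact: measurable_int (integrable_fubini_F Ip).
have := ae_integrable1 Ip.
apply: filterS => t It _ /=.
rewrite /fubini_F/= -[LHS]fineK; last exact: integrable_fin_num It.
by have := f0 t; rewrite /mean => ->.
Qed.

(** An integral bound that holds given the other observations, taken with a bound
    [g] of the conditional mean. *)
Lemma resample_le i (f g : n.-tuple Z -> R) :
  measurable_fun setT f -> (forall t, 0 <= f t) -> integ mu g ->
  (forall t, (\int[F]_u (f (tset i u t))%:E <= (g t)%:E)%E) ->
  integ mu f /\ mean mu f <= mean mu g.
Proof.
move=> mf f0 Ig fg.
have mEf : measurable_fun setT (EFin \o f) by exact/measurable_EFinP.
have h : (\int[mu]_t (f t)%:E <= (mean mu g)%:E)%E.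
  rewrite (resample_ge0 i)//.
  rewrite -meanE//; apply: ge0_le_integral => //.
  - by move=> t _; apply: integral_ge0 => u _; rewrite lee_fin.
  - apply: (@measurable_fun_fubini_tonelli_F _ _ _ _ _ F
      (fun p : n.-tuple Z * Z => (f (tset i p.2 p.1))%:E)).
      exact: (measurableT_comp mEf (measurable_tset i)).
    by move=> p; rewrite lee_fin.
  - exact: measurable_int Ig.
have If : integ mu f.
  apply/integrableP; split => //.
  under eq_integral do rewrite /= ger0_norm//.
  exact: le_lt_trans h (ltry _).
by split=> //; rewrite -lee_fin -meanE.
Qed.

Lemma mean_tnth i (f : Z -> R) : integ F f ->
  integ mu (fun t => f (tnth t i)) /\ mean mu (fun t => f (tnth t i)) = mean F f.
Proof.
move=> If.
have mf := integ_meas If.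
have mt : measurable_fun setT (fun t : n.-tuple Z => f (tnth t i)).
  exact: (measurableT_comp mf (measurable_tnth i)).
have I1 : integ mu (fun t => f (tnth t i)).
  have [||||+ _] := @resample_le i (fun t => `|f (tnth t i)|)
      (fun=> mean F (fun u => `|f u|)).
  - exact: measurableT_comp.
  - by [].
  - exact: integ_cst.
  - move=> t; under eq_integral do rewrite tnth_tset eqxx.
    by rewrite meanE//; exact: (integrable_norm (D := setT) If).
  move=> Ia; apply: (le_integ mt _ Ia) => t; exact: lexx.
split=> //; apply/eqP; rewrite -subr_eq0.
rewrite -[X in _ - X](mean_cst mu) -meanB//; last exact: integ_cst.
apply/eqP/(@resample_mean0 i).
  by apply: integB => //; exact: integ_cst.
move=> t; rewrite (@eq_mean _ _ _ _ _ (fun u => f u - mean F f)); last first.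
  by move=> u; rewrite tnth_tset eqxx.
by rewrite meanB// ?mean_cst ?subrr//; exact: integ_cst.
Qed.

Lemma L2_tnth i (f : Z -> R) : L2 F f -> L2 mu (fun t => f (tnth t i)).
Proof.
move=> [mf If]; split; first exact: (measurableT_comp mf (measurable_tnth i)).
exact: (proj1 (mean_tnth i If)).
Qed.

(** Two distinct terms are uncorrelated, as one sees by resampling one of the two
    observations. *)
Lemma mean_sq_wsum (S : {set 'I_n}) (w : 'I_n -> R) (f : Z -> R) :
  L2 F f -> mean F f = 0 ->
  L2 mu (fun t => \sum_(i in S) w i * f (tnth t i)) /\
  mean mu (fun t => (\sum_(i in S) w i * f (tnth t i)) ^+ 2) =
  (\sum_(i in S) w i ^+ 2) * mean F (fun u => f u ^+ 2).
Proof.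
move=> Lf f0.
have LW i : L2 mu (fun t => w i * f (tnth t i)) by exact/L2Z/L2_tnth.
split; first by apply: L2_sum => i _.
rewrite mean_sq_sum//.
  rewrite mulr_suml; apply: eq_bigr => i _.
  rewrite -(proj2 (mean_tnth i (proj2 Lf))) -meanZ.
    by apply: eq_mean => t; rewrite exprMn.
  exact: (proj1 (mean_tnth i (proj2 Lf))).
move=> i j _ _ ij; apply: (@resample_mean0 i).
  exact: L2M.
move=> t.
rewrite (@eq_mean _ _ _ _ _ (fun u => (w i * (w j * f (tnth t j))) * f u)); last first.
  by move=> u; rewrite !tnth_tset eqxx eq_sym (negbTE ij); ring.
by rewrite meanZ ?f0 ?mulr0//; exact: L2_integ.
Qed.

(** For the moment generating function of a sum: each factor is integrated out by
    resampling its observation. *)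
Lemma integral_prod (S : seq 'I_n) (f : Z -> R) :
  uniq S -> measurable_fun setT f -> (forall u, 0 <= f u) ->
  (\int[mu]_t (\prod_(i <- S) f (tnth t i))%:E =
   \prod_(i <- S) (\int[F]_u (f u)%:E))%E.
Proof.
move=> + mf f0; elim: S => [_|i S IH /= /andP[iS uS]].
  rewrite big_nil; under eq_integral do rewrite big_nil.
  by rewrite integral_cst//= probability_setT mule1.
have mp (S' : seq 'I_n) : measurable_fun setT
    (fun t : n.-tuple Z => \prod_(i <- S') f (tnth t i)).
  apply: measurable_prod => j _.
  exact: (measurableT_comp mf (measurable_tnth j)).
have p0 (S' : seq 'I_n) t : 0 <= \prod_(i <- S') f (tnth t i).
  by apply: prodr_ge0.
rewrite (resample_ge0 i); last 2 first.
- exact/measurable_EFinP.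
- by move=> t; rewrite lee_fin.
have E t : (\int[F]_u (\prod_(j <- i :: S) f (tnth (tset i u t) j))%:E =
    (\prod_(j <- S) f (tnth t j))%:E * \int[F]_u (f u)%:E)%E.
  rewrite -ge0_integralZl//; last 3 first.
  - exact/measurable_EFinP.
  - by move=> u _; rewrite lee_fin.
  - by rewrite lee_fin.
  apply: eq_integral => u _; rewrite big_cons tnth_tset eqxx mulrC -EFinM.
  congr (_ * _)%:E; rewrite big_seq [RHS]big_seq; apply: eq_bigr => j jS.
  by rewrite tnth_tset; case: eqP => // ji; rewrite -ji jS in iS.
under eq_integral do rewrite E.
rewrite ge0_integralZr//; last 3 first.
- exact/measurable_EFinP.
- by move=> t _; rewrite lee_fin.
- by apply: integral_ge0 => u _; rewrite lee_fin.
by rewrite IH// big_cons muleC.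
Qed.

End resample.

(** * Conditional means and exponential inequalities *)

Section conditional_mean.
Context {R : realType} dZ dX (Z : measurableType dZ) (X : measurableType dX).
Variables (F : probability Z R) (x : Z -> X).
Hypothesis mx : measurable_fun setT x.

Import HBNNSimple.

Lemma orthogonal_sfun (f : Z -> R) : integ F f ->
  (forall B, measurable B -> (\int[F]_(u in x @^-1` B) (f u)%:E = 0)%E) ->
  forall g : {nnsfun X >-> R}, mean F (fun u => g (x u) * f u) = 0.
Proof.
move=> If f0 g.
have mB k : measurable (g @^-1` [set k]) by [].
have mxB B : measurable B -> measurable (x @^-1` B).
  by move=> mB'; rewrite -[X in measurable X]setTI; exact: mx.
rewrite (@eq_mean _ _ _ _ _ (fun u => \sum_(k <- fset_set (range g))
    k * (f u * \1_(x @^-1` (g @^-1` [set k])) u))); last first.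
  move=> u; rewrite {1}fimfunE fsbig_finite//= mulr_suml; apply: eq_bigr => k _.
  by rewrite -mulrA; congr (_ * _); rewrite mulrC.
have Ik k : integ F (fun u => f u * \1_(x @^-1` (g @^-1` [set k])) u).
  apply: (@eq_integ _ _ _ _ (fun u => \1_(x @^-1` (g @^-1` [set k])) u * f u)).
    by move=> u; rewrite mulrC.
  apply: (@integMb _ _ _ _ 1) => //; first exact/measurable_indic/mxB.
  by move=> u; rewrite indicE; case: (_ \in _); rewrite ?normr1 ?normr0.
rewrite mean_sum; last by move=> k _; exact: integZ.
rewrite big1// => k _; rewrite meanZ// /mean.
have -> : (\int[F]_u (f u * \1_(x @^-1` (g @^-1` [set k])) u)%:E)%E =
    (\int[F]_(u in x @^-1` (g @^-1` [set k])) (f u)%:E)%E.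
  rewrite [RHS]integral_mkcond; apply: eq_integral => u _.
  rewrite patchE indicE; case: (u \in _); first by rewrite mulr1.
  by rewrite mulr0.
by rewrite f0// mulr0.
Qed.

(** Orthogonality to the indicators of events about [x] extends to bounded
    functions of [x], by approximating these from below by simple functions. *)
Lemma orthogonal_bounded (f : Z -> R) : integ F f ->
  (forall B, measurable B -> (\int[F]_(u in x @^-1` B) (f u)%:E = 0)%E) ->
  forall (H : X -> R) (c : R), measurable_fun setT H -> (forall v, `|H v| <= c) ->
  mean F (fun u => H (x u) * f u) = 0.
Proof.
move=> If f0.
have pos (H : X -> R) (c : R) : measurable_fun setT H ->
    (forall v, 0 <= H v <= c) -> mean F (fun u => H (x u) * f u) = 0.
  move=> mH Hc.
  have mEH : measurable_fun setT (EFin \o H) by exact/measurable_EFinP.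
  pose g := nnsfun_approx measurableT mEH.
  have H0 v : setT v -> (0 <= (EFin \o H) v)%E.
    by move=> _; rewrite lee_fin; case/andP: (Hc v).
  have gH v := cvg_nnsfun_approx measurableT mEH H0 (I : setT v).
  have gH' v : (g n v @[n --> \oo] --> H v).
    by have /fine_cvgP[_] := gH v.
  have gle n v : g n v <= H v.
    have nd : nondecreasing_seq (g ^~ v).
      by move=> a b ab; have /lefP := nd_nnsfun_approx measurableT mEH ab; exact.
    have := nondecreasing_cvgn_le nd (cvgP _ (gH' v)) n.
    by rewrite (cvg_lim _ (gH' v)).
  have mgx n : measurable_fun setT (fun u => g n (x u)).
    exact: (measurableT_comp (measurable_funPT (g n)) mx).
  have Ia : integ F (fun u => c * `|f u|).
    exact/integZ/(integrable_norm (D := setT) If).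
  have mf := integ_meas If.
  have [|||||_ _] := @dominated_convergence _ _ _ F setT measurableT
    (fun n u => (g n (x u) * f u)%:E) (fun u => (H (x u) * f u)%:E)
    (fun u => (c * `|f u|)%:E).
  - by move=> n; apply/measurable_EFinP; exact: measurable_funM.
  - apply/measurable_EFinP; apply: measurable_funM => //.
    exact: measurableT_comp mH mx.
  - apply: aeW => u _; apply: cvg_EFin; first exact: nearW.
    by apply: cvgM; [exact: gH'|exact: cvg_cst].
  - exact: Ia.
  - apply: aeW => u n _; rewrite /= lee_fin normrM ler_wpM2r//.
    rewrite ger0_norm//; apply: (le_trans (gle n _)).
    by case/andP: (Hc (x u)).
  rewrite (_ : [sequence _]_n = fun=> 0%E); last first.
    apply/funext => n /=; rewrite meanE.
      by rewrite orthogonal_sfun.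
    apply: (@integMb _ _ _ _ c) => // u; rewrite ger0_norm//.
    by apply: (le_trans (gle n _)); case/andP: (Hc (x u)).
  move=> /(cvg_lim (@ereal_hausdorff R)); rewrite lim_cst//; last first.
  by rewrite /mean => <-.
move=> H c mH Hc.
have c0 : 0 <= c by apply: le_trans (Hc point).
have mf := integ_meas If.
have IH : integ F (fun u => H (x u) * f u).
  by apply: (@integMb _ _ _ _ c) => //; exact: measurableT_comp mH mx.
have h1 := pos (fun v => H v + c) (2 * c) (measurable_funD mH (measurable_cst _)).
have h2 := pos (fun=> c) c (measurable_cst _).
have e : mean F (fun u => (H (x u) + c) * f u) =
    mean F (fun u => H (x u) * f u) + mean F (fun u => c * f u).
  rewrite -meanD//; last exact: integZ.
  by apply: eq_mean => u; rewrite mulrDl.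
have : mean F (fun u => H (x u) * f u) + mean F (fun u => c * f u) = 0.
  rewrite -e h1// => v; have := Hc v; rewrite ler_norml => /andP[? ?].
  by clear h1 h2 e pos; apply/andP; split; lra.
by rewrite (h2 _) ?addr0// => v; rewrite lexx andbT.
Qed.

(** The identity that defines a conditional mean tests it on events only. *)
Lemma cond_mean_bounded (Y : Z -> R) (h : X -> R) :
  is_cond_mean F Y x h ->
  forall (H : X -> R) (c : R), measurable_fun setT H -> (forall v, `|H v| <= c) ->
  mean F (fun u => H (x u) * (Y u - h (x u))) = 0.
Proof.
move=> [IY mh Ih hE]; apply: orthogonal_bounded; first exact: integB.
move=> B mB.
have mxB : measurable (x @^-1` B).
  by rewrite -[X in measurable X]setTI; exact: mx.
have IYB := integrableS measurableT mxB (@subsetT _ _) IY.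
have IhB := integrableS measurableT mxB (@subsetT _ _) Ih.
have := integralB_EFin mxB IYB IhB => /= ->.
by rewrite hE// subee// integrable_fin_num.
Qed.

End conditional_mean.

Section chernoff.
Context {R : realType} d (Z : measurableType d) (F : probability Z R) (n : nat).
Variable mu : probability (n.-tuple Z) R.
Hypothesis muF : iid_law F mu.

Lemma expR_le_quadratic (s : R) : s <= 2^-1 -> expR s <= 1 + s + 2 * s ^+ 2.
Proof.
move=> s2; have s1 : 0 < 1 - s by lra.
have h : 1 - s <= (expR s)^-1 by rewrite -expRN; exact: expR_ge1Dx.
have h2 : expR s <= (1 - s)^-1.
  by rewrite -[expR s]invrK lef_pV2 ?posrE ?invr_gt0 ?expR_gt0.
apply: (le_trans h2); rewrite -[leLHS]mul1r ler_pdivrMr//.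
rewrite -subr_ge0.
have -> : (1 + s + 2 * s ^+ 2) * (1 - s) - 1 = s ^+ 2 * (1 - 2 * s) by ring.
by rewrite mulr_ge0 ?sqr_ge0//; lra.
Qed.

(** Bernstein's inequality, with the parameter [l] of the exponential moment
    left free. *)
Lemma chernoff (S : {set 'I_n}) (f : Z -> R) (b v l t : R) :
  measurable_fun setT f -> (forall u, `|f u| <= b) -> mean F f = 0 ->
  mean F (fun u => f u ^+ 2) <= v -> 0 < l -> l * b <= 2^-1 ->
  (mu [set o | (t * #|S|%:R < \sum_(i in S) f (tnth o i))%R] <=
   (expR (#|S|%:R * (2 * l ^+ 2 * v - l * t)))%:E)%E.
Proof.
move=> mf fb f0 fv l_gt0 lb; have l0 := ltW l_gt0.
have lf u : l * f u <= 2^-1.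
  apply: le_trans lb; apply: ler_wpM2l => //.
  by apply: le_trans (fb u); exact: ler_norm.
pose e u := expR (l * f u).
have me : measurable_fun setT e.
  by apply: measurableT_comp => //; exact: measurable_funM.
have e0 u : 0 <= e u by exact: expR_ge0.
have eb u : `|e u| <= expR 2^-1 by rewrite ger0_norm// ler_expR.
have Ie : integ F e by apply: integ_bounded eb.
have If : integ F f by apply: integ_bounded fb.
have If2 : integ F (fun u => f u ^+ 2) by exact: (proj2 (L2_bounded _ mf fb)).
have Ee : mean F e <= expR (2 * l ^+ 2 * v).
  apply: le_trans (expR_ge1Dx _).
  apply: (@le_trans _ _ (mean F (fun u => 1 + (l * f u + (2 * l ^+ 2) * f u ^+ 2)))).
    apply: le_mean => //.
      by apply: integD; [exact: integ_cst|apply: integD; exact: integZ].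
    move=> u; apply: (le_trans (expR_le_quadratic (lf u))).
    by rewrite exprMn -addrA; lra.
  rewrite meanD ?mean_cst; [|exact: integ_cst|by apply: integD; exact: integZ].
  rewrite meanD; [|exact: integZ|exact: integZ].
  rewrite !meanZ// f0 mulr0 add0r lerD2l ler_wpM2l// mulr_ge0// sqr_ge0//.
have mt i : measurable_fun setT (fun o : n.-tuple Z => e (tnth o i)).
  exact: (measurableT_comp me (measurable_tnth i)).
have mp : measurable_fun setT (fun o : n.-tuple Z => \prod_(i <- enum S) e (tnth o i)).
  by apply: measurable_prod => i _; exact: mt.
have p0 (o : n.-tuple Z) : 0 <= \prod_(i <- enum S) e (tnth o i).
  by apply: prodr_ge0.
have Ep := integral_prod muF (enum_uniq S) me e0.
rewrite (eq_bigr (fun=> (mean F e)%:E)) in Ep; last by move=> i _; rewrite meanE.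
have Ip : integ mu (fun o : n.-tuple Z => \prod_(i <- enum S) e (tnth o i)).
  apply/integrableP; split; first exact/measurable_EFinP.
  under eq_integral do rewrite /= ger0_norm//.
  by rewrite Ep prodEFin ltry.
have Mp : mean mu (fun o : n.-tuple Z => \prod_(i <- enum S) e (tnth o i)) =
    mean F e ^+ #|S|.
  rewrite [LHS]/mean Ep prodEFin/= big_const_seq count_predT -cardE.
  by rewrite iter_mulr_1.
have := markov Ip p0 (expR_gt0 (l * (t * #|S|%:R))).
rewrite (_ : [set o | _] = [set o | (t * #|S|%:R < \sum_(i in S) f (tnth o i))%R]).
  move=> /le_trans; apply; rewrite lee_fin Mp -expRN.
  have -> : #|S|%:R * (2 * l ^+ 2 * v - l * t) =
      2 * l ^+ 2 * v * #|S|%:R + - (l * (t * #|S|%:R)) by ring.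
  rewrite expRD ler_pM2r ?expR_gt0// expRM_natr lerXn2r ?nnegrE ?expR_ge0//.
  exact: mean_ge0.
apply/seteqP; split => o /=; rewrite -expR_sum ltr_expR -mulr_sumr ltr_pM2l// big_enum//.
Qed.

(** From [chernoff] for [f - mean F f] and its opposite: centring at most doubles
    the sup norm and does not increase the second moment. *)
Lemma chernoff_abs (S : {set 'I_n}) (f : Z -> R) (b v l t : R) :
  measurable_fun setT f -> (forall u, `|f u| <= b) ->
  mean F (fun u => f u ^+ 2) <= v -> 0 < l -> l * (2 * b) <= 2^-1 ->
  (mu [set o | (t * #|S|%:R < `|\sum_(i in S) (f (tnth o i) - mean F f)|)%R] <=
   (2 * expR (#|S|%:R * (2 * l ^+ 2 * v - l * t)))%:E)%E.
Proof.
move=> mf fb fv l0 lb.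
have Lf := L2_bounded F mf fb.
pose g u := f u - mean F f.
have mg : measurable_fun setT g by exact: measurable_funB.
have gb u : `|g u| <= 2 * b.
  apply: (le_trans (ler_normB _ _)); rewrite mulr2n mulrDl mul1r lerD//.
  apply: (le_trans (norm_mean (L2_integ Lf))).
  rewrite -[leRHS](mean_cst F); apply: le_mean => //; last exact: integ_cst.
  exact: (integrable_norm (D := setT) (L2_integ Lf)).
have g0 : mean F g = 0.
  by rewrite meanB ?mean_cst ?subrr//; [exact: L2_integ|exact: integ_cst].
have gv : mean F (fun u => g u ^+ 2) <= v by exact: le_trans (variance_le Lf) fv.
have h1 := chernoff S t mg gb g0 gv l0 lb.
have mNg : measurable_fun setT (fun u => - g u) by exact: measurableT_comp.
have h2 := @chernoff S (fun u => - g u) (2 * b) v l t mNg _ _ _ l0 lb.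
have {}h2 : (mu [set o | (t * #|S|%:R < - \sum_(i in S) g (tnth o i))%R] <=
   (expR (#|S|%:R * (2 * l ^+ 2 * v - l * t)))%:E)%E.
  under eq_set do rewrite -sumrN.
  apply: h2.
  - by move=> u; rewrite normrN.
  - by rewrite meanN ?g0 ?oppr0//; apply: L2_integ; exact: (L2_bounded F mg gb).
  - by under eq_mean do rewrite sqrrN.
have mS : measurable_fun setT (fun o : n.-tuple Z => \sum_(i in S) g (tnth o i)).
  rewrite (_ : (fun _ => _) = fun o => \sum_(i <- enum S) g (tnth o i)).
    by apply: measurable_sum => i; exact: (measurableT_comp mg (measurable_tnth i)).
  by apply/funext => o; rewrite big_enum.
have mset (h : n.-tuple Z -> R) : measurable_fun setT h ->
    measurable [set o | (t * #|S|%:R < h o)%R].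
  move=> mh; rewrite -[X in measurable X]setTI.
  rewrite (_ : [set o | _] = h @^-1` `]t * #|S|%:R, +oo[%classic); first exact: mh.
  by apply/seteqP; split => o /=; rewrite in_itv /= andbT.
rewrite mulr2n mulrDl mul1r EFinD.
apply: le_trans (leeD h1 h2).
have mA1 := mset _ mS.
have mA2 : measurable [set o : n.-tuple Z | (t * #|S|%:R < - \sum_(i in S) g (tnth o i))%R].
  by apply: mset; exact: measurableT_comp.
apply: (@le_trans _ _ (mu ([set o : n.-tuple Z | (t * #|S|%:R < \sum_(i in S) g (tnth o i))%R] `|`
    [set o : n.-tuple Z | (t * #|S|%:R < - \sum_(i in S) g (tnth o i))%R]))); last first.
  exact: measureU2.
apply: le_measure.
- by apply/mem_set; apply: mset; exact: measurableT_comp.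
- by apply/mem_set; exact: measurableU.
- by move=> o /=; rewrite real_lter_normr ?num_real// => /orP.
Qed.

End chernoff.

(** * Quadratic forms and extreme eigenvalues *)

Section quadratic_forms.
Context {R : realType} {n : nat}.
Implicit Types (A G : 'M[R]_n) (u v b : 'cV[R]_n).

Definition dot u v : R := \sum_i u i 0 * v i 0.
Definition sqn u : R := \sum_i u i 0 ^+ 2.
Definition qform A u : R := dot u (A *m u).

Lemma dotE u v : (u^T *m v) 0 0 = dot u v.
Proof. by rewrite mxE; apply: eq_bigr => i _; rewrite mxE. Qed.

Lemma dotC u v : dot u v = dot v u.
Proof. by apply: eq_bigr => i _; rewrite mulrC. Qed.

Lemma dotDr u v w : dot u (v + w) = dot u v + dot u w.
Proof. by rewrite -big_split; apply: eq_bigr => i _; rewrite mxE mulrDr. Qed.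

Lemma dotZr c u v : dot u (c *: v) = c * dot u v.
Proof. by rewrite mulr_sumr; apply: eq_bigr => i _; rewrite mxE mulrCA. Qed.

Lemma dotZl c u v : dot (c *: u) v = c * dot u v.
Proof. by rewrite dotC dotZr dotC. Qed.

Lemma dotNr u v : dot u (- v) = - dot u v.
Proof. by rewrite -scaleN1r dotZr mulN1r. Qed.

Lemma dotBr u v w : dot u (v - w) = dot u v - dot u w.
Proof. by rewrite dotDr dotNr. Qed.

Lemma dotBl u v w : dot (u - v) w = dot u w - dot v w.
Proof. by rewrite dotC dotBr !(dotC w). Qed.

Lemma dot_sumr I (s : seq I) (Q : pred I) u (f : I -> 'cV[R]_n) :
  dot u (\sum_(i <- s | Q i) f i) = \sum_(i <- s | Q i) dot u (f i).
Proof.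
rewrite /dot exchange_big /=; apply: eq_bigr => i _.
by rewrite summxE mulr_sumr.
Qed.

Lemma dot_mulmx A u v : dot u (A *m v) = dot (A^T *m u) v.
Proof. by rewrite -!dotE trmx_mul trmxK mulmxA. Qed.

Lemma dotE2 A u v : dot u (A *m v) = \sum_i \sum_j A i j * (u i 0 * v j 0).
Proof.
apply: eq_bigr => i _; rewrite mxE mulr_sumr; apply: eq_bigr => j _; ring.
Qed.

Lemma sqnE u : sqn u = dot u u.
Proof. by apply: eq_bigr => i _; rewrite expr2. Qed.

Lemma sqn_ge0 u : 0 <= sqn u.
Proof. by apply: sumr_ge0 => i _; exact: sqr_ge0. Qed.

Lemma sqn_eq0 u : (sqn u == 0) = (u == 0).
Proof.
apply/eqP/eqP => [u0|->]; last by rewrite /sqn big1// => i _; rewrite mxE expr0n.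
apply/matrixP => i j; rewrite ord1 mxE; apply/eqP; rewrite -sqrf_eq0.
move/eqP: u0; rewrite psumr_eq0; last by move=> k _; exact: sqr_ge0.
by move=> /allP /(_ i (mem_index_enum i)).
Qed.

Lemma sqnZ c u : sqn (c *: u) = c ^+ 2 * sqn u.
Proof. by rewrite !sqnE dotZl dotZr; ring. Qed.

Lemma sqnN u : sqn (- u) = sqn u.
Proof. by apply: eq_bigr => i _; rewrite mxE sqrrN. Qed.

Lemma sqnB u v : sqn (u - v) = sqn u - 2 * dot u v + sqn v.
Proof. by rewrite !sqnE dotBl !dotBr (dotC v u); ring. Qed.

(** Cauchy-Schwarz, from [0 <= sqn (sqn v *: u - dot u v *: v)]. *)
Lemma dot_sq_le u v : dot u v ^+ 2 <= sqn u * sqn v.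
Proof.
have [->|v0] := eqVneq v 0.
  have -> : dot u 0 = 0 by rewrite /dot big1// => i _; rewrite mxE mulr0.
  by rewrite expr0n mulr_ge0 ?sqn_ge0.
have v1 : 0 < sqn v by rewrite lt_def sqn_eq0 v0 sqn_ge0.
have := sqn_ge0 (sqn v *: u - dot u v *: v).
rewrite sqnB !sqnZ dotZl dotZr.
have -> : sqn v ^+ 2 * sqn u - 2 * (sqn v * (dot u v * dot u v)) +
    dot u v ^+ 2 * sqn v = sqn v * (sqn u * sqn v - dot u v ^+ 2) by ring.
by rewrite pmulr_rge0// subr_ge0.
Qed.

(** From [0 <= sqn (t *: u - v)] and [0 <= sqn (t *: u + v)]. *)
Lemma norm_dot_le u v (t : R) : 0 < t ->
  `|dot u v| <= (t * sqn u + t^-1 * sqn v) / 2.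
Proof.
move=> t0.
have h w : 0 <= t * sqn u - 2 * dot u w + t^-1 * sqn w.
  have := sqn_ge0 (t *: u - w); rewrite sqnB sqnZ dotZl => h.
  rewrite -(pmulr_rge0 _ t0).
  have -> : t * (t * sqn u - 2 * dot u w + t^-1 * sqn w) =
      t ^+ 2 * sqn u - 2 * (t * dot u w) + (t * t^-1) * sqn w by ring.
  by rewrite divff ?gt_eqF// mul1r.
have h1 := h v; have h2 := h (- v); rewrite sqnN dotNr in h2.
by rewrite ler_norml; apply/andP; split; lra.
Qed.

Lemma qformE A u : qform A u = \sum_i \sum_j A i j * (u i 0 * u j 0).
Proof. exact: dotE2. Qed.

Lemma qformB A B u : qform (A - B) u = qform A u - qform B u.
Proof. by rewrite /qform mulmxBl dotBr. Qed.

Lemma qform_scalar c u : qform c%:M u = c * sqn u.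
Proof. by rewrite /qform mul_scalar_mx dotZr sqnE. Qed.

(** A symmetric nonnegative quadratic form vanishes only on its kernel: moving
    away from a zero in any direction would make the form negative to first
    order. *)
Lemma psd_kernel A u : A^T = A -> (forall v, 0 <= qform A v) ->
  qform A u = 0 -> A *m u = 0.
Proof.
move=> sA A0 u0; apply/eqP; rewrite -sqn_eq0; apply/eqP/le_anti.
rewrite sqn_ge0 andbT; set w := A *m u.
have key (e : R) : 0 <= e ^+ 2 * qform A w - 2 * e * sqn w.
  have := A0 (u - e *: w); rewrite /qform mulmxBr -scalemxAr dotBl !dotBr.
  rewrite -/(qform A u) u0 !dotZl !dotZr -/w.
  have -> : dot u (A *m w) = sqn w by rewrite dot_mulmx sA sqnE.
  rewrite -/(qform A w) sqnE; lra.
rewrite leNgt; apply/negP => w0.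
have q0 : 0 <= qform A w by exact: A0.
have := key (sqn w / (qform A w + 1)).
have q1 : 0 < qform A w + 1 by lra.
have -> : (sqn w / (qform A w + 1)) ^+ 2 * qform A w -
    2 * (sqn w / (qform A w + 1)) * sqn w =
    - (sqn w ^+ 2 / (qform A w + 1) ^+ 2) * (qform A w + 2).
  by field; rewrite gt_eqF.
rewrite mulNr oppr_ge0 leNgt => /negP; apply.
by rewrite mulr_gt0 ?divr_gt0 ?exprn_gt0//; lra.
Qed.

Lemma continuous_qform_tr A : continuous (fun v : 'rV[R]_n => qform A v^T).
Proof.
move=> v; rewrite (_ : (fun _ => _) =
    fun v : 'rV[R]_n => \sum_i \sum_j A i j * (v 0 i * v 0 j)); last first.
  apply/funext => t; rewrite qformE; apply: eq_bigr => i _.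
  by apply: eq_bigr => j _; rewrite !mxE.
have cs (f : 'I_n -> 'rV[R]_n -> R) : (forall i, continuous (f i)) ->
    continuous (fun t => \sum_i f i t).
  move=> cf; apply: (@continuous_big _ _ +%R 0 xpredT _ _ _ f) => //.
  exact: add_continuous.
apply: (cs (fun i t => \sum_j A i j * (t 0 i * t 0 j))) => i.
apply: (cs (fun j t => A i j * (t 0 i * t 0 j))) => j t.
have ct k : {for t, continuous (fun v : 'rV[R]_n => v 0 k)} by exact: coord_continuous.
have c2 := @continuousM _ _ _ _ t (ct i) (ct j).
exact: (@continuousM _ _ (fun=> A i j) _ t (@cst_continuous _ _ _ t) c2).
Qed.

(** The smallest value of the form on the unit sphere exists by compactness, and
    is an eigenvalue by [psd_kernel]. *)
Lemma rayleigh_min A : A^T = A -> (0 < n)%N ->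
  exists2 c, eigenvalue A c & forall u, c * sqn u <= qform A u.
Proof.
move=> sA n0.
pose S := [set v : 'rV[R]_n | sqn v^T = 1].
have sqnq (v : 'rV[R]_n) : sqn v^T = qform 1%:M v^T by rewrite qform_scalar mul1r.
have cS : compact S.
  apply: (@subclosed_compact _ _ [set v : 'rV[R]_n | forall i, `[(-1 : R), 1]%classic (v ord0 i)]).
  - apply: (@preimage_closed _ _ (fun v : 'rV[R]_n => sqn v^T) [set 1]); last first.
      exact: closed_eq.
    move=> v _; rewrite (_ : (fun _ => _) = fun v : 'rV[R]_n => qform 1%:M v^T).
      exact: continuous_qform_tr.
    by apply/funext => t; rewrite sqnq.
  - exact: rV_compact (fun=> @segment_compact _ _ _).
  - move=> v /= v1 i; rewrite in_itv/= -ler_norml.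
    rewrite -(@ler_pXn2r _ 2)// ?nnegrE// expr1n real_normK ?num_real//.
    rewrite -v1 /sqn (bigD1 i)//= mxE lerDl.
    by apply: sumr_ge0 => j _; exact: sqr_ge0.
have S0 : S !=set0.
  exists (delta_mx 0 (Ordinal n0)); rewrite /S /= /sqn (bigD1 (Ordinal n0))//=.
  rewrite !mxE !eqxx expr1n big1 ?addr0// => j /negbTE ji.
  by rewrite !mxE ji expr0n.
have [|v vS vmin] := @compact_EVT_min _ _ (fun v : 'rV[R]_n => qform A v^T) S S0 cS.
  exact/continuous_subspaceT/continuous_qform_tr.
move/set_mem: vS => v1; rewrite /S /= in v1.
set c := qform A v^T in vmin.
have cmin u : c * sqn u <= qform A u.
  have [->|u0] := eqVneq u 0.
    by rewrite /qform mulmx0 /dot /sqn !big1 ?mulr0// => i _; rewrite mxE ?mul0r ?expr0n.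
  have s0 : 0 < sqn u by rewrite lt_def sqn_eq0 u0 sqn_ge0.
  have r0 : 0 < Num.sqrt (sqn u) by rewrite sqrtr_gt0.
  have /vmin : ((Num.sqrt (sqn u))^-1 *: u)^T \in S.
    apply/mem_set; rewrite /S /= trmxK sqnZ exprVn sqr_sqrtr ?ltW//.
    by rewrite mulVf ?gt_eqF.
  rewrite trmxK /qform -scalemxAr dotZl dotZr mulrA -expr2 exprVn.
  by rewrite (sqr_sqrtr (ltW s0)) => h; rewrite -ler_pdivlMr// mulrC.
exists c => //.
have k0 : (A - c%:M) *m v^T = 0.
  apply: psd_kernel.
  - by rewrite linearB/= tr_scalar_mx sA.
  - by move=> u; rewrite qformB qform_scalar subr_ge0.
  - by rewrite qformB qform_scalar v1 mulr1 subrr.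
apply/eigenvalueP; exists v; last first.
  apply/eqP => v0; move: v1; rewrite v0 trmx0 /sqn big1 => [/eqP|i _].
    by rewrite eq_sym oner_eq0.
  by rewrite mxE expr0n.
move/(congr1 trmx): k0; rewrite trmx_mul trmxK linearB/= tr_scalar_mx sA trmx0.
by rewrite mulmxBr mul_mx_scalar => /eqP; rewrite subr_eq0 => /eqP.
Qed.

Lemma eigenvalue_qform A c : A^T = A -> eigenvalue A c ->
  exists2 u, u != 0 & qform A u = c * sqn u.
Proof.
move=> sA /eigenvalueP[v vA v0]; exists v^T; first by rewrite trmx_eq0.
rewrite /qform; have -> : A *m v^T = c *: v^T.
  by rewrite -{1}sA -trmx_mul vA linearZ.
by rewrite dotZr sqnE.
Qed.

(** The Rayleigh minimum is an eigenvalue and a lower bound of all others, so it is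
    the infimum of the spectrum. In dimension 0 both sides vanish. *)
Lemma lambda_min_le A u : A^T = A -> lambda_min A * sqn u <= qform A u.
Proof.
move=> sA; have [n0|n0] := posnP n.
  have e0 (f : 'I_n -> R) : \sum_i f i = 0.
    by rewrite big1// => -[i im]; exfalso; rewrite n0 in im.
  by rewrite /sqn /qform /dot !e0 mulr0.
have [c Ac cmin] := rayleigh_min sA n0.
apply: le_trans (cmin u); rewrite ler_wpM2r ?sqn_ge0//.
apply: ge_inf => //; exists c => e /= /(eigenvalue_qform sA)[w w0 we].
have := cmin w; rewrite we ler_pM2r// lt_def sqn_eq0 w0; exact: sqn_ge0.
Qed.

End quadratic_forms.

Section quadratic_forms2.
Context {R : realType} {n : nat}.
Implicit Types (A G : 'M[R]_n) (u v b : 'cV[R]_n).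

Lemma eigenvalueN A c : eigenvalue (- A) c -> eigenvalue A (- c).
Proof.
move=> /eigenvalueP[v vA v0]; apply/eigenvalueP; exists v => //.
by rewrite scaleNr -vA mulmxN opprK.
Qed.

Lemma lambda_max_ge A u : A^T = A -> qform A u <= lambda_max A * sqn u.
Proof.
move=> sA; have [n0|n0] := posnP n.
  have e0 (f : 'I_n -> R) : \sum_i f i = 0.
    by rewrite big1// => -[i im]; exfalso; rewrite n0 in im.
  by rewrite /sqn /qform /dot !e0 mulr0.
have sNA : (- A)^T = - A by rewrite linearN/= sA.
have [c Ac cmin] := rayleigh_min sNA n0.
have qN w : qform (- A) w = - qform A w by rewrite /qform mulNmx dotNr.
apply: (@le_trans _ _ (- c * sqn u)).
  by rewrite mulNr lerNr -qN.
rewrite ler_wpM2r ?sqn_ge0//; apply: ub_le_sup; last exact: eigenvalueN.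
exists (- c) => e /= /(eigenvalue_qform sA)[w w0 we].
have := cmin w; rewrite qN we lerNr -mulNr ler_pM2r// lt_def sqn_eq0 w0.
exact: sqn_ge0.
Qed.

Lemma posdef_unitmx A (c : R) : 0 < c -> (forall u, c * sqn u <= qform A u) ->
  A \in unitmx.
Proof.
move=> c0 Ac; rewrite -unitmx_tr -row_free_unit -kermx_eq0.
apply/eqP/row_matrixP => i; rewrite row0.
have := mulmx_ker A^T => /(congr1 (row i)); rewrite row_mul row0.
set w := row i _ => wA.
have Aw : A *m w^T = 0 by rewrite -[A]trmxK -trmx_mul wA trmx0.
have := Ac w^T; rewrite /qform Aw.
have -> : dot w^T 0 = 0 by rewrite /dot big1// => j _; rewrite !mxE mulr0.
rewrite pmulr_rle0// => h.
have /eqP : sqn w^T = 0 by apply/le_anti; rewrite h sqn_ge0.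
by rewrite sqn_eq0 trmx_eq0 => /eqP.
Qed.

(** Both bounds follow from [dot w b <= (c * sqn w + sqn b / c) / 2] for the
    solution [w] of [A *m w = b]. *)
Lemma posdef_inv A (c : R) b : 0 < c -> (forall u, c * sqn u <= qform A u) ->
  sqn (invmx A *m b) <= sqn b / c ^+ 2 /\
  qform A (invmx A *m b) <= sqn b / c.
Proof.
move=> c0 Ac; set w := invmx A *m b.
have Aw : A *m w = b by rewrite mulKVmx//; exact: posdef_unitmx Ac.
have q : qform A w = dot w b by rewrite /qform Aw.
have h1 := Ac w.
have h2 : dot w b <= (c * sqn w + c^-1 * sqn b) / 2.
  by apply: le_trans (norm_dot_le _ _ c0); exact: ler_norm.
rewrite q in h1 *.
have h3 : c * sqn w <= c^-1 * sqn b by lra.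
split; last by rewrite mulrC; lra.
rewrite ler_pdivlMr ?exprn_gt0// mulrC expr2 -mulrA.
have -> : sqn b = c * (c^-1 * sqn b) by rewrite mulrA divff ?mul1r ?gt_eqF.
by rewrite ler_pM2l.
Qed.

Lemma generalized_inverse_unit A G : A \in unitmx -> generalized_inverse A G ->
  G = invmx A.
Proof.
move=> uA AG; have := congr1 (fun M => invmx A *m M *m invmx A) AG.
by rewrite /= !mulmxA mulVmx// mul1mx -mulmxA mulmxV// mulmx1 mul1mx.
Qed.

(** A Gershgorin bound: by [2 |u_i u_j| <= u_i ^ 2 + u_j ^ 2] each square is counted
    at most [N] times in either role. *)
Lemma sparse_qform_le A (r : rel 'I_n) (N : nat) (t : R) u :
  0 <= t -> symmetric r ->
  (forall i, (#|r i| <= N)%N) ->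
  (forall i j, `|A i j| <= t) -> (forall i j, ~~ r i j -> A i j = 0) ->
  `|qform A u| <= N%:R * t * sqn u.
Proof.
move=> t0 rsym rN At A0.
have rN' i : \sum_j (r i j)%:R <= N%:R :> R.
  rewrite -natr_sum ler_nat; apply: leq_trans (rN i).
  by rewrite -sum1_card [leqRHS]big_mkcond /=; apply: leq_sum => j _; rewrite unfold_in; case: (r i j).
have s1 : \sum_i \sum_j (r i j)%:R * u i 0 ^+ 2 <= N%:R * sqn u.
  rewrite mulr_sumr; apply: ler_sum => i _.
  by rewrite -mulr_suml ler_wpM2r ?sqr_ge0.
have s2 : \sum_i \sum_j (r i j)%:R * u j 0 ^+ 2 <= N%:R * sqn u.
  rewrite exchange_big /=; apply: le_trans s1.
  by apply: ler_sum => i _; apply: ler_sum => j _; rewrite rsym.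
apply: (@le_trans _ _ (\sum_i \sum_j (t / 2 * ((r i j)%:R * u i 0 ^+ 2) +
    t / 2 * ((r i j)%:R * u j 0 ^+ 2)))).
  rewrite qformE; apply: (le_trans (ler_norm_sum _ _ _)); apply: ler_sum => i _.
  apply: (le_trans (ler_norm_sum _ _ _)); apply: ler_sum => j _.
  have [rij|/A0 ->] := boolP (r i j); last by rewrite !mul0r normr0 !mulr0 addr0.
  rewrite !mul1r normrM -mulrDr.
  have h : `|u i 0 * u j 0| <= (u i 0 ^+ 2 + u j 0 ^+ 2) / 2.
    have := sqr_ge0 (u i 0 - u j 0); have := sqr_ge0 (u i 0 + u j 0).
    by rewrite ler_norml => h1 h2; apply/andP; split; nra.
  have -> : t / 2 * (u i 0 ^+ 2 + u j 0 ^+ 2) =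
      t * ((u i 0 ^+ 2 + u j 0 ^+ 2) / 2) by ring.
  by apply: ler_pM.
under eq_bigr do rewrite big_split/= -!mulr_sumr.
rewrite big_split/= -!mulr_sumr.
have := ler_wpM2l (divr_ge0 t0 (ler0n _ 2)) s1.
have := ler_wpM2l (divr_ge0 t0 (ler0n _ 2)) s2.
lra.
Qed.

End quadratic_forms2.

(** * Marsden's identity and polarization *)

Section bspline_cell.
Context {R : realType}.
Variables (tau : nat -> R) (k J : nat).
Hypothesis knots : knot_sequence k J tau.
Hypothesis tau_strict : forall i, (k <= i < k + J)%N -> tau i < tau i.+1.

(** The last clause says that the splines of degree 0 select the interval [m]. At
    [t = 1], which closes the last interval, it follows the convention of
    [bspline]. *)
Definition in_cell (t : R) (m : nat) : Prop :=
  [/\ (k <= m < k + J)%N, 0 <= t <= 1, tau m <= t <= tau m.+1 &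
      (forall i, (i < J + k.*2)%N -> bspline tau 0 i t = (i == m)%:R)].

Lemma knots_le i j : (i <= j)%N -> (j <= J + k.*2)%N -> tau i <= tau j.
Proof.
move=> ij jN; case: knots => _ _ _ mono.
elim: j ij jN => [|j IH]; first by rewrite leqn0 => /eqP ->.
rewrite leq_eqVlt => /orP[/eqP <- //|]; rewrite ltnS => ij jN.
by apply: (le_trans (IH ij (ltnW jN))); apply: mono.
Qed.

Lemma in_cell_lt1 t m : (k <= m < k + J)%N -> 0 <= t -> t < 1 ->
  tau m <= t < tau m.+1 -> in_cell t m.
Proof.
move=> km t0 t1 /andP[mt tm]; split => //; first by rewrite t0 ltW.
  by rewrite mt ltW.
move=> i iN; rewrite /= t1; have [->|im] := eqVneq i m; first by rewrite mt tm.
move: im; rewrite neq_ltn => /orP[im|mi].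
  have h : tau i.+1 <= tau m by apply: knots_le => //; lia.
  by rewrite [t < _]ltNge (le_trans h mt) andbF.
have h : tau m.+1 <= tau i by apply: knots_le => //; lia.
by rewrite leNgt (lt_le_trans tm h).
Qed.

Lemma in_cell_1 : in_cell 1 (k + J).-1.
Proof.
have [J0 t0 t1 _] := knots.
have e : (k + J).-1.+1 = (k + J)%N by lia.
have lt1 : tau (k + J).-1 < 1 by rewrite -t1 -[X in _ < tau X]e; apply: tau_strict; lia.
split; [lia|by rewrite ler01 lexx|by rewrite e t1 lexx ltW|].
move=> i iN; rewrite /= ltxx; have [->|im] := eqVneq i (k + J).-1.
  by rewrite e t1 lt1 lexx.
move: im; rewrite neq_ltn => /orP[im|mi].
  have h : tau i.+1 <= tau (k + J).-1 by apply: knots_le => //; lia.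
  by rewrite [1 <= _]leNgt (le_lt_trans h lt1) andbF.
have h : tau (k + J)%N <= tau i by apply: knots_le => //; lia.
by rewrite ltNge -t1 h.
Qed.

Lemma in_cell_exists t : 0 <= t <= 1 -> exists m, in_cell t m.
Proof.
move=> /andP[t0]; rewrite le_eqVlt => /orP[/eqP ->|t1].
  by exists (k + J).-1; exact: in_cell_1.
have [J0 tk t1' _] := knots.
pose P i := (k <= i < k + J)%N && (tau i <= t).
have exP : exists i, P i by exists k; rewrite /P tk t0 leqnn /= andbT; lia.
have ubP i : P i -> (i <= k + J)%N by case/andP; lia.
case: (ex_maxnP exP ubP) => m /andP[km tm] mmax.
exists m; apply: in_cell_lt1 => //; rewrite tm /=.
have [mJ|mJ] := ltnP m.+1 (k + J).
  rewrite ltNge; apply/negP => h; have := mmax m.+1.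
  by rewrite /P h andbT => /(_ ltac:(lia)); rewrite ltnn.
by have -> : m.+1 = (k + J)%N; [lia|rewrite t1'].
Qed.

Section one_cell.
Variables (t : R) (m : nat).
Hypothesis tm : in_cell t m.

Lemma bspline_eq0 d i : (i + d < J + k.*2)%N -> ~~ (i <= m <= i + d)%N ->
  bspline tau d i t = 0.
Proof.
case: tm => _ _ _ t0; elim: d i => [|d IH] i iN im.
  rewrite t0; last by lia.
  by case: eqP => // e; move: im; lia.
rewrite [bspline _ _ _ _]/= (IH i) ?(IH i.+1) ?mulr0 ?addr0//; lia.
Qed.

Lemma knots_lt i j : (i <= m < j)%N -> (j <= J + k.*2)%N -> tau i < tau j.
Proof.
move=> imj jN; case: tm => km _ _ _.
apply: (@le_lt_trans _ _ (tau m)); first by apply: knots_le; lia.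
by apply: (lt_le_trans (tau_strict km)); apply: knots_le; lia.
Qed.

Lemma knots_itv i j : (i <= m < j)%N -> (j <= J + k.*2)%N -> tau i <= t <= tau j.
Proof.
move=> imj jN; case: tm => km _ /andP[h1 h2] _; apply/andP; split.
  by apply: le_trans h1; apply: knots_le; lia.
by apply: (le_trans h2); apply: knots_le; lia.
Qed.

Lemma bspline_ge0 d i : (i + d < J + k.*2)%N -> 0 <= bspline tau d i t.
Proof.
elim: d i => [|d IH] i iN.
  by case: tm => _ _ _ ->; [rewrite ler0n|lia].
rewrite [bspline _ _ _ _]/=; apply: addr_ge0.
  have [/andP[h1 h2]|h] := boolP (i <= m <= i + d)%N; last first.
    by rewrite bspline_eq0 ?mulr0//; lia.
  have /andP[a b] : tau i <= t <= tau (i + d.+1)%N by apply: knots_itv; lia.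
  apply: mulr_ge0; last by apply: IH; lia.
  by apply: divr_ge0; rewrite subr_ge0// (le_trans a b).
have [/andP[h1 h2]|h] := boolP (i.+1 <= m <= i.+1 + d)%N; last first.
  by rewrite (@bspline_eq0 d i.+1) ?mulr0//; lia.
have /andP[a b] : tau i.+1 <= t <= tau (i + d.+2)%N by apply: knots_itv; lia.
apply: mulr_ge0; last by apply: IH; lia.
by apply: divr_ge0; rewrite subr_ge0// (le_trans a b).
Qed.

(** Marsden's identity, in the homogeneous form that contains the partition of unity
    ([al = 0], [be = 1]). In the step of the induction the coefficients of one
    lower degree spline combine because [al * t + be] is interpolated linearly
    between the first and last knots of its support. *)
Lemma marsden d (al be : R) : (d <= k)%N ->
  \sum_(0 <= i < J + k.*2 - d)
    (\prod_(l < d) (al * tau (i + l.+1)%N + be)) * bspline tau d i t =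
  (al * t + be) ^+ d.
Proof.
have [km _ _ t0] := tm.
elim: d => [_|d IH dk].
  have mN : (m < J + k.*2)%N by lia.
  rewrite expr0 subn0 big_mkord (eq_bigr (fun i : 'I__ => (val i == m)%:R)).
    rewrite (bigD1 (Ordinal mN))//= eqxx big1 ?addr0// => i im; case: eqP => // e.
    by case/negP: im; apply/eqP/val_inj.
  by move=> i _; rewrite big_ord0 mul1r t0.
have := IH (ltnW dk); set N := (J + k.*2 - d.+1)%N.
have -> : (J + k.*2 - d)%N = N.+1 by rewrite /N; lia.
move=> {}IH.
pose psi e i := \prod_(l < e) (al * tau (i + l.+1)%N + be).
pose w i := (t - tau i) / (tau (i + d.+1)%N - tau i).
pose w' i := (tau (i + d.+1)%N - t) / (tau (i + d.+1)%N - tau i).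
rewrite (eq_bigr (fun i => psi d.+1 i * w i * bspline tau d i t +
    psi d.+1 i * w' i.+1 * bspline tau d i.+1 t)); last first.
  move=> i _; rewrite /psi /w /w' [bspline _ _ _ _]/= mulrDr !mulrA.
  by rewrite !addSnnS.
rewrite big_split /=.
have e1 : \sum_(0 <= i < N) psi d.+1 i * w i * bspline tau d i t =
    \sum_(0 <= i < N.+1) psi d.+1 i * w i * bspline tau d i t.
  by rewrite big_nat_recr//= (@bspline_eq0 d N) ?mulr0 ?addr0// /N; lia.
have e2 : \sum_(0 <= i < N) psi d.+1 i * w' i.+1 * bspline tau d i.+1 t =
    \sum_(0 <= i < N.+1) psi d.+1 i.-1 * w' i * bspline tau d i t.
  by rewrite big_nat_recl//= (@bspline_eq0 d 0) ?mulr0 ?add0r// ; lia.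
rewrite e1 e2 -big_split /= exprS -IH mulr_sumr.
rewrite !big_mkord; apply: eq_bigr => -[i iN] _ /=.
have [im|im] := boolP (i <= m <= i + d)%N; last first.
  by rewrite bspline_eq0 ?mulr0 ?addr0//; move: iN; rewrite /N; lia.
have i0 : (0 < i)%N by lia.
rewrite -mulrDl mulrA; congr (_ * _).
have -> : psi d.+1 i = psi d i * (al * tau (i + d.+1)%N + be).
  by rewrite /psi big_ord_recr.
have -> : psi d.+1 i.-1 = (al * tau i + be) * psi d i.
  rewrite /psi big_ord_recl /= addn1 prednK//; congr (_ * _).
  by apply: eq_bigr => l _; rewrite /bump /= add1n -addSnnS prednK.
have D : tau i < tau (i + d.+1)%N by apply: knots_lt; rewrite ?/N; move: iN; rewrite /N; lia.
rewrite -/(psi d i) /w /w'; field.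
by rewrite subr_eq0 gt_eqF.
Qed.

Lemma marsden_top (al be : R) :
  \sum_(i < J + k) (\prod_(l < k) (al * tau (i + l.+1)%N + be)) * bspline tau k i t =
  (al * t + be) ^+ k.
Proof.
rewrite -(marsden al be (leqnn k)) big_mkord.
by have -> : (J + k.*2 - k)%N = (J + k)%N by lia.
Qed.

Lemma bspline_sum1 : \sum_(i < J + k) bspline tau k i t = 1.
Proof.
have := marsden_top 0 1; rewrite mul0r add0r expr1n => <-.
by apply: eq_bigr => i _; rewrite big1 ?mul1r// => l _; rewrite mul0r add0r.
Qed.

End one_cell.
End bspline_cell.

Section polynomials.
Context {R : realType}.

Lemma poly_eq0_infinite (p : {poly R}) (e : nat -> R) : injective e ->
  (forall i, p.[e i] = 0) -> p = 0.
Proof.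
move=> ei pe; apply: (@roots_geq_poly_eq0 _ p (map e (iota 0 (size p)))).
- by apply/allP => _ /mapP[i _ ->]; apply/eqP; exact: pe.
- by rewrite map_inj_uniq// iota_uniq.
- by rewrite size_map size_iota.
Qed.

Lemma poly_eq_horner (p q : {poly R}) : (forall x, p.[x] = q.[x]) -> p = q.
Proof.
move=> pq; apply/eqP; rewrite -subr_eq0; apply/eqP.
apply: (@poly_eq0_infinite _ (fun n => n%:R)).
  by move=> i j /eqP; rewrite eqr_nat => /eqP.
by move=> i; rewrite hornerD hornerN pq subrr.
Qed.

(** Both sides are polynomials in [be]; compare the coefficients of
    [be ^ (k - nu)]. *)
Lemma power_identity_monomial (I : finType) (a : I -> {poly R}) (k : nat) (t : R) :
  (forall be : R, \sum_i (a i).[be] = (t + be) ^+ k) ->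
  forall nu, (nu <= k)%N -> \sum_i (a i)`_(k - nu) = t ^+ nu *+ 'C(k, nu).
Proof.
move=> H nu nuk.
have E : \sum_i a i = (t%:P + 'X) ^+ k.
  apply: poly_eq_horner => be; rewrite horner_sum H.
  by rewrite horner_exp hornerD hornerC hornerX.
have := congr1 (fun p : {poly R} => p`_(k - nu)) E; rewrite /= coef_sum => ->.
rewrite addrC exprDn coef_sum.
have nuk' : (nu < k.+1)%N by [].
rewrite (bigD1 (Ordinal nuk')) //= big1 ?addr0.
  by rewrite -polyC_exp coefMn coefMC coefXn eqxx mul1r.
move=> i inu; rewrite -polyC_exp coefMn coefMC coefXn.
case: eqP => [e|_]; last by rewrite mul0r mul0rn.
case/negP: inu; apply/eqP/val_inj => /=; have := ltn_ord i; lia.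
Qed.

(** The [k]-th powers of [x + be] span the polynomials of degree at most [k]. *)
Lemma power_reproduction (I : finType) (c x : I -> R) (k : nat) (t : R) :
  (forall be : R, \sum_i c i * (x i + be) ^+ k = (t + be) ^+ k) ->
  forall p : {poly R}, (size p <= k.+1)%N -> \sum_i c i * p.[x i] = p.[t].
Proof.
move=> H.
have mono nu : (nu <= k)%N -> \sum_i c i * x i ^+ nu = t ^+ nu.
  move=> nuk; have := @power_identity_monomial I
    (fun i => c i *: ((x i)%:P + 'X) ^+ k) k t _ nu nuk.
  have -> : \sum_i (c i *: ((x i)%:P + 'X) ^+ k)`_(k - nu) =
      (\sum_i c i * x i ^+ nu) *+ 'C(k, nu).
    rewrite -sumrMnl; apply: eq_bigr => i _; rewrite coefZ.
    have /= := @power_identity_monomial unit (fun=> ((x i)%:P + 'X) ^+ k) k (x i) _ nu nuk.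
    rewrite big_const card_unit /= addr0 => ->; first by rewrite mulrnAr.
    move=> be; rewrite big_const card_unit /= addr0.
    by rewrite horner_exp hornerD hornerC hornerX.
  move=> h; have {h} : (\sum_i c i * x i ^+ nu) *+ 'C(k, nu) = t ^+ nu *+ 'C(k, nu).
    apply: h => be; rewrite -H; apply: eq_bigr => i _.
    by rewrite hornerZ horner_exp hornerD hornerC hornerX.
  by move/eqP; rewrite eqr_pMn2r ?bin_gt0// => /eqP.
move=> p sp; rewrite (horner_coef_wide t sp).
under eq_bigr do rewrite (horner_coef_wide _ sp) mulr_sumr.
rewrite exchange_big /=; apply: eq_bigr => nu _.
rewrite -(mono nu) -1?ltnS// mulr_sumr; apply: eq_bigr => i _; ring.
Qed.

(** Expanding the powers gives a sum over maps [f] of the indices into [S]. For a map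
    that is not onto, the signs of the sets [S] that contain its image cancel, and
    the onto maps are the [k!] permutations. *)
Lemma polarization (k : nat) (x : 'I_k -> R) :
  \sum_(S : {set 'I_k}) (-1) ^+ #|~: S| * (\sum_(l in S) x l) ^+ k =
  k`!%:R * \prod_l x l.
Proof.
have e1 (S : {set 'I_k}) : (-1) ^+ #|~: S| * (\sum_(l in S) x l) ^+ k =
    \sum_(f : {ffun 'I_k -> 'I_k}) (\prod_i x (f i)) *
      \prod_l (if l \in S then 1 else if l \in codom f then 0 else -1).
  have -> : (\sum_(l in S) x l) ^+ k =
      \sum_(f : {ffun 'I_k -> 'I_k}) \prod_i ((f i \in S)%:R * x (f i)).
    rewrite -(bigA_distr_bigA (fun i j => (j \in S)%:R * x j)) /=.
    rewrite prodr_const card_ord; congr (_ ^+ _).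
    by rewrite big_mkcond; apply: eq_bigr => l _; case: (l \in S); rewrite ?mul1r ?mul0r.
  rewrite mulr_sumr; apply: eq_bigr => f _.
  rewrite big_split /= mulrA [LHS]mulrC; congr (_ * _).
  have [fS|] := boolP [forall i, f i \in S].
    rewrite big1; last by move=> i _; rewrite (forallP fS).
    rewrite mulr1 (bigID (mem S)) /= [X in _ = X * _]big1 ?mul1r; last by move=> l ->.
    rewrite -prodr_const; apply: eq_big => [l|l]; first by rewrite inE.
    rewrite inE => lS; rewrite (negbTE lS); case: ifP => // /codomP[i li].
    by move: lS; rewrite li (forallP fS).
  rewrite negb_forall => /existsP[i fiS].
  rewrite (bigD1 i)//= (negbTE fiS) mul0r mulr0.
  by rewrite (bigD1 (f i))//= (negbTE fiS) codom_f mul0r.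
rewrite (eq_bigr _ (fun S _ => e1 S)) exchange_big /=.
have e2 (f : {ffun 'I_k -> 'I_k}) : \sum_(S : {set 'I_k})
    \prod_l (if l \in S then 1 else if l \in codom f then 0 else -1) =
    (injectiveb f)%:R :> R.
  rewrite -(bigA_distr _ _ (fun=> 1) (fun l => if l \in codom f then 0 else -1)) /=.
  have [fi|fi] := boolP (injectiveb f).
    rewrite big1// => l _; have /injectiveP fI := fi.
    have -> : l \in codom f by apply: inj_card_onto.
    by rewrite addr0.
  have [l lf] : exists l, l \notin codom f.
    apply/existsP; rewrite -negb_forall; apply: contra fi => /forallP cf.
    apply: (@leq_size_uniq _ (enum 'I_k)); first exact: enum_uniq.
      by move=> l _; exact: cf.
    by rewrite size_codom -cardE.
  by rewrite (bigD1 l)//= (negbTE lf) subrr mul0r.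
rewrite (eq_bigr (fun f : {ffun 'I_k -> 'I_k} => (injectiveb f)%:R * \prod_i x (f i)));
  last by move=> f _; rewrite -mulr_sumr e2 mulrC.
rewrite (eq_bigr (fun f : {ffun 'I_k -> 'I_k} => (injectiveb f)%:R * \prod_l x l)); last first.
  move=> f _; case: (boolP (injectiveb f)) => [fi|_]; last by rewrite !mul0r.
  congr (_ * _); have /injectiveP fI := fi.
  by rewrite [RHS](reindex_inj fI).
rewrite -mulr_suml; congr (_ * _).
rewrite -natr_sum -big_mkcond /= sum1dep_card.
have := card_inj_ffuns 'I_k 'I_k; rewrite /= !card_ord ffactnn => <-.
by rewrite cardsE.
Qed.

End polynomials.

(** * Quasi-interpolation by univariate splines *)

Section truncated_powers.
Context {R : realType}.
Variables (tau : nat -> R) (k J : nat).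
Hypothesis knots : knot_sequence k J tau.
Hypothesis tau_strict : forall i, (k <= i < k + J)%N -> tau i < tau i.+1.

(** The monomials of degree at most [k], followed by the truncated powers at the
    interior knots. The cell [m] of [t] says which truncated powers are active, so
    that no convention for [t] at a knot is involved. *)
Definition tpow (m : nat) (t : R) : 'cV[R]_(J + k) :=
  \col_(j < J + k) (if (j <= k)%N then t ^+ j
                    else if (j <= m)%N then (t - tau j) ^+ k else 0).

Definition bvec (t : R) : 'cV[R]_(J + k) := \col_(i < J + k) bspline tau k i t.

Definition knot_poly (i : nat) : {poly R} := \prod_(l < k) ((tau (i + l.+1)%N)%:P + 'X).

Definition tpow_mx : 'M[R]_(J + k) := \matrix_(j < J + k, i < J + k)
  (if (j <= k)%N then (knot_poly i)`_(k - j) / ('C(k, j))%:R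
   else if (j <= i)%N then \prod_(l < k) (tau (i + l.+1)%N - tau j) else 0).

(** The monomials come from Marsden's identity by comparing coefficients, the
    truncated power at [tau j] by setting [be = - tau j], which annihilates the
    B-splines that have [tau j] as an inner knot of their support. *)
Lemma tpow_bspline t m : in_cell tau k J t m -> tpow m t = tpow_mx *m bvec t.
Proof.
move=> tm; have [km _ _ _] := tm; apply/colP => j; rewrite !mxE.
under eq_bigr do rewrite !mxE.
case: (leqP j k) => jk.
  have H (be : R) : \sum_(i < J + k) (bspline tau k i t *: knot_poly i).[be] = (t + be) ^+ k.
    have := marsden_top knots tau_strict tm 1 be; rewrite mul1r => <-.
    apply: eq_bigr => i _; rewrite hornerZ horner_prod mulrC; congr (_ * _).
    by apply: eq_bigr => l _; rewrite hornerD hornerC hornerX mul1r.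
  have := power_identity_monomial H jk => h.
  have C0 : ('C(k, j))%:R != 0 :> R by rewrite pnatr_eq0 -lt0n bin_gt0.
  apply: (mulfI C0); rewrite mulr_natl -h mulr_sumr; apply: eq_bigr => i _.
  by rewrite coefZ; field.
have := marsden_top knots tau_strict tm 1 (- tau j); rewrite mul1r => Mj.
case: (leqP j m) => jm.
  rewrite -Mj; apply: eq_bigr => i _; case: (leqP j i) => ji.
    by congr (_ * _); apply: eq_bigr => l _; rewrite mul1r.
  rewrite mul0r; have [/andP[im mi]|h] := boolP (i <= m <= i + k)%N; last first.
    by rewrite (bspline_eq0 tm) ?mulr0//; have := ltn_ord i; lia.
  have jik : (j - i.+1 < k)%N by lia.
  rewrite (bigD1 (Ordinal jik))//= mul1r.
  have -> : (i + (j - i.+1).+1)%N = j by lia.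
  by rewrite subrr !mul0r.
rewrite big1// => i _; case: (leqP j i) => ji; last by rewrite mul0r.
rewrite (bspline_eq0 tm) ?mulr0//; have := ltn_ord i; lia.
Qed.

Definition cell_point (m l : nat) : R :=
  tau m + (tau m.+1 - tau m) / l.+2%:R.

Lemma cell_point_in m l : (k <= m < k + J)%N -> in_cell tau k J (cell_point m l) m.
Proof.
move=> km; have [J0 t0 t1 mono] := knots.
have st := tau_strict km.
have d0 : 0 < tau m.+1 - tau m by rewrite subr_gt0.
have l0 : 0 < (tau m.+1 - tau m) / l.+2%:R by rewrite divr_gt0.
have l1 : (tau m.+1 - tau m) / l.+2%:R < tau m.+1 - tau m.
  by rewrite ltr_pdivrMr// ltr_pMr// ltr1n.
have m0 : 0 <= tau m by rewrite -t0; apply: (knots_le knots); lia.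
have m1 : tau m.+1 <= 1 by rewrite -t1; apply: (knots_le knots); lia.
move: l0 l1; rewrite /cell_point; set e := _ / _ => l0 l1.
by apply: in_cell_lt1 => //; [lra|lra|apply/andP; split; lra].
Qed.

Lemma cell_point_inj m : (k <= m < k + J)%N -> injective (cell_point m).
Proof.
move=> km i j /addrI /eqP; have st := tau_strict km.
rewrite (inj_eq (mulfI _)); last by rewrite subr_eq0 gt_eqF.
by rewrite (inj_eq invr_inj) eqr_nat => /eqP [].
Qed.

Lemma cell_point_gt m l : (k <= m < k + J)%N -> tau m < cell_point m l.
Proof.
move=> km; have st := tau_strict km.
by rewrite /cell_point ltrDl divr_gt0// subr_gt0.
Qed.

(** Each cell, from left to right, brings one new truncated power into play, and
    the first cell determines the polynomial part. *)
Lemma tpow_free (c : 'I_(J + k) -> R) :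
  (forall t m, in_cell tau k J t m -> \sum_j c j * tpow m t j 0 = 0) ->
  forall j, c j = 0.
Proof.
move=> H; have [J0 _ _ _] := knots.
(* On the first cell only the monomials are present. *)
have low (j : 'I_(J + k)) : (j <= k)%N -> c j = 0.
  pose p := \sum_(j < J + k) (if (j <= k)%N then c j else 0) *: 'X^j.
  have p0 : p = 0.
    apply: (@poly_eq0_infinite _ _ (cell_point k)); first by apply: cell_point_inj; lia.
    move=> l; rewrite -(H (cell_point k l) k); last by apply: cell_point_in; lia.
    rewrite horner_sum; apply: eq_bigr => i _; rewrite hornerZ hornerXn mxE.
    by case: leqP; rewrite ?mul0r ?mulr0.
  move=> jk; have := congr1 (fun p : {poly R} => p`_j) p0; rewrite /= coef0 coef_sum.
  rewrite (bigD1 j)//= big1 ?addr0 => [|i ij].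
    by rewrite jk coefZ coefXn eqxx mulr1.
  by rewrite coefZ coefXn (eq_sym (nat_of_ord j)) (inj_eq val_inj) (negbTE ij) mulr0.
have main (n : nat) (j : 'I_(J + k)) : (j <= n)%N -> c j = 0.
  elim: n j => [|n IH] j; first by rewrite leqn0 => /eqP j0; apply: low; rewrite j0.
  rewrite leq_eqVlt => /orP[/eqP jn|]; last by rewrite ltnS; exact: IH.
  have [jk|jk] := leqP j k; first exact: low.
  have jc : (k <= j < k + J)%N by have := ltn_ord j; lia.
  have := H _ _ (cell_point_in 0 jc); rewrite (bigD1 j)//= big1 ?addr0.
    rewrite mxE leqNgt jk /= leqnn => /eqP; rewrite mulf_eq0 => /orP[/eqP //|].
    rewrite expf_eq0 => /andP[_]; rewrite subr_eq0 gt_eqF//; exact: cell_point_gt.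
  move=> i ij; have [ilt|ige] := ltnP i j.
    by rewrite IH ?mul0r//; lia.
  have {}ige : (j < i)%N by rewrite ltn_neqAle ige andbT eq_sym.
  rewrite mxE; case: leqP => [ik|_]; first by move: (leq_trans ige ik); lia.
  by case: leqP => [ij'|_]; [move: (leq_trans ige ij'); rewrite ltnn|rewrite mulr0].
by move=> j; apply: (main j).
Qed.

Lemma tpow_mx_unit : tpow_mx \in unitmx.
Proof.
rewrite -row_free_unit -kermx_eq0; apply/eqP/row_matrixP => i; rewrite row0.
have := mulmx_ker tpow_mx => /(congr1 (row i)); rewrite row_mul row0.
set w := row i _ => wA; apply/rowP => j; rewrite [RHS]mxE.
apply: (@tpow_free (fun j => w 0 j)) => t m tm.
transitivity ((w *m tpow m t) 0 0); first by rewrite mxE.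
by rewrite (tpow_bspline tm) mulmxA wA mul0mx mxE.
Qed.

End truncated_powers.

(** The splines with given interior knots restrict on [0, 1] to the same space
    of functions, whatever the outer knots are: all contain the truncated power
    basis, which has the right number of elements. *)
Lemma change_outer_knots {R : realType} (tau sig : nat -> R) (k J : nat) :
  knot_sequence k J tau -> knot_sequence k J sig ->
  (forall i, (k <= i < k + J)%N -> tau i < tau i.+1) ->
  (forall i, (k <= i <= k + J)%N -> sig i = tau i) ->
  exists A : 'M[R]_(J + k), forall t, 0 <= t <= 1 -> bvec sig k J t = A *m bvec tau k J t.
Proof.
move=> kt ks st e.
have ss i : (k <= i < k + J)%N -> sig i < sig i.+1.
  by move=> ki; rewrite !e ?st//; lia.
exists (invmx (tpow_mx sig k J) *m tpow_mx tau k J) => t t01.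
have [m tm] := in_cell_exists kt st t01.
have sm : in_cell sig k J t m.
  have [km /andP[t0 t1] mt _] := tm.
  move: t1; rewrite le_eqVlt => /orP[/eqP t1|t1].
    have [m' [km' _ mt' _]] := ex_intro _ _ (in_cell_1 ks ss).
    have -> : m = (k + J).-1; last by rewrite t1; exact: in_cell_1.
    move: mt; rewrite t1 => /andP[mt1 mt2].
    have [_ _ t1' _] := kt; case: (ltnP m.+1 (k + J)) => h; last by lia.
    have : tau m.+1 < tau m.+2 by apply: st; lia.
    have : tau m.+2 <= tau (k + J)%N by apply: (knots_le kt); lia.
    by rewrite t1' => a b; move: (lt_le_trans b a); rewrite ltNge mt2.
  apply: in_cell_lt1 => //; rewrite !e; try lia.
  case: tm => _ _ /andP[h1 h2] B; rewrite h1 /=.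
  have := B m ltac:(lia); rewrite /= t1 eqxx h1 /= => /eqP.
  by case: (t < _) => //; rewrite eq_sym oner_eq0.
rewrite -mulmxA -(tpow_bspline kt st tm).
have -> : tpow tau k J m t = tpow sig k J m t.
  apply/colP => j; rewrite !mxE; case: leqP => // kj.
  by rewrite e//; have := ltn_ord j; lia.
by rewrite (tpow_bspline ks ss sm) mulKmx// tpow_mx_unit.
Qed.

Section clamped.
Context {R : realType}.
Variables (tau : nat -> R) (k J : nat).
Hypothesis knots : knot_sequence k J tau.
Hypothesis tau_strict : forall i, (k <= i < k + J)%N -> tau i < tau i.+1.

(** Clamped knots are in [0, 1], so that a function on [0, 1] can be evaluated at
    their averages. *)
Definition clamp i := tau (maxn k (minn i (k + J))).

Lemma clamp_inner i : (k <= i <= k + J)%N -> clamp i = tau i.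
Proof. by move=> ki; rewrite /clamp; congr tau; lia. Qed.

Lemma clamp_le i j : (i <= j)%N -> clamp i <= clamp j.
Proof. by move=> ij; apply: (knots_le knots); lia. Qed.

Lemma clamp01 i : 0 <= clamp i <= 1.
Proof.
by have [J0 t0 t1 _] := knots; rewrite -t0 -t1; apply/andP; split;
  apply: (knots_le knots); lia.
Qed.

Lemma knots_clamp : knot_sequence k J clamp.
Proof.
have [J0 t0 t1 _] := knots; split => //.
- by rewrite clamp_inner//; lia.
- by rewrite clamp_inner//; lia.
- by move=> i _; exact: clamp_le.
Qed.

Lemma clamp_strict i : (k <= i < k + J)%N -> clamp i < clamp i.+1.
Proof. by move=> ki; rewrite !clamp_inner ?tau_strict//; lia. Qed.

Lemma clamp_width (h : R) : 0 <= h ->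
  (forall i, (k <= i < k + J)%N -> tau i.+1 - tau i <= h) ->
  forall i d, clamp (i + d) - clamp i <= d%:R * h.
Proof.
move=> h0 th i d; elim: d => [|d IH]; first by rewrite addn0 subrr mul0r.
have step : clamp (i + d.+1) - clamp (i + d) <= h.
  have [c|c] := boolP (k <= i + d < k + J)%N.
    by rewrite addnS !clamp_inner ?th//; lia.
  suff -> : clamp (i + d.+1) = clamp (i + d) by rewrite subrr.
  rewrite /clamp; congr tau; lia.
have -> : d.+1%:R * h = h + d%:R * h by rewrite -natr1; ring.
have -> : clamp (i + d.+1) - clamp i =
    (clamp (i + d.+1) - clamp (i + d)) + (clamp (i + d) - clamp i) by ring.
exact: lerD.
Qed.

Lemma bspline_supp t m i : in_cell tau k J t m -> (i <= m <= i + k)%N ->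
  clamp i <= t <= clamp (i + k.+1).
Proof.
move=> [km _ /andP[h1 h2] _] im; apply/andP; split.
  by apply: le_trans h1; rewrite -(@clamp_inner m); [apply: clamp_le; lia|lia].
by apply: (le_trans h2); rewrite -(@clamp_inner m.+1); [apply: clamp_le; lia|lia].
Qed.

Lemma bspline_neq0_cell t m i : in_cell tau k J t m -> (i < J + k)%N ->
  bspline tau k i t != 0 -> (i <= m <= i + k)%N.
Proof.
move=> tm iJ; apply: contraNT => h; apply/eqP; apply: (bspline_eq0 tm) => //; lia.
Qed.

End clamped.

Section quasi_interpolant.
Context {R : realType}.
Variables (tau : nat -> R) (k J : nat).
Hypothesis knots : knot_sequence k J tau.
Hypothesis tau_strict : forall i, (k <= i < k + J)%N -> tau i < tau i.+1.

Local Notation sig := (clamp tau k J).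

Definition qi_index := ('I_(J + k) * {set 'I_k})%type.

(** The coefficient of a B-spline in Marsden's identity is a product over its inner
    knots; [polarization] makes it a combination of powers of averages of subsets
    of these knots. For the empty subset, whose [qi_coef] vanishes unless [k = 0],
    the value is a point of the support. *)
Definition qi_node (a : qi_index) : R :=
  if #|a.2| == 0%N then sig (a.1 + k) else
  (\sum_(l in a.2) sig (a.1 + l.+1)) / #|a.2|%:R.

Definition qi_coef (S : {set 'I_k}) : R :=
  (-1) ^+ #|~: S| * #|S|%:R ^+ k / k`!%:R.

Definition qi_weight (a : qi_index) (t : R) : R :=
  qi_coef a.2 * bspline sig k a.1 t.

Definition qi_norm : R := \sum_(S : {set 'I_k}) `|qi_coef S|.

Let kc := knots_clamp knots.
Let sc := clamp_strict tau_strict.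

(** Marsden's identity with the products of knots polarized. *)
Lemma qi_power (t al be : R) : 0 <= t <= 1 ->
  \sum_a qi_weight a t * (al * qi_node a + be) ^+ k = (al * t + be) ^+ k.
Proof.
move=> t01; have [m tm] := in_cell_exists kc sc t01.
rewrite -(marsden_top kc sc tm) -(pair_bigA _ (fun i S =>
  qi_weight (i, S) t * (al * qi_node (i, S) + be) ^+ k)) /=.
apply: eq_bigr => i _.
pose x (l : 'I_k) := al * sig (i + l.+1) + be.
have f0 : k`!%:R != 0 :> R by rewrite pnatr_eq0 -lt0n fact_gt0.
have := polarization x => pol.
have -> : \prod_(l < k) (al * sig (i + l.+1) + be) =
    (\sum_(S : {set 'I_k}) (-1) ^+ #|~: S| * (\sum_(l in S) x l) ^+ k) / k`!%:R.
  by rewrite pol mulrC mulKf.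
rewrite !mulr_suml; apply: eq_bigr => S _; rewrite /qi_weight /qi_coef /=.
have -> : (\sum_(l in S) x l) ^+ k = #|S|%:R ^+ k * (al * qi_node (i, S) + be) ^+ k.
  rewrite -exprMn; have [S0|S0] := eqVneq #|S| 0%N.
    rewrite S0 mul0r big_pred0; last by move=> l; rewrite (cards0_eq S0) inE.
    by case: (k) => [|k']; rewrite ?expr0n.
  rewrite /qi_node /= (negbTE S0); congr (_ ^+ _).
  have c0 : #|S|%:R != 0 :> R by rewrite pnatr_eq0.
  rewrite big_split /= -mulr_sumr sumr_const -mulr_natl.
  by field.
by rewrite !mulrA; ring.
Qed.

Lemma qi_reproduce (t : R) (p : {poly R}) : 0 <= t <= 1 -> (size p <= k.+1)%N ->
  \sum_a qi_weight a t * p.[qi_node a] = p.[t].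
Proof.
move=> t01; apply: power_reproduction => be.
have := qi_power 1 be t01; rewrite mul1r => <-.
by apply: eq_bigr => a _; rewrite mul1r.
Qed.

Lemma qi_bound (t : R) : 0 <= t <= 1 -> \sum_a `|qi_weight a t| <= qi_norm.
Proof.
move=> t01; have [m tm] := in_cell_exists kc sc t01.
rewrite -(pair_bigA _ (fun i S => `|qi_weight (i, S) t|)) /= /qi_weight /=.
under eq_bigr => i _.
  under eq_bigr do rewrite normrM.
  rewrite -mulr_suml -/qi_norm ger0_norm; last first.
    by apply: (bspline_ge0 kc tm); have := ltn_ord i; lia.
  over.
by rewrite -mulr_sumr (bspline_sum1 kc sc tm) mulr1.
Qed.

Lemma qi_node_between (a : qi_index) : sig a.1 <= qi_node a <= sig (a.1 + k.+1).
Proof.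
rewrite /qi_node; case: eqVneq => [_|S0].
  by apply/andP; split; apply: (clamp_le knots); lia.
have c0 : 0 < #|a.2|%:R :> R by rewrite ltr0n lt0n.
rewrite ler_pdivlMr// ler_pdivrMr// !mulr_natr -!sumr_const.
by apply/andP; split; apply: ler_sum => l _; apply: (clamp_le knots); have := ltn_ord l; lia.
Qed.

Lemma qi_node01 (a : qi_index) : 0 <= qi_node a <= 1.
Proof.
have /andP[h1 h2] := qi_node_between a.
have /andP[h3 _] := clamp01 knots a.1.
have /andP[_ h4] := clamp01 knots (a.1 + k.+1).
by rewrite (le_trans h3 h1) (le_trans h2 h4).
Qed.

Lemma qi_local (h t : R) (a : qi_index) : 0 <= h ->
  (forall i, (k <= i < k + J)%N -> tau i.+1 - tau i <= h) ->
  0 <= t <= 1 -> qi_weight a t != 0 -> `|qi_node a - t| <= k.+1%:R * h.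
Proof.
move=> h0 th t01; have [m tm] := in_cell_exists kc sc t01.
rewrite mulf_eq0 negb_or => /andP[_ Bt].
have im := bspline_neq0_cell tm (ltn_ord a.1) Bt.
have /andP[a1 a2] := bspline_supp kc tm im.
have e i : clamp sig k J i = sig i by rewrite /clamp; congr tau; lia.
rewrite !e in a1 a2.
have /andP[b1 b2] := qi_node_between a.
have := clamp_width h0 th a.1 k.+1.
rewrite ler_norml => w; apply/andP; split; lra.
Qed.

(** The polynomial [p] is reproduced, so only [f - p] matters, at [t] and at the
    nodes of nonzero weight, which are at distance at most [k.+1%:R * h]. *)
Lemma qi_error (h t E : R) (f : R -> R) (p : {poly R}) : 0 <= h -> 0 <= E ->
  (forall i, (k <= i < k + J)%N -> tau i.+1 - tau i <= h) ->
  0 <= t <= 1 -> (size p <= k.+1)%N ->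
  (forall s, 0 <= s <= 1 -> `|s - t| <= k.+1%:R * h -> `|f s - p.[s]| <= E) ->
  `|f t - \sum_a f (qi_node a) * qi_weight a t| <= (1 + qi_norm) * E.
Proof.
move=> h0 E0 th t01 sp fp.
have -> : f t - \sum_a f (qi_node a) * qi_weight a t =
    (f t - p.[t]) - \sum_a (f (qi_node a) - p.[qi_node a]) * qi_weight a t.
  rewrite -(qi_reproduce t01 sp) -addrA -opprD -big_split /=; congr (_ - _).
  by apply: eq_bigr => a _; ring.
apply: (le_trans (ler_normB _ _)); rewrite mulrDl mul1r lerD//.
  by apply: fp => //; rewrite subrr normr0 mulr_ge0.
apply: (le_trans (ler_norm_sum _ _ _)).
apply: (@le_trans _ _ (\sum_a `|qi_weight a t| * E)); last first.
  by rewrite -mulr_suml ler_wpM2r// qi_bound.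
apply: ler_sum => a _; rewrite normrM mulrC.
have [->|w0] := eqVneq (qi_weight a t) 0; first by rewrite normr0 !mul0r.
by rewrite ler_wpM2l// fp// ?qi_node01// qi_local.
Qed.

Lemma qi_norm_ge0 : 0 <= qi_norm.
Proof. exact: sumr_ge0. Qed.

(** The quasi-interpolant is built from the B-splines with clamped knots, which
    [change_outer_knots] expresses in the original ones. *)
Lemma qi_span : exists B : qi_index -> 'I_(J + k) -> R, forall a t, 0 <= t <= 1 ->
  qi_weight a t = \sum_i B a i * bspline tau k i t.
Proof.
have [A HA] := change_outer_knots knots kc tau_strict (@clamp_inner _ tau k J).
exists (fun a i => qi_coef a.2 * A a.1 i) => a t t01.
rewrite /qi_weight; have /colP /(_ a.1) := HA t t01.
rewrite !mxE => ->; rewrite mulr_sumr; apply: eq_bigr => i _.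
by rewrite mxE mulrA.
Qed.

End quasi_interpolant.

(** * Approximation of Hoelder functions by tensor products *)

Section taylor.
Context {R : realType}.

Definition antideriv (p : {poly R}) : {poly R} :=
  \poly_(i < (size p).+1) (p`_i.-1 / i%:R).

Lemma antideriv_deriv (p : {poly R}) : (antideriv p)^`() = p.
Proof.
apply/polyP => i; rewrite coef_deriv coef_poly /= ltnS.
case: ltnP => h; last by rewrite mul0rn nth_default.
by rewrite -[LHS]mulr_natr mulfVK// pnatr_eq0.
Qed.

(** Taylor's theorem with a polynomial that need not be written down: it is
    obtained by integrating [N] times the constant approximation of the last
    derivative. *)
Lemma local_polynomial (N : nat) (F : nat -> R -> R) (t rho E : R) :
  0 <= t <= 1 -> 0 <= rho -> 0 <= E ->
  (forall i (s : R), (i < N)%N -> is_derive s (1 : R) (F i) (F i.+1 s)) ->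
  (forall s, 0 <= s <= 1 -> `|s - t| <= rho -> `|F N s - F N t| <= E) ->
  exists p : {poly R}, (size p <= N.+1)%N /\
    forall s, 0 <= s <= 1 -> `|s - t| <= rho -> `|F 0 s - p.[s]| <= E * rho ^+ N.
Proof.
move=> t01 rho0 E0; elim: N F => [|N IH] F dF FE.
  exists (F 0 t)%:P; split; first exact: size_polyC_leq1.
  by move=> s s01 st; rewrite hornerC expr0 mulr1 FE.
have [|p' [sp' Hp']] := IH (fun i => F i.+1) _ FE.
  by move=> i s iN; apply: dF.
pose p := antideriv p' + (F 0 t - (antideriv p').[t])%:P.
have dp : p^`() = p' by rewrite derivD derivC addr0 antideriv_deriv.
exists p; split.
  apply: (leq_trans (size_polyD _ _)); rewrite geq_max; apply/andP; split.
    by apply: (leq_trans (size_poly _ _)).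
  exact: (leq_trans (size_polyC_leq1 _)).
pose g s := F 0 s - p.[s].
have gt : g t = 0 by rewrite /g hornerD hornerC addrCA subrr addr0 subrr.
have dg (s : R) : is_derive s (1 : R) g (F 1 s - p'.[s]).
  have h1 := dF 0%N s (ltn0Sn N).
  have h2 : is_derive s (1 : R) (horner p) p'.[s].
    by apply: DeriveDef; [exact: derivable_horner|rewrite -dp derivE derive1E].
  exact: is_deriveB.
have cg a b : {within `[a, b], continuous g}.
  apply: derivable_within_continuous => s _; exact: ex_derive.
have main a b : 0 <= a -> a <= b -> b <= 1 -> (forall s, a <= s <= b -> `|s - t| <= rho) ->
    b - a <= rho -> `|g b - g a| <= E * rho ^+ N.+1.
  move=> a0 ab b1 abt ba.
  have [c cab ->] := MVT_segment ab (fun s _ => dg s) (cg a b).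
  move: cab; rewrite in_itv /= => /andP[ac cb].
  rewrite normrM exprSr mulrA; apply: ler_pM => //.
    by apply: Hp'; [rewrite (le_trans a0 ac) (le_trans cb b1)|apply: abt; rewrite ac].
  by rewrite ger0_norm// subr_ge0.
move=> s /andP[s0 s1] st; rewrite -/(g s).
have /andP[t0 t1] := t01.
have [ts|/ltW ts] := leP t s.
  rewrite -[g s]subr0 -gt; apply: main => //.
    move=> x /andP[tx xs]; rewrite ger0_norm ?subr_ge0//; apply: le_trans st.
    by rewrite ger0_norm ?subr_ge0// lerD2r.
  by move: st; rewrite ger0_norm// subr_ge0.
rewrite -[g s]subr0 -gt distrC; apply: main => //.
  move=> x /andP[tx xs]; rewrite ler0_norm ?subr_le0//; apply: le_trans st.
  by rewrite ler0_norm ?subr_le0// lerN2 lerD2r.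
by move: st; rewrite ler0_norm ?subr_le0// opprB.
Qed.

End taylor.

Section coordinates.
Context {R : realType} {r : nat}.
Implicit Types (u : 'I_r -> R) (j : 'I_r).

Definition upd u j (t : R) : 'I_r -> R := fun i => if i == j then t else u i.
Definition rowf u : 'rV[R]_r := \row_i u i.
Definition in_cube u : Prop := forall i, 0 <= u i <= 1.

Lemma upd_id u j : upd u j (u j) = u.
Proof. by apply/funext => i; rewrite /upd; case: eqP => [->|]. Qed.

Lemma updK u j s t : upd (upd u j s) j t = upd u j t.
Proof. by apply/funext => i; rewrite /upd; case: eqP. Qed.

Lemma updC u j j' s t : j != j' -> upd (upd u j s) j' t = upd (upd u j' t) j s.
Proof.
move=> jj; apply/funext => i; rewrite /upd; case: eqP => [->|//].
by rewrite eq_sym (negbTE jj).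
Qed.

Lemma in_cube_upd u j t : in_cube u -> 0 <= t <= 1 -> in_cube (upd u j t).
Proof. by move=> uc t01 i; rewrite /upd; case: eqP. Qed.

Lemma rowf_upd u j s h : rowf (upd u j (h + s)) = h *: delta_mx 0 j + rowf (upd u j s).
Proof.
apply/rowP => i; rewrite !mxE /upd eqxx /=; case: eqP => _.
  by rewrite mulr1.
by rewrite mulr0 add0r.
Qed.

Lemma is_derive_upd (phi : 'rV[R]_r -> R) u j (s : R) :
  (forall v, derivable phi v (delta_mx 0 j)) ->
  is_derive s (1 : R) (fun t => phi (rowf (upd u j t)))
    ('D_(delta_mx 0 j) phi (rowf (upd u j s))).
Proof.
move=> dphi; have := dphi (rowf (upd u j s)); rewrite /derivable => c.
have e : (fun h => h^-1 *: (((fun t => phi (rowf (upd u j t))) \o shift s) (h *: (1 : R)) -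
      phi (rowf (upd u j s)))) =
    (fun h => h^-1 *: ((phi \o shift (rowf (upd u j s))) (h *: delta_mx 0 j) -
      phi (rowf (upd u j s)))).
  apply/funext => h; rewrite /= /shift /=.
  by have -> : h *: (1 : R) = h; [exact: mulr1|rewrite rowf_upd].
by apply: DeriveDef; rewrite /derivable /derive e.
Qed.

Lemma bounded_on_cube (phi : 'rV[R]_r -> R) : continuous phi ->
  exists2 M, 0 <= M & forall u, in_cube u -> `|phi (rowf u)| <= M.
Proof.
move=> cphi; pose S := [set v : 'rV[R]_r | forall i, `[(0 : R), 1]%classic (v ord0 i)].
have cS : compact S by exact: rV_compact (fun=> @segment_compact _ _ _).
have S0 : S !=set0 by exists 0 => i /=; rewrite mxE in_itv /= lexx ler01.
have [|v _ vmax] := @compact_EVT_max _ _ (fun v : 'rV[R]_r => `|phi v|) S S0 cS.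
  apply: continuous_subspaceT => v; exact: (continuous_comp (cphi v) (@norm_continuous _ _ _)).
exists `|phi v| => // u uc; apply: vmax; apply/mem_set => i /=.
by rewrite mxE in_itv /=; exact: uc.
Qed.

Lemma tuple_rowE u : tuple_row [tuple u i | i < r] = rowf u.
Proof. by apply/rowP => i; rewrite !mxE tnth_mktuple. Qed.

Lemma enorm_upd u j s t : enorm (rowf (upd u j s) - rowf (upd u j t)) = `|s - t|.
Proof.
rewrite /enorm big_ord1 (bigD1 j)//= big1 ?addr0.
  by rewrite !mxE /upd eqxx sqrtr_sqr.
by move=> i ij; rewrite !mxE /upd (negbTE ij) subrr expr0n.
Qed.

(** For [s < 1 + k] this is Taylor's formula of order [int s] along a coordinate
    line. Otherwise the derivative of order [k] is Lipschitz, since the next one is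
    continuous, hence bounded on the cube, and Taylor's formula of order [k]
    applies. *)
Lemma holder_local_polynomial (k : nat) (s : R) (g : 'rV[R]_r -> R) :
  0 < s -> holder s g -> exists2 C, 0 <= C &
  forall u j (rho : R), in_cube u -> 0 < rho ->
    exists p : {poly R}, (size p <= k.+1)%N /\
      forall t, 0 <= t <= 1 -> `|t - u j| <= rho ->
        `|g (rowf (upd u j t)) - p.[t]| <= C * rho `^ Num.min (1 + k%:R) s.
Proof.
move=> s0 [dg cg [C0 hg]].
pose C := Num.max C0 0.
have C_ge0 : 0 <= C by rewrite le_max lexx orbT.
have sbs : (Num.truncn s)%:R <= s by rewrite Num.Theory.truncn_le ltW.
have dF N u j : (N <= Num.truncn s)%N -> forall i (t : R), (i < N)%N ->
    is_derive t (1 : R) (fun t => partials (nseq i j) g (rowf (upd u j t)))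
      (partials (nseq i.+1 j) g (rowf (upd u j t))).
  move=> Ns i t iN; apply: is_derive_upd => v; apply: dg.
  by rewrite size_nseq (leq_trans iN).
have [sk|ks] := ltP s (1 + k%:R).
  have sb_k : (Num.truncn s <= k)%N.
    by rewrite Num.Theory.truncn_le_nat -natr1 addrC.
  exists C => // u j rho uc rho0.
  have e0 : 0 <= s - (Num.truncn s)%:R by rewrite subr_ge0.
  have [|||||p [sp Hp]] := @local_polynomial R (Num.truncn s)
    (fun i t => partials (nseq i j) g (rowf (upd u j t))) (u j) rho
    (C * rho `^ (s - (Num.truncn s)%:R)).
  - exact: uc.
  - exact: ltW.
  - by rewrite mulr_ge0 ?powR_ge0.
  - exact: dF.
  - move=> t t01 tu.
    have := hg (nseq (Num.truncn s) j) (size_nseq _ _)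
      [tuple upd u j (u j) i | i < r] [tuple upd u j t i | i < r].
    rewrite !tuple_rowE enorm_upd => h.
    apply: (le_trans (h _ _)).
    + by move=> i; rewrite tnth_mktuple upd_id.
    + by move=> i; rewrite tnth_mktuple; apply: in_cube_upd.
    apply: (@le_trans _ _ (C * `|t - u j| `^ (s - (Num.truncn s)%:R))).
      by rewrite ler_wpM2r ?powR_ge0// le_max lexx.
    by rewrite ler_wpM2l// ge0_ler_powR// ?nnegrE// ltW.
  exists p; split; first by apply: (leq_trans sp).
  move=> t t01 tu; apply: (le_trans (Hp t t01 tu)).
  rewrite -mulrA -(powR_mulrn _ (ltW rho0)) -powRD; last by rewrite (gt_eqF rho0) implybT.
  by rewrite subrK.
have k_sb : (k < Num.truncn s)%N.
  by rewrite ltnNge Num.Theory.truncn_le_nat -natr1 addrC -leNgt.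
have M_ex j : exists M, 0 <= M /\ forall u, in_cube u -> `|partials (nseq k.+1 j) g (rowf u)| <= M.
  have [|M M0 HM] := @bounded_on_cube (partials (nseq k.+1 j) g).
    by apply: cg; rewrite size_nseq.
  by exists M.
have [M HM] := choice M_ex.
exists (\sum_j M j); first by apply: sumr_ge0 => j _; case: (HM j).
move=> u j rho uc rho0.
have Mj : M j <= \sum_j M j.
  by rewrite (bigD1 j)//= lerDl; apply: sumr_ge0 => i _; case: (HM i).
have M0 : 0 <= \sum_j M j by apply: sumr_ge0 => i _; case: (HM i).
have [|||||p [sp Hp]] := @local_polynomial R k
    (fun i t => partials (nseq i j) g (rowf (upd u j t))) (u j) rho
    ((\sum_j M j) * rho).
- exact: uc.
- exact: ltW.
- by rewrite mulr_ge0// ltW.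
- exact: (dF k u j (ltnW k_sb)).
- pose f t := partials (nseq k j) g (rowf (upd u j t)).
  pose f' t := partials (nseq k.+1 j) g (rowf (upd u j t)).
  have df (t : R) : is_derive t (1 : R) f (f' t) by exact: (dF k.+1 u j k_sb k t (ltnSn k)).
  have cf a b : {within `[a, b], continuous f}.
    by apply: derivable_within_continuous => x _; exact: ex_derive.
  have main a b : 0 <= a -> a <= b -> b <= 1 -> b - a <= rho ->
      `|f b - f a| <= (\sum_j M j) * rho.
    move=> a0 ab b1 ba; have [c cab ->] := MVT_segment ab (fun x _ => df x) (cf a b).
    move: cab; rewrite in_itv /= => /andP[ac cb].
    rewrite normrM [X in _ * X]ger0_norm ?subr_ge0//; apply: ler_pM => //; first by rewrite subr_ge0.
    apply: le_trans Mj; apply: (proj2 (HM j)); apply: in_cube_upd => //.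
    by rewrite (le_trans a0 ac) (le_trans cb b1).
  move=> t /andP[t0 t1] tu; rewrite -/(f t) -/(f (u j)).
  have /andP[u0 u1] := uc j.
  have [ut|/ltW ut] := leP (u j) t.
    by apply: main => //; move: tu; rewrite ger0_norm// subr_ge0.
  by rewrite distrC; apply: main => //; move: tu; rewrite ler0_norm ?subr_le0// opprB.
exists p; split => // t t01 tu; apply: (le_trans (Hp t t01 tu)).
rewrite powRD; last by rewrite (gt_eqF rho0) implybT.
by rewrite (powRr1 (ltW rho0)) (powR_mulrn _ (ltW rho0)) mulrA.
Qed.

End coordinates.

Section tensor_approximation.
Context {R : realType} {r : nat}.
Variables (k : nat) (J : 'I_r -> nat) (tau : 'I_r -> nat -> R).
Hypothesis knots : forall j, knot_sequence k (J j) (tau j).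
Hypothesis tau_strict : forall j i, (k <= i < k + J j)%N -> tau j i < tau j i.+1.

Definition qi_op (j : 'I_r) (f : ('I_r -> R) -> R) : ('I_r -> R) -> R :=
  fun u => \sum_(a : qi_index k (J j))
    f (upd u j (qi_node (tau j) a)) * qi_weight (tau j) a (u j).

Definition qi_ops (js : seq 'I_r) (f : ('I_r -> R) -> R) := foldr qi_op f js.

Fixpoint qi_const (n : nat) : R :=
  if n is n'.+1 then 1 + qi_norm k + qi_norm k * qi_const n' else 0.

Lemma qi_const_ge0 n : 0 <= qi_const n.
Proof.
elim: n => //= n IH; have := @qi_norm_ge0 R k => N0.
by rewrite addr_ge0 ?addr_ge0 ?mulr_ge0.
Qed.

(** The error of the tensor product operator telescopes into one-dimensional
    errors of the original function, each multiplied by norms of the remaining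
    one-dimensional operators. *)
Lemma qi_ops_error (f : ('I_r -> R) -> R) (h E : R) : 0 <= h -> 0 <= E ->
  (forall j i, (k <= i < k + J j)%N -> tau j i.+1 - tau j i <= h) ->
  (forall u j, in_cube u -> exists p : {poly R}, (size p <= k.+1)%N /\
    forall t, 0 <= t <= 1 -> `|t - u j| <= k.+1%:R * h ->
      `|f (upd u j t) - p.[t]| <= E) ->
  forall js u, in_cube u -> `|f u - qi_ops js f u| <= qi_const (size js) * E.
Proof.
move=> h0 E0 th fp; elim=> [|j js IH] u uc /=; first by rewrite subrr normr0 mul0r.
have uj := uc j.
have [p [sp Hp]] := fp u j uc.
have e1 := @qi_error R (tau j) k (J j) (knots j) (@tau_strict j) h (u j) E
  (fun t => f (upd u j t)) p h0 E0 (th j) uj sp Hp.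
rewrite upd_id in e1.
have -> : f u - qi_op j (qi_ops js f) u =
    (f u - \sum_(a : qi_index k (J j)) f (upd u j (qi_node (tau j) a)) *
      qi_weight (tau j) a (u j)) +
    \sum_(a : qi_index k (J j)) (f (upd u j (qi_node (tau j) a)) -
      qi_ops js f (upd u j (qi_node (tau j) a))) * qi_weight (tau j) a (u j).
  by rewrite (eq_bigr _ (fun a _ => mulrBl _ _ _)) sumrB addrA subrK.
apply: (le_trans (ler_normD _ _)); rewrite mulrDl lerD//.
apply: (le_trans (ler_norm_sum _ _ _)).
apply: (@le_trans _ _ (\sum_(a : qi_index k (J j)) (qi_const (size js) * E) *
    `|qi_weight (tau j) a (u j)|)).
  apply: ler_sum => a _; rewrite normrM ler_wpM2r// IH//; apply: in_cube_upd => //.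
  exact: (qi_node01 (knots j)).
rewrite -mulr_sumr [leLHS]mulrC -[leRHS]mulrA; apply: ler_wpM2r.
  by rewrite mulr_ge0 ?qi_const_ge0.
exact: (qi_bound (knots j) (@tau_strict j)).
Qed.

(** The coefficients may still depend on the coordinates outside [js]. *)
Definition in_span (js : seq 'I_r) (f : ('I_r -> R) -> R) : Prop :=
  exists (I : finType) (c : I -> ('I_r -> R) -> R) (l : I -> 'I_r -> nat),
  [/\ forall a j, (l a j < J j + k)%N,
      forall a u j t, j \in js -> c a (upd u j t) = c a u &
      forall u, in_cube u ->
        f u = \sum_a c a u * \prod_(j <- js) bspline (tau j) k (l a j) (u j)].

Lemma qi_op_span j js f : j \notin js -> in_span js f -> in_span (j :: js) (qi_op j f).
Proof.
move=> jjs [I [c [l [lJ cinv fE]]]].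
have [B HB] := qi_span (knots j) (@tau_strict j).
exists (I * (qi_index k (J j) * 'I_(J j + k)))%type.
exists (fun b u => c b.1 (upd u j (qi_node (tau j) b.2.1)) * B b.2.1 b.2.2).
exists (fun b i => if i == j then nat_of_ord b.2.2 else l b.1 i).
split.
- by move=> [a [a0 i]] j' /=; case: eqP => [->|_] //.
- move=> [a [a0 i]] u j' t /=; rewrite inE => /orP[/eqP ->|j'js]; first by rewrite updK.
  rewrite updC; last by apply: contraNneq jjs => <-.
  by rewrite cinv.
- move=> u uc; rewrite /qi_op.
  rewrite -(pair_bigA _ (fun a b => c a (upd u j (qi_node (tau j) b.1)) * B b.1 b.2 *
    \prod_(j' <- j :: js) bspline (tau j') k
       (if j' == j then nat_of_ord b.2 else l a j') (u j'))) /=.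
  have E1 (a0 : qi_index k (J j)) : f (upd u j (qi_node (tau j) a0)) *
      qi_weight (tau j) a0 (u j) =
      \sum_a (c a (upd u j (qi_node (tau j) a0)) *
        \prod_(j' <- js) bspline (tau j') k (l a j') (upd u j (qi_node (tau j) a0) j')) *
        \sum_i B a0 i * bspline (tau j) k i (u j).
    rewrite fE; last by apply: in_cube_upd => //; exact: (qi_node01 (knots j)).
    by rewrite HB ?mulr_suml//; exact: uc.
  rewrite (eq_bigr _ (fun a0 _ => E1 a0)).
  rewrite exchange_big /=; apply: eq_bigr => a _.
  rewrite -(pair_bigA _ (fun b1 b2 => c a (upd u j (qi_node (tau j) b1)) * B b1 b2 *
    \prod_(j' <- j :: js) bspline (tau j') k
       (if j' == j then nat_of_ord b2 else l a j') (u j'))) /=.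
  apply: eq_bigr => a0 _; rewrite mulr_sumr; apply: eq_bigr => i _.
  rewrite big_cons eqxx.
  have -> : \prod_(j' <- js) bspline (tau j') k (l a j')
        (upd u j (qi_node (tau j) a0) j') =
      \prod_(j' <- js) bspline (tau j') k
        (if j' == j then nat_of_ord i else l a j') (u j').
    rewrite big_seq [RHS]big_seq; apply: eq_bigr => j' j'js.
    by rewrite /upd; case: eqP => // e; rewrite -e j'js in jjs.
  by ring.
Qed.

Lemma qi_ops_span js f : uniq js -> in_span js (qi_ops js f).
Proof.
elim: js => [_|j js IH /= /andP[jjs ujs]]; last by apply: qi_op_span => //; exact: IH.
exists unit, (fun _ u => f u), (fun _ _ => 0%N); split => //.
  by move=> _ j; have [J0 _ _ _] := knots j; rewrite addn_gt0 J0.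
move=> u _; rewrite big_const card_unit /= addr0 big_nil mulr1//.
Qed.

End tensor_approximation.

(** By [qi_ops_error] with the polynomials of [holder_local_polynomial] on intervals
    of radius [k.+1%:R * h]; once all coordinates are treated, the coefficients in
    [in_span] are constants. *)
Lemma spline_approximation {R : realType} {r : nat} (k : nat) (s : R)
    (g : 'rV[R]_r -> R) : 0 < s -> holder s g ->
  exists2 C, 0 <= C & forall (J : 'I_r -> nat) (tau : 'I_r -> nat -> R) (h : R),
    (forall j, knot_sequence k (J j) (tau j)) ->
    (forall j i, (k <= i < k + J j)%N -> tau j i < tau j i.+1) -> 0 < h ->
    (forall j i, (k <= i < k + J j)%N -> tau j i.+1 - tau j i <= h) ->
    exists (I : finType) (c : I -> R) (l : I -> 'I_r -> nat),
      (forall a j, (l a j < J j + k)%N) /\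
      forall u : 'I_r -> R, in_cube u ->
        `|g (rowf u) - \sum_a c a * \prod_j bspline (tau j) k (l a j) (u j)| <=
          C * h `^ Num.min (1 + k%:R) s.
Proof.
move=> s0 hg; have [C C0 HC] := holder_local_polynomial k s0 hg.
pose e := Num.min (1 + k%:R) s.
exists (qi_const k (size (enum 'I_r)) * (C * k.+1%:R `^ e)).
  by rewrite mulr_ge0 ?qi_const_ge0// mulr_ge0 ?powR_ge0.
move=> J tau h knots st h0 th.
pose f u := g (rowf u).
have [I [c [l [lJ cinv fE]]]] := qi_ops_span knots st f (enum_uniq 'I_r).
have err := @qi_ops_error R r k J tau knots st f h (C * (k.+1%:R * h) `^ e) (ltW h0).
exists I, (fun a => c a (fun=> 0)), l; split => // u uc.
have cconst a : c a u = c a (fun=> 0).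
  have gen (js : seq 'I_r) : c a (foldr (fun j v => upd v j (u j)) (fun=> 0) js) = c a (fun=> 0).
    by elim: js => //= j js IH; rewrite cinv ?mem_enum.
  rewrite -(gen (enum 'I_r)); congr (c a _); apply/funext => i.
  have : i \in enum 'I_r by rewrite mem_enum.
  elim: (enum 'I_r) => //= j js IH; rewrite inE /upd; case: eqP => [-> //|_ /=].
  exact: IH.
have -> : \sum_a c a (fun=> 0) * \prod_j bspline (tau j) k (l a j) (u j) =
    qi_ops k J tau (enum 'I_r) f u.
  rewrite fE//; apply: eq_bigr => a _; rewrite cconst; congr (_ * _).
  by rewrite big_enum.
apply: le_trans (err _ th _ (enum 'I_r) u uc) _.
- by rewrite mulr_ge0 ?powR_ge0.
- by move=> v j vc; apply: HC => //; rewrite mulr_gt0.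
by rewrite (powRM _ (ler0n _ _) (ltW h0)) !mulrA.
Qed.

(** * Tensor product bases and integrals over boxes *)

Section tensor_basis.
Context {R : realType}.
Variables (k : nat) (c C : R) (r K : nat).
Variables (J : 'I_r -> nat) (tau : 'I_r -> nat -> R).
Variable e : 'I_K -> {dffun forall j : 'I_r, 'I_(J j + k)}.
Hypothesis c0 : 0 < c.
Hypothesis r0 : (0 < r)%N.
Hypothesis knots : forall j, knot_sequence k (J j) (tau j).
Hypothesis spacing : forall j j' i, (k <= i < k + J j)%N ->
  c / (J j')%:R <= tau j i.+1 - tau j i <= C / (J j')%:R.
Hypothesis bij_e : bijective e.

Let J0 j : 0 < (J j)%:R :> R.
Proof. by rewrite ltr0n; case: (knots j). Qed.

Lemma spacing_strict j i : (k <= i < k + J j)%N -> tau j i < tau j i.+1.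
Proof.
by move=> ki; have /andP[+ _] := spacing j ki; rewrite -subr_gt0; apply: lt_le_trans; rewrite divr_gt0.
Qed.

Lemma card_basis : K = (\prod_j (J j + k))%N.
Proof.
rewrite -[LHS]card_ord (bij_eq_card bij_e) card_dep_ffun foldrE big_image.
by apply: eq_bigr => j _; rewrite card_ord.
Qed.

Lemma C_gt0 : 0 < C.
Proof.
pose j0 := Ordinal r0; have Jn : (0 < J j0)%N by case: (knots j0).
have h : (k <= k < k + J j0)%N by rewrite leqnn /= -[ltnLHS]addn0 ltn_add2l.
have /andP[h1 h2] := spacing j0 h.
have := lt_le_trans (divr_gt0 c0 (J0 j0)) (le_trans h1 h2).
by rewrite pmulr_lgt0// invr_gt0.
Qed.

Definition mesh : R := C * (1 + k%:R) * K%:R `^ (- r%:R^-1).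

Lemma K_gt0 : (0 < K)%N.
Proof.
rewrite card_basis prodn_gt0// => j.
by have [Jn _ _ _] := knots j; rewrite addn_gt0 Jn.
Qed.

Lemma mesh_gt0 : 0 < mesh.
Proof. by rewrite mulr_gt0 ?powR_gt0 ?ltr0n ?K_gt0// mulr_gt0 ?C_gt0// addr_gt0. Qed.

(** The number of splines determines the number of knots, hence the spacing, up
    to constants, since all coordinates carry comparably many knots. *)
Lemma spacing_mesh j i : (k <= i < k + J j)%N -> tau j i.+1 - tau j i <= mesh.
Proof.
move=> ki; pose j0 := Ordinal r0.
have [jm _ jmax] := @arg_maxnP _ j0 xpredT J isT.
have /andP[_ h] := spacing jm ki; apply: (le_trans h).
rewrite /mesh -mulrA; apply: (ler_wpM2l (ltW C_gt0)).
have K0 : 0 < K%:R :> R by rewrite ltr0n K_gt0.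
rewrite powRN -[leLHS]mul1r ler_pdivrMr// mulrAC ler_pdivlMr ?powR_gt0// mul1r.
have r0' : r%:R != 0 :> R by rewrite pnatr_eq0 -lt0n.
have -> : (1 + k%:R) * (J jm)%:R = (((1 + k%:R) * (J jm)%:R) `^ r%:R) `^ r%:R^-1 :> R.
  by rewrite -powRrM divff// powRr1// mulr_ge0// addr_ge0.
apply: ge0_ler_powR; rewrite ?nnegrE ?invr_ge0 ?powR_ge0//.
rewrite powR_mulrn ?mulr_ge0 ?addr_ge0// -[1]/(1%:R) -natrD -natrM -natrX ler_nat.
rewrite card_basis -[X in (_ <= _ ^ X)%N]card_ord -prod_nat_const.
apply: leq_prod => j' _; have := jmax j' isT; have [Jn _ _ _] := knots j'.
nia.
Qed.

Definition overlap : rel 'I_K := fun l l' =>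
  [forall j, (e l j <= e l' j + k)%N && (e l' j <= e l j + k)%N].

Lemma overlap_sym : symmetric overlap.
Proof.
by move=> l l'; apply/forallP/forallP => h j; rewrite andbC; exact: h.
Qed.

(** An index that overlaps with [l] is determined by the differences to [l] in the
    [r] coordinates, each of which takes at most [2 k + 1] values. *)
Lemma overlap_card l : (#|overlap l| <= k.*2.+1 ^ r)%N.
Proof.
pose f (l' : 'I_K) : {ffun 'I_r -> 'I_k.*2.+1} := [ffun j => inord (e l' j + k - e l j)].
have finj : {in overlap l &, injective f}.
  move=> a b; rewrite !unfold_in => /forallP ha /forallP hb fab.
  apply: (bij_inj bij_e); apply/ffunP => j; apply/val_inj => /=.
  have := congr1 (fun g : {ffun 'I_r -> 'I_k.*2.+1} => nat_of_ord (g j)) fab.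
  rewrite !ffunE; have := ha j; have := hb j => ? ?.
  clear c0 r0; rewrite !inordK; lia.
rewrite -(card_in_image finj); apply: (leq_trans (max_card _)).
by rewrite card_ffun !card_ord.
Qed.

Definition tprod (l : 'I_K) (v : r.-tuple R) : R :=
  \prod_j bspline (tau j) k (e l j) (tnth v j).

Lemma tprod_neq0 l v : cube v -> tprod l v != 0 -> exists m : 'I_r -> nat,
  forall j, in_cell (tau j) k (J j) (tnth v j) (m j) /\
    (e l j <= m j <= e l j + k)%N.
Proof.
move=> vc; rewrite /tprod prodf_seq_neq0 => /allP nz.
have [m Hm] := choice (fun j => in_cell_exists (knots j) (@spacing_strict j) (vc j)).
exists m => j; split=> //.
by apply: (bspline_neq0_cell (Hm j)); rewrite ?ltn_ord//; apply: nz; rewrite mem_index_enum.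
Qed.

Lemma in_cell_uniq j t m m' : in_cell (tau j) k (J j) t m ->
  in_cell (tau j) k (J j) t m' -> m = m'.
Proof.
move=> [km _ _ h] [km' _ _ h'].
have := h m ltac:(lia); rewrite h' ?eqxx; last by lia.
by case: eqP => // _ /eqP; rewrite eq_sym oner_eq0.
Qed.

Lemma overlap0 l l' v : cube v -> ~~ overlap l l' -> tprod l v * tprod l' v = 0.
Proof.
move=> vc; apply: contraNeq; rewrite mulf_eq0 negb_or => /andP[h h'].
have [m Hm] := tprod_neq0 vc h; have [m' Hm'] := tprod_neq0 vc h'.
apply/forallP => j; have [a1 a2] := Hm j; have [b1 b2] := Hm' j.
have := in_cell_uniq a1 b1; lia.
Qed.

Definition supp_lo l j := clamp (tau j) k (J j) (e l j).
Definition supp_hi l j := clamp (tau j) k (J j) (e l j + k.+1).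

Lemma supp_box l v : cube v -> tprod l v != 0 ->
  forall j, supp_lo l j <= tnth v j <= supp_hi l j.
Proof.
move=> vc h j; have [m Hm] := tprod_neq0 vc h; have [a1 a2] := Hm j.
exact: (bspline_supp (knots j) a1 a2).
Qed.

Lemma supp_width l j : 0 <= supp_hi l j - supp_lo l j <= k.+1%:R * mesh.
Proof.
rewrite subr_ge0; apply/andP; split; first by apply: (clamp_le (knots j)); lia.
by apply: clamp_width; [exact/ltW/mesh_gt0|exact: spacing_mesh].
Qed.

Lemma supp_01 l j : 0 <= supp_lo l j /\ supp_hi l j <= 1.
Proof.
have /andP[h1 _] := clamp01 (knots j) (e l j).
by have /andP[_ h2] := clamp01 (knots j) (e l j + k.+1).
Qed.

Lemma index_onto (l : 'I_r -> nat) : (forall j, (l j < J j + k)%N) ->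
  exists a : 'I_K, forall j, nat_of_ord (e a j) = l j.
Proof.
move=> lJ; have [e' _ ee'] := bij_e.
exists (e' [ffun j => Ordinal (lJ j)]) => j.
by rewrite ee' ffunE.
Qed.

End tensor_basis.

Section tensor_bspline_facts.
Context {R : realType}.

Lemma measurable_bspline (tau : nat -> R) (k i : nat) :
  measurable_fun setT (bspline tau k i).
Proof.
elim: k i => [|k IH] i.
  have mif (b : R -> bool) : measurable_fun setT b ->
      measurable_fun setT (fun t => (b t)%:R : R).
    move=> mb; rewrite (_ : (fun t => _) = fun t => if b t then 1 else 0).
      by apply: measurable_fun_ifT => //.
    by apply/funext => t; case: (b t).
  apply: mif; apply: measurable_fun_ifT.
  - exact: measurable_fun_ltr.
  - by apply: measurable_and; [exact: measurable_fun_ler|exact: measurable_fun_ltr].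
  - by apply: measurable_and; [exact: measurable_fun_ltr|exact: measurable_fun_ler].
rewrite (_ : bspline tau k.+1 i = fun t =>
    (t - tau i) / (tau (i + k.+1)%N - tau i) * bspline tau k i t +
      (tau (i + k.+2)%N - t) / (tau (i + k.+2)%N - tau i.+1) *
        bspline tau k i.+1 t)//.
apply: measurable_funD; apply: measurable_funM => //; apply: measurable_funM => //.
- exact: measurable_funB.
- exact: measurable_funB.
Qed.

Lemma measurable_tensor_bspline k (c C : R) r K (q : r.-tuple R -> 'cV[R]_K) l :
  tensor_bspline k c C q -> measurable_fun setT (fun v => q v l 0).
Proof.
move=> [J [tau [e [scale [_ _ _ qE]]]]].
rewrite (_ : (fun v => _) = fun v =>
    scale l * \prod_j bspline (tau j) k (e l j) (tnth v j)); last first.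
  by apply/funext => v; rewrite qE.
apply: measurable_funM => //; apply: measurable_prod => j _.
exact: (measurableT_comp (measurable_bspline _ _ _) (measurable_tnth j)).
Qed.

(** Overlapping makes the second moment matrices sparse, and a box of volume of
    order [1 / K] carries each basis function. *)
Lemma tensor_bspline_local k (c C : R) r K (q : r.-tuple R -> 'cV[R]_K) :
  0 < c -> (0 < r)%N -> tensor_bspline k c C q ->
  exists (ov : rel 'I_K) (lo hi : 'I_K -> 'I_r -> R),
    [/\ symmetric ov, forall l, (#|ov l| <= k.*2.+1 ^ r)%N,
      forall l l' v, cube v -> ~~ ov l l' -> q v l 0 * q v l' 0 = 0,
      forall l j, [/\ 0 <= lo l j, lo l j <= hi l j, hi l j <= 1 &
        hi l j - lo l j <= k.+1%:R * (C * (1 + k%:R) * K%:R `^ (- r%:R^-1))] &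
      forall l v, cube v -> q v l 0 != 0 -> forall j, lo l j <= tnth v j <= hi l j].
Proof.
move=> c0 r0 [J [tau [e [scale [knots spacing be qE]]]]].
exists (overlap e), (supp_lo tau e), (supp_hi tau e); split.
- exact: overlap_sym.
- move=> l; exact: (overlap_card be l).
- move=> l l' v vc h; rewrite !qE mulrACA.
  by rewrite -/(tprod tau e l v) -/(tprod tau e l' v) (overlap0 c0 r0 knots spacing vc h) mulr0.
- move=> l j; have [h1 h2] := supp_01 e knots l j.
  have /andP[h3 h4] := supp_width c0 r0 knots spacing be l j.
  by split => //; rewrite -subr_ge0.
- move=> l v vc; rewrite qE mulf_eq0 negb_or => /andP[_ h].
  exact: (supp_box c0 knots spacing vc h).
Qed.

(** The scale factors are nonzero, since no basis function vanishes on the cube, so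
    the spline of [spline_approximation] is a combination of the basis. *)
Lemma tensor_bspline_approximation k (c C s : R) r (g : 'rV[R]_r -> R) :
  0 < c -> (0 < r)%N -> 0 < s -> holder s g ->
  exists2 D, 0 <= D & forall K (q : r.-tuple R -> 'cV[R]_K),
    tensor_bspline k c C q -> (forall l, exists2 v, cube v & q v l 0 != 0) ->
    exists b : 'cV[R]_K, forall v, cube v ->
      `|g (tuple_row v) - dot (q v) b| <= D * K%:R `^ (- zeta k r s).
Proof.
move=> c0 r0 s0 hg; have [D D0 HD] := spline_approximation k s0 hg.
pose m := Num.min (1 + k%:R) s.
exists (D * (C * (1 + k%:R)) `^ m); first by rewrite mulr_ge0 ?powR_ge0.
move=> K q [J [tau [e [scale [knots spacing be qE]]]]] qnz.
have st j i := spacing_strict c0 knots spacing (j := j) (i := i).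
have h0 := mesh_gt0 c0 r0 knots spacing be.
have hs j i := spacing_mesh c0 r0 knots spacing be (j := j) (i := i).
have C0 := C_gt0 c0 r0 knots spacing.
have [I [a [l [lJ Ha]]]] := HD J tau (mesh k C r K) knots st h0 hs.
have [idx Hidx] := choice (fun b => index_onto be (lJ b)).
have sc0 i : scale i != 0.
  by have [v vc] := qnz i; rewrite qE mulf_eq0 negb_or => /andP[].
exists (\col_i ((scale i)^-1 * \sum_(b | idx b == i) a b)) => v vc.
have vc' : in_cube (tnth v) by [].
have := Ha _ vc'.
have -> : rowf (tnth v) = tuple_row v by [].
have -> : \sum_b a b * \prod_j bspline (tau j) k (l b j) (tnth v j) =
    dot (q v) (\col_i ((scale i)^-1 * \sum_(b | idx b == i) a b)).
  rewrite /dot (partition_big idx xpredT) //=; apply: eq_bigr => i _.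
  rewrite qE mxE mulrACA mulfV// mul1r mulrC mulr_suml; apply: eq_bigr => b /eqP bi.
  by congr (_ * _); apply: eq_bigr => j _; rewrite -bi Hidx.
have B0 : 0 <= C * (1 + k%:R) by rewrite mulr_ge0 ?addr_ge0// ltW.
move=> /le_trans; apply; rewrite -mulrA ler_wpM2l//.
rewrite /mesh (powRM _ B0 (powR_ge0 _ _)) -powRrM.
by rewrite mulNr [r%:R^-1 * _]mulrC.
Qed.

End tensor_bspline_facts.

Section iterated_integral.
Context {R : realType}.
Local Open Scope ereal_scope.

(** Monotonicity holds without measurability, which the sections of the functions
    in [lebesgue_iint] need not have. *)
Lemma ge0_le_integral_nomeas d (T : measurableType d) (mu : {measure set T -> \bar R})
    (f g : T -> \bar R) :
  (forall x, 0 <= f x) -> (forall x, f x <= g x) ->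
  \int[mu]_x f x <= \int[mu]_x g x.
Proof.
move=> f0 fg; have g0 x : 0 <= g x by exact: le_trans (f0 x) (fg x).
rewrite !ge0_integralTE//; apply: ub_ereal_sup => _ [h hf <-].
by apply: ereal_sup_ubound; exists h => // x; exact: le_trans (hf x) (fg x).
Qed.

Lemma lebesgue_iint_ge0 r (f : r.-tuple R -> \bar R) :
  (forall v, 0 <= f v) -> 0 <= lebesgue_iint f.
Proof.
elim: r f => [|r IH] f f0 /=; first exact: f0.
by apply: integral_ge0 => t _; apply: IH => v; exact: f0.
Qed.

(** Induction on the dimension: the inner integral is at most a constant multiple of
    the indicator of the first side of the box. *)
Lemma lebesgue_iint_box_le r (f : r.-tuple R -> \bar R) (D : R) (lo hi : 'I_r -> R) :
  (0 <= D)%R -> (forall j, (lo j <= hi j)%R) -> (forall v, 0 <= f v) ->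
  (forall v, f v <= D%:E) ->
  (forall v, ~ (forall j, (lo j <= tnth v j <= hi j)%R) -> f v = 0) ->
  lebesgue_iint f <= (D * \prod_j (hi j - lo j))%:E.
Proof.
elim: r D f lo hi => [|r IH] D f lo hi D0 lh f0 fD fz /=.
  by rewrite big_ord0 mulr1.
rewrite big_ord_recl.
pose P := (D * \prod_(j < r) (hi (lift ord0 j) - lo (lift ord0 j)))%R.
have P0 : (0 <= P)%R by rewrite mulr_ge0// prodr_ge0// => j _; rewrite subr_ge0.
apply: (@le_trans _ _ (\int[lebesgue_measure]_t (P%:E * (\1_`[lo ord0, hi ord0] t)%:E))).
  apply: ge0_le_integral_nomeas => t.
    by apply: lebesgue_iint_ge0 => v; exact: f0.
  rewrite indicE; case: (boolP (t \in _)) => [|tn].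
    move=> _; rewrite mule1; apply: IH => //.
    move=> v nv; apply: fz => h; apply: nv => j.
    by have := h (lift ord0 j); rewrite tnthS.
  rewrite mule0 -[X in _ <= X](mul0e (\prod_(j < r) (hi (lift ord0 j) - lo (lift ord0 j)))%:E) -EFinM.
  apply: IH => //.
    move=> v; rewrite fz// => h; move/negP: tn; apply; apply/mem_set => /=.
    by rewrite in_itv /=; have := h ord0; rewrite tnth0.
  by move=> v _; apply: fz => h; move/negP: tn; apply; apply/mem_set => /=;
    rewrite in_itv /=; have := h ord0; rewrite tnth0.
rewrite ge0_integralZl//; last first.
  by apply/measurable_EFinP; exact: measurable_indic.
have -> : \int[lebesgue_measure]_x (\1_`[lo ord0, hi ord0] x)%:E = (hi ord0 - lo ord0)%:E.
  rewrite integral_indic// setIT.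
  apply: (etrans (lebesgue_measure_itv `[lo ord0, hi ord0])); rewrite /= lte_fin.
  case: ltP => h; first by rewrite -EFinB.
  by have -> : hi ord0 = lo ord0; [apply/le_anti; rewrite h lh|rewrite subrr].
by rewrite -EFinM lee_fin mulrCA mulrC.
Qed.

End iterated_integral.

(** * Measurability of matrix-valued functions *)

Section measurable_matrix.
Context {R : realType} d (T : measurableType d).

Definition mxmeas m n (A : T -> 'M[R]_(m, n)) : Prop :=
  forall i j, measurable_fun setT (fun t => A t i j).

Lemma mxmeasD m n (A B : T -> 'M[R]_(m, n)) : mxmeas A -> mxmeas B ->
  mxmeas (fun t => A t + B t).
Proof.
move=> mA mB i j; rewrite (_ : (fun _ => _) = fun t => A t i j + B t i j).
  exact: measurable_funD.
by apply/funext => t; rewrite mxE.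
Qed.

Lemma mxmeasZ m n (a : T -> R) (A : T -> 'M[R]_(m, n)) :
  measurable_fun setT a -> mxmeas A -> mxmeas (fun t => a t *: A t).
Proof.
move=> ma mA i j; rewrite (_ : (fun _ => _) = fun t => a t * A t i j).
  exact: measurable_funM.
by apply/funext => t; rewrite mxE.
Qed.

Lemma measurable_inv : measurable_fun setT (fun x : R => x^-1).
Proof.
rewrite (_ : (fun x => _) = fun x : R => x * (`|x| `^ (-1)) ^+ 2).
  apply: measurable_funM => //; apply: measurable_funX.
  exact: (measurableT_comp (measurable_powR _)).
apply/funext => x; have [->|x0] := eqVneq x 0; first by rewrite invr0 mul0r.
rewrite powR_inv1// exprVn real_normK ?num_real// expr2 invfM.
by rewrite mulrA divff// mul1r.
Qed.

Lemma mxmeas_cst m n (A : 'M[R]_(m, n)) : mxmeas (fun=> A).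
Proof. by move=> i j. Qed.

Lemma mxmeasB m n (A B : T -> 'M[R]_(m, n)) : mxmeas A -> mxmeas B ->
  mxmeas (fun t => A t - B t).
Proof.
move=> mA mB; have := mxmeasD mA (mxmeasZ (a := fun=> -1) (measurable_cst _) mB).
by congr mxmeas; apply/funext => t; rewrite scaleN1r.
Qed.

Lemma measurable_bigsum (I : finType) (Q : pred I) (f : I -> T -> R) :
  (forall i, measurable_fun setT (f i)) ->
  measurable_fun setT (fun t => \sum_(i | Q i) f i t).
Proof.
move=> mf; rewrite (_ : (fun _ => _) = fun t => \sum_(i <- enum Q) f i t).
  by apply: measurable_sum => i.
by apply/funext => t; rewrite big_enum.
Qed.

Lemma mxmeas_sum m n (I : finType) (Q : pred I) (A : I -> T -> 'M[R]_(m, n)) :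
  (forall i, mxmeas (A i)) -> mxmeas (fun t => \sum_(i | Q i) A i t).
Proof.
move=> mA i j; rewrite (_ : (fun _ => _) = fun t => \sum_(k | Q k) A k t i j).
  by apply: measurable_bigsum => k; exact: mA.
by apply/funext => t; rewrite summxE.
Qed.

Lemma mxmeasM m n p (A : T -> 'M[R]_(m, n)) (B : T -> 'M[R]_(n, p)) :
  mxmeas A -> mxmeas B -> mxmeas (fun t => A t *m B t).
Proof.
move=> mA mB i j; rewrite (_ : (fun _ => _) = fun t => \sum_k A t i k * B t k j).
  by apply: measurable_bigsum => k; exact: measurable_funM.
by apply/funext => t; rewrite mxE.
Qed.

Lemma mxmeasT m n (A : T -> 'M[R]_(m, n)) : mxmeas A -> mxmeas (fun t => (A t)^T).
Proof.
by move=> mA i j; rewrite (_ : (fun _ => _) = fun t => A t j i)//; apply/funext => t; rewrite mxE.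
Qed.

Lemma measurable_det n (A : T -> 'M[R]_n) : mxmeas A ->
  measurable_fun setT (fun t => \det (A t)).
Proof.
move=> mA; apply: measurable_bigsum => s; apply: measurable_funM => //.
by apply: measurable_prod => i _; exact: mA.
Qed.

Lemma mxmeas_adj n (A : T -> 'M[R]_n) : mxmeas A -> mxmeas (fun t => \adj (A t)).
Proof.
move=> mA i j; rewrite (_ : (fun _ => _) = fun t => (-1) ^+ (j + i) *
    \det (row' j (col' i (A t)))); last first.
  by apply/funext => t; rewrite mxE.
apply: measurable_funM => //; apply: measurable_det => a b.
by rewrite (_ : (fun _ => _) = fun t => A t (lift j a) (lift i b))//;
  apply/funext => t; rewrite !mxE.
Qed.

(** A rational function of the entries, hence measurable; it is the inverse where
    that exists. *)
Definition adjinv n (A : 'M[R]_n) : 'M[R]_n := (\det A)^-1 *: \adj A.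

Lemma adjinvE n (A : 'M[R]_n) : A \in unitmx -> adjinv A = invmx A.
Proof. by move=> uA; rewrite /invmx uA. Qed.

Lemma mxmeas_adjinv n (A : T -> 'M[R]_n) : mxmeas A ->
  mxmeas (fun t => adjinv (A t)).
Proof.
move=> mA; apply: mxmeasZ; last exact: mxmeas_adj.
exact: (measurableT_comp measurable_inv (measurable_det mA)).
Qed.

Lemma measurable_dot n (u v : T -> 'cV[R]_n) : mxmeas u -> mxmeas v ->
  measurable_fun setT (fun t => dot (u t) (v t)).
Proof.
by move=> mu mv; apply: measurable_bigsum => i; exact: measurable_funM.
Qed.

Lemma measurable_sqn n (u : T -> 'cV[R]_n) : mxmeas u ->
  measurable_fun setT (fun t => sqn (u t)).
Proof. by move=> mu; apply: measurable_bigsum => i; exact: measurable_funX. Qed.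

Lemma measurable_nat_of_bool (b : T -> bool) : measurable_fun setT b ->
  measurable_fun setT (fun t => (b t)%:R : R).
Proof.
move=> mb; rewrite (_ : (fun t => _) = fun t => if b t then 1 else 0).
  exact: measurable_fun_ifT.
by apply/funext => t; case: (b t).
Qed.

Definition entries_le n (A : 'M[R]_n) (t : R) : bool :=
  [forall k, forall l, (`|A k l| <= t)%R].

Lemma measurable_entries_le n (A : T -> 'M[R]_n) (t : R) : mxmeas A ->
  measurable_fun setT (fun o => (entries_le (A o) t)%:R : R).
Proof.
move=> mA; rewrite (_ : (fun _ => _) =
    fun o => \prod_k \prod_l (((`|A o k l| <= t)%R : bool)%:R : R)).
  apply: measurable_prod => k _; apply: measurable_prod => l _.
  apply: measurable_nat_of_bool; apply: measurable_fun_ler => //.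
  by apply: measurableT_comp => //; exact: mA.
apply/funext => o; rewrite /entries_le.
case: (boolP [forall k, _]) => [/forallP h|].
  by rewrite big1// => k _; rewrite big1// => l _; rewrite (forallP (h k)).
rewrite negb_forall => /existsP[k]; rewrite negb_forall => /existsP[l /negbTE h].
by rewrite (bigD1 k)//= (bigD1 l)//= h !mul0r.
Qed.

End measurable_matrix.

(** A comparison of conditional means given the other observations. *)
Lemma resample_mean_le {R : realType} d (Z : measurableType d) (F : probability Z R)
    n (mu : probability (n.-tuple Z) R) : iid_law F mu ->
  forall (i : 'I_n) (f g : n.-tuple Z -> R),
  measurable_fun setT f -> (forall t, 0 <= f t) -> integ mu g -> (forall t, 0 <= g t) ->
  (forall t, (\int[F]_u (f (tset i u t))%:E <= \int[F]_u (g (tset i u t))%:E)%E) ->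
  integ mu f /\ mean mu f <= mean mu g.
Proof.
move=> muF i f g mf f0 Ig g0 fg.
have mEf : measurable_fun setT (EFin \o f) by exact/measurable_EFinP.
have h : (\int[mu]_t (f t)%:E <= (mean mu g)%:E)%E.
  rewrite -meanE// (resample_ge0 muF i)//.
  rewrite [leRHS](resample_ge0 muF i)//; last exact: measurable_int Ig.
  apply: ge0_le_integral_nomeas => // t.
  by apply: integral_ge0 => u _; rewrite lee_fin.
have If : integ mu f.
  apply/integrableP; split => //.
  under eq_integral do rewrite /= ger0_norm//.
  exact: le_lt_trans h (ltry _).
by split=> //; rewrite -lee_fin -meanE.
Qed.

(** * Sample second moments and conditional variances *)

Section sample.
Context {R : realType} dZ dX (Z : measurableType dZ) (X : measurableType dX).
Variables (F : probability Z R) (x : Z -> X).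
Hypothesis mx : measurable_fun setT x.
Variables (n : nat) (mu : probability (n.-tuple Z) R).
Hypothesis muF : iid_law F mu.
Variables (K : nat) (p : X -> 'cV[R]_K) (b : R).
Hypothesis mp : mxmeas p.
Hypothesis pb : forall v, sqn (p v) <= b.
Variable T : {set 'I_n}.
Hypothesis T0 : (0 < #|T|)%N.

Local Notation N := (#|T|%:R : R).
Let N0 : 0 < N. Proof. by rewrite ltr0n. Qed.
Let b0 : 0 <= b. Proof. exact: le_trans (sqn_ge0 _) (pb point). Qed.

Let le_of_eq (y z : R) : y = z -> y <= z. Proof. by move=> ->. Qed.

Definition xsample (o : n.-tuple Z) : 'I_n -> X := fun i => x (tnth o i).

Definition updX (xi : 'I_n -> X) (i : 'I_n) (v : X) : 'I_n -> X :=
  fun j => if j == i then v else xi j.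

Lemma xsample_tset i u o : xsample (tset i u o) = updX (xsample o) i (x u).
Proof. by apply/funext => j; rewrite /xsample /updX tnth_tset; case: eqP. Qed.

Lemma measurable_xsample i : measurable_fun setT (fun o => xsample o i).
Proof. exact: (measurableT_comp mx (measurable_tnth i)). Qed.

Lemma measurable_updX xi i j : measurable_fun setT (fun v => updX xi i v j).
Proof. by rewrite /updX; case: eqP. Qed.

Definition gram : 'M[R]_K :=
  \matrix_(k, l) mean F (fun u => p (x u) k 0 * p (x u) l 0).

Definition gramhat (xi : 'I_n -> X) : 'M[R]_K := sample_gram p xi T.

Definition dev xi : 'M[R]_K := gramhat xi - gram.

Definition pavg (e : Z -> R) (o : n.-tuple Z) : 'cV[R]_K :=
  sample_cross p (xsample o) (fun i => e (tnth o i)) T.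

Lemma p_entry v k : p v k 0 ^+ 2 <= b.
Proof.
apply: le_trans (pb v); rewrite /sqn (bigD1 k)//= lerDl.
by apply: sumr_ge0 => l _; exact: sqr_ge0.
Qed.

Lemma p_entry2 v k l : `|p v k 0 * p v l 0| <= b.
Proof.
have := p_entry v k; have := p_entry v l.
have := sqr_ge0 (p v k 0 - p v l 0); have := sqr_ge0 (p v k 0 + p v l 0).
by rewrite ler_norml => *; apply/andP; split; nra.
Qed.

Lemma p_entry1 v k : `|p v k 0| <= Num.sqrt b.
Proof.
by rewrite -(@ler_pXn2r _ 2)// ?nnegrE ?sqrtr_ge0// sqr_sqrtr// real_normK ?num_real// p_entry.
Qed.

Lemma measurable_p k : measurable_fun setT (fun u => p (x u) k 0).
Proof. exact: (measurableT_comp (mp k 0) mx). Qed.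

Lemma L2_p k : L2 F (fun u => p (x u) k 0).
Proof. by apply: L2_bounded => [|u]; [exact: measurable_p|exact: p_entry1]. Qed.

Lemma L2_pM (e : Z -> R) k : L2 F e -> L2 F (fun u => e u * p (x u) k 0).
Proof.
move=> Le; have := L2Mb Le (measurable_p k) (fun u => p_entry1 (x u) k).
by congr L2; apply/funext => u; rewrite mulrC.
Qed.

Lemma gramE i j : gram i j = mean F (fun u => p (x u) i 0 * p (x u) j 0).
Proof. by rewrite mxE. Qed.

Lemma gram_sym : gram^T = gram.
Proof. by apply/matrixP => i j; rewrite mxE !gramE; apply: eq_mean => u; rewrite mulrC. Qed.

Lemma L2_dot (d : 'cV[R]_K) : L2 F (fun u => dot (p (x u)) d).
Proof.
apply: L2_sum => k _; have := L2Z (d k 0) (L2_p k).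
by congr L2; apply/funext => u; rewrite mulrC.
Qed.

Lemma qform_gram d : qform gram d = mean F (fun u => dot (p (x u)) d ^+ 2).
Proof.
rewrite qformE.
rewrite (@eq_mean _ _ _ _ (fun u => dot (p (x u)) d ^+ 2)
  (fun u => \sum_i \sum_j (d i 0 * d j 0) * (p (x u) i 0 * p (x u) j 0))); last first.
  move=> u; rewrite expr2 /dot mulr_suml; apply: eq_bigr => i _.
  by rewrite mulr_sumr; apply: eq_bigr => j _; ring.
have I2 i j : integ F (fun u => d i 0 * d j 0 * (p (x u) i 0 * p (x u) j 0)).
  by apply: integZ; apply: L2M; exact: L2_p.
rewrite mean_sum; last by move=> i _; apply: integ_sum.
apply: eq_bigr => i _; rewrite mean_sum//.
apply: eq_bigr => j _; rewrite meanZ ?gramE 1?mulrC//.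
by apply: L2M; exact: L2_p.
Qed.

Lemma gram_apply d k : (gram *m d) k 0 = mean F (fun u => dot (p (x u)) d * p (x u) k 0).
Proof.
rewrite mxE (@eq_mean _ _ _ _ (fun u => dot (p (x u)) d * p (x u) k 0)
  (fun u => \sum_j d j 0 * (p (x u) k 0 * p (x u) j 0))); last first.
  by move=> u; rewrite /dot mulr_suml; apply: eq_bigr => j _; ring.
rewrite mean_sum; last by move=> j _; apply: integZ; apply: L2M; exact: L2_p.
apply: eq_bigr => j _; rewrite meanZ ?gramE 1?mulrC//.
by apply: L2M; exact: L2_p.
Qed.

Lemma gramhat_apply xi d :
  gramhat xi *m d = N^-1 *: \sum_(i in T) dot (p (xi i)) d *: p (xi i).
Proof.
rewrite /gramhat /sample_gram -scalemxAl mulmx_suml; congr (_ *: _).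
apply: eq_bigr => i _; rewrite -mulmxA; apply/colP => k; rewrite !mxE big_ord1.
by rewrite dotE mulrC.
Qed.

Lemma qform_gramhat xi d : qform (gramhat xi) d = N^-1 * \sum_(i in T) dot (p (xi i)) d ^+ 2.
Proof.
rewrite /qform gramhat_apply dotZr dot_sumr; congr (_ * _).
by apply: eq_bigr => i _; rewrite dotZr dotC expr2.
Qed.

Lemma measurable_gramhat d (S : measurableType d) (xi : S -> 'I_n -> X) :
  (forall i, measurable_fun setT (xi^~ i)) -> mxmeas (fun t => gramhat (xi t)).
Proof.
move=> mxi; apply: mxmeasZ => //; apply: mxmeas_sum => i.
have mpi : mxmeas (fun t => p (xi t i)).
  by move=> k l; rewrite ord1; exact: (measurableT_comp (mp k 0) (mxi i)).
by apply: mxmeasM => //; exact: mxmeasT.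
Qed.

Lemma measurable_dev d (S : measurableType d) (xi : S -> 'I_n -> X) :
  (forall i, measurable_fun setT (xi^~ i)) -> mxmeas (fun t => dev (xi t)).
Proof.
by move=> mxi; apply: mxmeasB; [exact: measurable_gramhat|exact: mxmeas_cst].
Qed.

Lemma measurable_pavg e : measurable_fun setT e -> mxmeas (pavg e).
Proof.
move=> me; apply: mxmeasZ => //; apply: mxmeas_sum => i; apply: mxmeasZ.
  exact: (measurableT_comp me (measurable_tnth i)).
move=> k l; rewrite ord1.
exact: (measurableT_comp (mp k 0) (measurable_xsample i)).
Qed.

Lemma sqn_p_mean (e : Z -> R) : L2 F e ->
  \sum_k mean F (fun u => (e u * p (x u) k 0) ^+ 2) <= b * mean F (fun u => e u ^+ 2).
Proof.
move=> Le; have [me Ie] := Le; rewrite -meanZ// -mean_sum; last first.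
  by move=> k _; exact: (proj2 (L2_pM k Le)).
apply: le_mean; last 2 first.
- exact: integZ.
- move=> u; rewrite (_ : \sum_k _ = sqn (p (x u)) * e u ^+ 2).
    by rewrite ler_wpM2r ?sqr_ge0.
  by rewrite /sqn mulr_suml; apply: eq_bigr => k _; rewrite exprMn mulrC.
- by apply: integ_sum => k _; exact: (proj2 (L2_pM k Le)).
Qed.

(** Each component is an average of [N] independent centred terms. *)
Lemma mean_sqn_avg (h : Z -> 'cV[R]_K) (A : n.-tuple Z -> 'cV[R]_K) (B : R) :
  (forall k, L2 F (fun u => h u k 0)) ->
  (forall o k, A o k 0 = \sum_(i in T) N^-1 * (h (tnth o i) k 0 - mean F (fun u => h u k 0))) ->
  \sum_k mean F (fun u => h u k 0 ^+ 2) <= B ->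
  [/\ forall k, L2 mu (fun o => A o k 0), integ mu (fun o => sqn (A o)) &
    mean mu (fun o => sqn (A o)) <= B / N].
Proof.
move=> Lh AE hB.
have L1 k : L2 F (fun u => h u k 0 - mean F (fun u => h u k 0)).
  by apply: L2B => //; exact: L2_cst.
have m0 k : mean F (fun u => h u k 0 - mean F (fun u => h u k 0)) = 0.
  by rewrite meanB ?mean_cst ?subrr//; [exact: L2_integ|exact: integ_cst].
have W k := mean_sq_wsum muF T (fun=> N^-1) (L1 k) (m0 k).
have AE' k : (fun o => A o k 0) = (fun o => \sum_(i in T) N^-1 *
    (h (tnth o i) k 0 - mean F (fun u => h u k 0))) by apply/funext => o; rewrite AE.
have LA k : L2 mu (fun o => A o k 0) by rewrite AE'; case: (W k).
have IA k : integ mu (fun o => A o k 0 ^+ 2) by case: (LA k).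
split => //; first by apply: integ_sum => k _.
rewrite /sqn mean_sum//; apply: le_trans (ler_wpM2r (ltW (_ : 0 < N^-1)) hB); last first.
  by rewrite invr_gt0.
rewrite mulr_suml; apply: ler_sum => k _.
have -> : mean mu (fun o => A o k 0 ^+ 2) =
    N^-1 * mean F (fun u => (h u k 0 - mean F (fun u => h u k 0)) ^+ 2).
  under eq_mean do rewrite AE.
  rewrite (proj2 (W k)); congr (_ * _).
  rewrite sumr_const -[LHS]mulr_natr expr2 -mulrA mulVf ?mulr1// gt_eqF//.
rewrite mulrC ler_wpM2r ?invr_ge0 ?ler0n//; exact: variance_le.
Qed.

Lemma mean_pavg (e : Z -> R) : L2 F e -> (forall k, mean F (fun u => e u * p (x u) k 0) = 0) ->
  [/\ forall k, L2 mu (fun o => pavg e o k 0), integ mu (fun o => sqn (pavg e o)) &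
    mean mu (fun o => sqn (pavg e o)) <= b * mean F (fun u => e u ^+ 2) / N].
Proof.
move=> Le e0; apply: (@mean_sqn_avg (fun u => e u *: p (x u))).
- by move=> k; have := L2_pM k Le; congr L2; apply/funext => u; rewrite mxE.
- move=> o k; rewrite !mxE summxE mulr_sumr; apply: eq_bigr => i _.
  rewrite !mxE (_ : mean F _ = 0) ?subr0//.
  by rewrite -(e0 k); apply: eq_mean => u; rewrite mxE.
- apply: le_trans (sqn_p_mean Le); apply: ler_sum => k _.
  by apply: le_of_eq; apply: eq_mean => u; rewrite mxE.
Qed.

Lemma mean_dev (d : 'cV[R]_K) :
  integ mu (fun o => sqn (dev (xsample o) *m d)) /\
  mean mu (fun o => sqn (dev (xsample o) *m d)) <=
    b * mean F (fun u => dot (p (x u)) d ^+ 2) / N.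
Proof.
have [|||_ I1 I2] := @mean_sqn_avg (fun u => dot (p (x u)) d *: p (x u))
  (fun o => dev (xsample o) *m d) (b * mean F (fun u => dot (p (x u)) d ^+ 2)); last by [].
- by move=> k; have := L2_pM k (L2_dot d); congr L2; apply/funext => u; rewrite mxE.
- move=> o k; rewrite mulmxBl gramhat_apply mxE [X in _ + X]mxE gram_apply mxE summxE.
  rewrite -mulr_sumr sumrB mulrBr; congr (_ * _ - _).
  rewrite sumr_const -[X in _ * X]mulr_natl mulrA mulVf ?mul1r ?gt_eqF//.
  by apply: eq_mean => u; rewrite mxE.
- apply: le_trans (sqn_p_mean (L2_dot d)); apply: ler_sum => k _.
  by apply: le_of_eq; apply: eq_mean => u; rewrite mxE.
Qed.

Variable t : R.
(** Entrywise closeness can be had from scalar exponential inequalities and a union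
    bound. *)
Definition good xi := entries_le (dev xi) t.

Lemma measurable_good d (S : measurableType d) (xi : S -> 'I_n -> X) :
  (forall i, measurable_fun setT (xi^~ i)) ->
  measurable_fun setT (fun s => (good (xi s))%:R : R).
Proof. by move=> mxi; apply: measurable_entries_le; exact: measurable_dev. Qed.

Lemma good_prob (l vv : R) : 0 < l -> l * (2 * b) <= 2^-1 ->
  (forall k m, mean F (fun u => (p (x u) k 0 * p (x u) m 0) ^+ 2) <= vv) ->
  (mu [set o | ~~ good (xsample o)] <=
    ((K * K)%:R * (2 * expR (N * (2 * l ^+ 2 * vv - l * t))))%:E)%E.
Proof.
move=> l0 lb hv; set E := 2 * expR _.
have mD := measurable_dev (xi := xsample) measurable_xsample.
have devE o k m : dev (xsample o) k m = N^-1 * \sum_(i in T)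
    (p (x (tnth o i)) k 0 * p (x (tnth o i)) m 0 -
      mean F (fun u => p (x u) k 0 * p (x u) m 0)).
  rewrite !mxE summxE sumrB mulrBr; congr (_ - _).
    by congr (_ * _); apply: eq_bigr => i _; rewrite mxE big_ord1 mxE.
  by rewrite sumr_const -[X in _ * X]mulr_natl mulrA mulVf ?mul1r ?gt_eqF.
pose bad (km : 'I_K * 'I_K) := [set o | t < `|dev (xsample o) km.1 km.2|].
have mbad km : measurable (bad km).
  rewrite -[X in measurable X]setTI.
  rewrite (_ : bad km = (fun o => `|dev (xsample o) km.1 km.2|) @^-1` `]t, +oo[%classic).
    by apply: measurableT_comp; rewrite //.
  by apply/seteqP; split => o /=; rewrite in_itv /= andbT.
have Pbad km : (mu (bad km) <= E%:E)%E.
  have := chernoff_abs muF T t (measurable_funM (measurable_p km.1) (measurable_p km.2))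
    (fun u => p_entry2 (x u) km.1 km.2) (hv km.1 km.2) l0 lb.
  rewrite (_ : [set o | _] = bad km)//; apply/seteqP; split => o /=; rewrite /bad /= devE;
    by rewrite normrM gtr0_norm ?invr_gt0// (mulrC N^-1) ltr_pdivlMr.
have -> : [set o | ~~ good (xsample o)] = [set o | exists km, bad km o].
  apply/seteqP; split => o /=.
    rewrite /good /entries_le negb_forall => /existsP[k]; rewrite negb_forall => /existsP[m].
    by rewrite -ltNge => h; exists (k, m).
  move=> [[k m] h]; apply/negP => /forallP /(_ k) /forallP /(_ m).
  by rewrite leNgt => /negP; apply.
by have [_] := prob_exists_le mbad Pbad; rewrite card_prod !card_ord.
Qed.

Variable c : R.
Hypothesis c0 : 0 < c.
Hypothesis good_pd : forall xi, good xi -> forall u, c * sqn u <= qform (gramhat xi) u.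

Lemma good_unit xi : good xi -> gramhat xi \in unitmx.
Proof. by move=> /good_pd /(posdef_unitmx c0). Qed.

Lemma good_inv xi u : good xi ->
  sqn (adjinv (gramhat xi) *m u) <= sqn u / c ^+ 2 /\
  qform (gramhat xi) (adjinv (gramhat xi) *m u) <= sqn u / c.
Proof.
by move=> g; rewrite adjinvE ?good_unit//; apply: (posdef_inv _ c0 (good_pd g)).
Qed.

Variable da : 'cV[R]_K.
Local Notation A2 := (mean F (fun u => dot (p (x u)) da ^+ 2)).

(** The error of the sample second moments transported to the coefficients: its inner
    product with a training average is the error made in [population_functional]
    by replacing the second moments with their sample analogue. *)
Definition dirw xi : 'cV[R]_K := adjinv (gramhat xi) *m (dev xi *m da).

Lemma measurable_dirw d (S : measurableType d) (xi : S -> 'I_n -> X) :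
  (forall i, measurable_fun setT (xi^~ i)) -> mxmeas (fun s => dirw (xi s)).
Proof.
move=> mxi; apply: mxmeasM; first exact/mxmeas_adjinv/measurable_gramhat.
by apply: mxmeasM; [exact: measurable_dev|exact: mxmeas_cst].
Qed.

(** The coefficient of the noise of observation [i] in the inner product of
    [noise_term]; it depends on the regressors only. *)
Definition noise_coef (i : 'I_n) xi : R := (good xi)%:R * (N^-1 * dot (dirw xi) (p (xi i))).

Lemma measurable_noise_coef i d (S : measurableType d) (xi : S -> 'I_n -> X) :
  (forall i, measurable_fun setT (xi^~ i)) -> measurable_fun setT (fun s => noise_coef i (xi s)).
Proof.
move=> mxi; apply: measurable_funM; first exact: measurable_good.
apply: measurable_funM => //; apply: measurable_dot; first exact: measurable_dirw.
by move=> k l; rewrite ord1; exact: (measurableT_comp (mp k 0) (mxi i)).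
Qed.

(** The bound depends on the sample size and serves for integrability only. *)
Lemma noise_coef_bounded : exists M, forall i xi, `|noise_coef i xi| <= M.
Proof.
pose B := \sum_(k < K) (\sum_(l < K) t * `|da l 0|) ^+ 2.
exists (N^-1 * ((B / c ^+ 2 + b) / 2)) => i xi; rewrite /noise_coef.
have B0 : 0 <= B by apply: sumr_ge0 => k _; exact: sqr_ge0.
case: (boolP (good xi)) => [g|_]; last first.
  rewrite mul0r normr0 mulr_ge0 ?invr_ge0// divr_ge0// addr_ge0// divr_ge0//.
  by rewrite sqr_ge0.
rewrite mul1r normrM gtr0_norm ?invr_gt0// ler_wpM2l ?invr_ge0//.
apply: (le_trans (norm_dot_le _ _ ltr01)); rewrite invr1 !mul1r ler_wpM2r ?invr_ge0//.
apply: lerD => //; apply: le_trans (proj1 (good_inv _ g)) _.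
rewrite ler_wpM2r ?invr_ge0 ?sqr_ge0//; apply: ler_sum => k _.
rewrite -[leLHS]real_normK ?num_real// ler_pXn2r ?nnegrE//; last first.
  by apply: sumr_ge0 => l _; rewrite mulr_ge0// (le_trans (normr_ge0 _) (forallP (forallP g k) l)).
rewrite mxE; apply: (le_trans (ler_norm_sum _ _ _)); apply: ler_sum => l _.
by rewrite normrM ler_wpM2r// (forallP (forallP g k) l).
Qed.

Variables (eps : Z -> R) (s2 : R).
Hypothesis Leps : L2 F eps.
Hypothesis eps0 : forall (H : X -> R) M, measurable_fun setT H -> (forall v, `|H v| <= M) ->
  mean F (fun u => H (x u) * eps u) = 0.
Hypothesis eps2 : forall (H : X -> R) M, measurable_fun setT H -> (forall v, 0 <= H v <= M) ->
  mean F (fun u => H (x u) * eps u ^+ 2) <= s2 * mean F (fun u => H (x u)).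
Hypothesis s2_ge0 : 0 <= s2.

(** The design enters only through bounded coefficients [cf], so the noise terms
    are uncorrelated and their variances are bounded conditionally. *)
Lemma mean_sq_noise (cf : 'I_n -> ('I_n -> X) -> R) (M : R) :
  (forall i d (S : measurableType d) (xi : S -> 'I_n -> X),
    (forall j, measurable_fun setT (xi^~ j)) -> measurable_fun setT (fun s => cf i (xi s))) ->
  (forall i xi, `|cf i xi| <= M) ->
  L2 mu (fun o => \sum_(i in T) cf i (xsample o) * eps (tnth o i)) /\
  mean mu (fun o => (\sum_(i in T) cf i (xsample o) * eps (tnth o i)) ^+ 2) <=
    s2 * mean mu (fun o => \sum_(i in T) cf i (xsample o) ^+ 2).
Proof.
move=> mcf cfM.
have mc i : measurable_fun setT (fun o => cf i (xsample o)).
  by apply: mcf; exact: measurable_xsample.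
have Le i : L2 mu (fun o => eps (tnth o i)) by exact: (L2_tnth muF i Leps).
have LW i : L2 mu (fun o => cf i (xsample o) * eps (tnth o i)).
  by apply: (L2Mb (Le i) (mc i)) => o; exact: cfM.
split; first by apply: L2_sum => i _.
have Lc i : L2 mu (fun o => cf i (xsample o)) by apply: L2_bounded.
rewrite mean_sq_sum//; last first.
  move=> i j _ _ ij; apply: (@resample_mean0 _ _ _ _ _ _ muF i); first exact: L2M.
  move=> o.
  rewrite (@eq_mean _ _ _ _ _ (fun u => (cf i (updX (xsample o) i (x u)) *
     cf j (updX (xsample o) i (x u)) * eps (tnth o j)) * eps u)); last first.
    by move=> u; rewrite xsample_tset !tnth_tset eqxx eq_sym (negbTE ij); ring.
  apply: (@eps0 (fun v => cf i (updX (xsample o) i v) * cf j (updX (xsample o) i v) *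
     eps (tnth o j)) (M * M * `|eps (tnth o j)|)).
    have mu' k : measurable_fun setT (fun v => cf k (updX (xsample o) i v)).
      by apply: mcf => l; exact: measurable_updX.
    by apply: measurable_funM => //; exact: measurable_funM.
  by move=> v; rewrite !normrM ler_wpM2r// ler_pM.
rewrite mean_sum; last by move=> i _; case: (Lc i).
rewrite mulr_sumr; apply: ler_sum => i _; rewrite -meanZ; last by case: (Lc i).
have [|||||_ //] := @resample_mean_le _ _ _ _ _ _ muF i
  (fun o => (cf i (xsample o) * eps (tnth o i)) ^+ 2)
  (fun o => s2 * cf i (xsample o) ^+ 2).
- by apply: measurable_funX; case: (LW i).
- by move=> o; exact: sqr_ge0.
- by apply: integZ; case: (Lc i).
- by move=> o; rewrite mulr_ge0 ?sqr_ge0.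
- move=> o.
  have mu' : measurable_fun setT (fun v => cf i (updX (xsample o) i v) ^+ 2).
    by apply: measurable_funX; apply: mcf => l; exact: measurable_updX.
  have bd v : 0 <= cf i (updX (xsample o) i v) ^+ 2 <= M ^+ 2.
    rewrite sqr_ge0 /= -[leLHS]real_normK ?num_real// ler_pXn2r ?nnegrE//.
    exact: le_trans (cfM i (updX (xsample o) i v)).
  have H := eps2 mu' bd.
  have I1 : integ F (fun u => cf i (updX (xsample o) i (x u)) ^+ 2).
    apply: (@integ_bounded _ _ _ _ (M ^+ 2)); first exact: (measurableT_comp mu' mx).
    by move=> u; have /andP[h1 h2] := bd (x u); rewrite ger0_norm.
  have I2 : integ F (fun u => cf i (updX (xsample o) i (x u)) ^+ 2 * eps u ^+ 2).
    apply: (@integMb _ _ _ _ (M ^+ 2)); [by case: Leps|exact: (measurableT_comp mu' mx)|].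
    by move=> u; have /andP[h1 h2] := bd (x u); rewrite ger0_norm.
  under eq_integral do rewrite xsample_tset tnth_tset eqxx exprMn.
  under [leRHS]eq_integral do rewrite xsample_tset.
  by rewrite meanE// meanE ?meanZ ?lee_fin//; exact: integZ.
Qed.

Lemma good_if xi (y : R) : ((good xi)%:R * y) ^+ 2 = (good xi)%:R * y ^+ 2.
Proof. by case: (good xi); rewrite ?mul1r// !mul0r expr0n. Qed.

(** Given the regressors, the second moment is at most
    [s2 / N * qform (gramhat xi) (dirw xi)], hence at most [s2 / (N * c)] times the
    squared norm of [dev xi *m da]. *)
Lemma noise_term :
  L2 mu (fun o => (good (xsample o))%:R * dot (dirw (xsample o)) (pavg eps o)) /\
  mean mu (fun o => ((good (xsample o))%:R * dot (dirw (xsample o)) (pavg eps o)) ^+ 2) <=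
    s2 * (b * A2 / N / c / N).
Proof.
have [M hM] := noise_coef_bounded.
have [L H] := mean_sq_noise measurable_noise_coef hM.
have E o : (good (xsample o))%:R * dot (dirw (xsample o)) (pavg eps o) =
    \sum_(i in T) noise_coef i (xsample o) * eps (tnth o i).
  rewrite /pavg /sample_cross dotZr dot_sumr !mulr_sumr; apply: eq_bigr => i _.
  by rewrite dotZr /noise_coef /xsample; ring.
split; first by move: L; congr L2; apply/funext => o; rewrite E.
under eq_mean do rewrite E.
apply: (le_trans H); apply: ler_wpM2l => //.
have [I1 B1] := mean_dev da.
have mt i : measurable_fun setT (fun o => noise_coef i (xsample o)).
  by apply: measurable_noise_coef; exact: measurable_xsample.
have Lt i : L2 mu (fun o => noise_coef i (xsample o)) by apply: L2_bounded.
apply: (@le_trans _ _ (mean mu (fun o => (N^-1 / c) * sqn (dev (xsample o) *m da)))).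
  apply: le_mean.
  - by apply: integ_sum => i _; case: (Lt i).
  - exact: integZ.
  move=> o; rewrite /noise_coef.
  under eq_bigr do rewrite good_if.
  case: (boolP (good (xsample o))) => [g|_]; last first.
    rewrite big1 => [|i _]; last by rewrite mul0r.
    by rewrite mulr_ge0 ?sqn_ge0// divr_ge0 ?invr_ge0// ltW.
  under eq_bigr do rewrite mul1r exprMn.
  rewrite -mulr_sumr expr2 -!mulrA ler_wpM2l ?invr_ge0//.
  under eq_bigr do rewrite dotC.
  rewrite -qform_gramhat [leRHS]mulrC.
  exact: (proj2 (good_inv _ g)).
rewrite meanZ// [leRHS](_ : _ = N^-1 / c * (b * A2 / N)); last by ring.
by rewrite ler_wpM2l// divr_ge0 ?invr_ge0// ltW.
Qed.

(** Both factors depend on the regressors, so they are separated by Cauchy-Schwarz;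
    each has second moment of order [b / N]. *)
Lemma bias_term (rho : Z -> R) (al be : R) : L2 F rho ->
  (forall k, mean F (fun u => rho u * p (x u) k 0) = 0) -> 0 < al -> 0 < be ->
  b * A2 / N <= al ^+ 2 -> b * mean F (fun u => rho u ^+ 2) / N <= be ^+ 2 ->
  integ mu (fun o => `|(good (xsample o))%:R * dot (dirw (xsample o)) (pavg rho o)|) /\
  mean mu (fun o => `|(good (xsample o))%:R * dot (dirw (xsample o)) (pavg rho o)|) <=
    al * be / c.
Proof.
move=> Lr r0 al0 be0 hal hbe.
have [_ I1 B1] := mean_pavg Lr r0.
have [I2 B2] := mean_dev da.
have k1 : 0 <= be / al / c / 2 by rewrite !divr_ge0// ltW.
have k2 : 0 <= al / be / c / 2 by rewrite !divr_ge0// ltW.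
pose G o := (be / al / c) / 2 * sqn (dev (xsample o) *m da) + (al / be / c) / 2 * sqn (pavg rho o).
have IG : integ mu G by apply: integD; exact: integZ.
have le1 o : `|(good (xsample o))%:R * dot (dirw (xsample o)) (pavg rho o)| <= G o.
  case: (boolP (good (xsample o))) => [g|_]; last first.
    rewrite mul0r normr0; apply: addr_ge0; apply: mulr_ge0; rewrite ?sqn_ge0//.
  rewrite mul1r; have t0 : 0 < c * be / al by rewrite divr_gt0// mulr_gt0.
  apply: (le_trans (norm_dot_le _ _ t0)).
  have h := proj1 (good_inv (dev (xsample o) *m da) g).
  rewrite mulrDl /G; apply: lerD; last first.
    by rewrite !invfM invrK [leLHS](_ : _ = al / be / c / 2 * sqn (pavg rho o))//; ring.
  have h' := ler_wpM2l (ltW t0) h.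
  rewrite [leRHS](_ : _ = c * be / al * (sqn (dev (xsample o) *m da) / c ^+ 2) / 2).
    by rewrite ler_wpM2r ?invr_ge0.
  by field; rewrite !gt_eqF.
have mT : measurable_fun setT (fun o => (good (xsample o))%:R * dot (dirw (xsample o)) (pavg rho o)).
  apply: measurable_funM; first by apply: measurable_good; exact: measurable_xsample.
  apply: measurable_dot; first by apply: measurable_dirw; exact: measurable_xsample.
  by apply: measurable_pavg; case: Lr.
have IT : integ mu (fun o => `|(good (xsample o))%:R * dot (dirw (xsample o)) (pavg rho o)|).
  apply: (le_integ _ _ IG); first exact: measurableT_comp.
  by move=> o; rewrite normr_id.
split=> //; apply: (le_trans (le_mean IT IG le1)).
rewrite meanD; [|exact: integZ|exact: integZ]; rewrite !meanZ//.
have h1 := le_trans B2 hal; have h2 := le_trans B1 hbe.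
have := lerD (ler_wpM2l k1 h1) (ler_wpM2l k2 h2) => /le_trans; apply.
by apply: le_of_eq; field; rewrite !gt_eqF.
Qed.

Variable I : {set 'I_n}.
Hypothesis IT : forall i, i \in I -> i \notin T.

Definition coefdev e o : 'cV[R]_K := adjinv (gramhat (xsample o)) *m pavg e o.

Lemma eq_train o o' e : (forall i, i \in T -> tnth o i = tnth o' i) ->
  gramhat (xsample o) = gramhat (xsample o') /\ pavg e o = pavg e o'.
Proof.
move=> oo; split; rewrite /gramhat /sample_gram /pavg /sample_cross /xsample;
  congr (_ *: _); apply: eq_bigr => i iT; by rewrite oo.
Qed.

(** The held-out observations are independent of the estimated coefficients, so
    conditionally on the latter the average of the centred vectors [V] has
    variance of order [Dv] times the squared estimation error. *)
Lemma heldout_term (V : Z -> 'cV[R]_K) (Dv B : R) (e : Z -> R) : 0 <= Dv ->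
  L2 F e -> integ mu (fun o => sqn (pavg e o)) -> mean mu (fun o => sqn (pavg e o)) <= B ->
  (forall k, L2 F (fun u => V u k 0)) -> (forall k, mean F (fun u => V u k 0) = 0) ->
  (forall d, mean F (fun u => dot (V u) d ^+ 2) <= Dv * sqn d) ->
  L2 mu (fun o => \sum_(i in I) (good (xsample o))%:R * dot (V (tnth o i)) (coefdev e o)) /\
  mean mu (fun o => (\sum_(i in I) (good (xsample o))%:R *
     dot (V (tnth o i)) (coefdev e o)) ^+ 2) <= #|I|%:R * (Dv * (B / c ^+ 2)).
Proof.
move=> Dv0 Le Ie Be LV V0 Vd.
pose G o := Dv * ((good (xsample o))%:R * sqn (coefdev e o)).
have mg : measurable_fun setT (fun o => (good (xsample o))%:R : R).
  by apply: measurable_good; exact: measurable_xsample.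
have mcd : mxmeas (coefdev e).
  apply: mxmeasM; last by apply: measurable_pavg; case: Le.
  by apply/mxmeas_adjinv/measurable_gramhat; exact: measurable_xsample.
have Gle o : (good (xsample o))%:R * sqn (coefdev e o) <= sqn (pavg e o) / c ^+ 2.
  case: (boolP (good _)) => [g|_]; first by rewrite mul1r; exact: (proj1 (good_inv _ g)).
  by rewrite mul0r divr_ge0 ?sqn_ge0 ?sqr_ge0.
have Ie' : integ mu (fun o => sqn (pavg e o) / c ^+ 2).
  by have := integZ (c ^+ 2)^-1 Ie; apply: eq_integ => o; rewrite mulrC.
have Ig : integ mu (fun o => (good (xsample o))%:R * sqn (coefdev e o)).
  apply: (le_integ _ _ Ie').
    by apply: measurable_funM => //; exact: measurable_sqn.
  by move=> o; rewrite ger0_norm// mulr_ge0 ?sqn_ge0.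
have IG : integ mu G by exact: integZ.
have mG : mean mu G <= Dv * (B / c ^+ 2).
  rewrite meanZ// ler_wpM2l//; apply: (le_trans (le_mean Ig Ie' Gle)).
  rewrite (@eq_mean _ _ _ _ _ (fun o => (c ^+ 2)^-1 * sqn (pavg e o))); last first.
    by move=> o; rewrite mulrC.
  by rewrite meanZ// mulrC ler_wpM2r// invr_ge0 sqr_ge0.
have inv i o u : i \in I -> gramhat (xsample (tset i u o)) = gramhat (xsample o) /\
    coefdev e (tset i u o) = coefdev e o.
  move=> iI; have [j jT|h1 h2] := @eq_train (tset i u o) o e.
    rewrite tnth_tset; case: eqP => // ji.
    by have := IT iI; rewrite -ji jT.
  by rewrite /coefdev h1 h2.
have invg i o u : i \in I -> good (xsample (tset i u o)) = good (xsample o).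
  by move=> iI; rewrite /good /dev (proj1 (inv i o u iI)).
pose W i o := (good (xsample o))%:R * dot (V (tnth o i)) (coefdev e o).
have mV : mxmeas V by move=> k l; rewrite ord1; case: (LV k).
have mW i : measurable_fun setT (W i).
  apply: measurable_funM => //; apply: measurable_dot => //.
  by move=> k l; exact: (measurableT_comp (mV k l) (measurable_tnth i)).
have LVd d : L2 F (fun u => dot (V u) d).
  apply: L2_sum => k _; have := L2Z (d k 0) (LV k).
  by congr L2; apply/funext => u; rewrite mulrC.
have W2 i : i \in I -> integ mu (fun o => W i o ^+ 2) /\
    mean mu (fun o => W i o ^+ 2) <= mean mu G.
  move=> iI; apply: (@resample_le _ _ _ _ _ _ muF i).
  - exact: measurable_funX.
  - by move=> o; exact: sqr_ge0.
  - exact: IG.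
  - move=> o; rewrite /W.
    under eq_integral do rewrite good_if (invg i) // (proj2 (inv i _ _ iI)) tnth_tset eqxx.
    rewrite meanE; last by apply: integZ; case: (LVd (coefdev e o)).
    rewrite lee_fin meanZ; last by case: (LVd (coefdev e o)).
    rewrite /G mulrCA; case: (good _); rewrite ?mul1r ?mul0r//; exact: Vd.
have LW i : i \in I -> L2 mu (W i) by move=> iI; split => //; exact: (proj1 (W2 i iI)).
split; first by apply: L2_sum => i iI; exact: LW.
rewrite mean_sq_sum//; last first.
  move=> i j iI jI ij; apply: (@resample_mean0 _ _ _ _ _ _ muF i).
    by apply: L2M; exact: LW.
  move=> o; rewrite /W.
  rewrite (@eq_mean _ _ _ _ _ (fun u => ((good (xsample o))%:R *
    ((good (xsample o))%:R * dot (V (tnth o j)) (coefdev e o))) * dot (V u) (coefdev e o))); last first.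
    move=> u; rewrite (invg i)// (proj2 (inv i _ _ iI)) !tnth_tset eqxx eq_sym (negbTE ij).
    by ring.
  rewrite meanZ; last exact: L2_integ (LVd _).
  rewrite (_ : mean F _ = 0) ?mulr0//.
  rewrite mean_sum; last first.
    move=> k _; have := integZ (coefdev e o k 0) (L2_integ (LV k)).
    by apply: eq_integ => u; rewrite mulrC.
  rewrite big1// => k _.
  rewrite (@eq_mean _ _ _ _ _ (fun u => coefdev e o k 0 * V u k 0)); last first.
    by move=> u; rewrite mulrC.
  by rewrite meanZ ?V0 ?mulr0//; exact: L2_integ.
apply: (@le_trans _ _ (\sum_(i in I) mean mu G)).
  by apply: ler_sum => i iI; exact: (proj2 (W2 i iI)).
by rewrite sumr_const -[leLHS]mulr_natl ler_wpM2l.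
Qed.

End sample.

(** * The remainder of the expansion *)

(** Jensen's inequality, from the nonnegativity of the variance of [|f|]. *)
Lemma mean_abs_le {R : realType} d (T : measurableType d) (mu : probability T R)
    (f : T -> R) (A : R) : 0 <= A -> L2 mu f -> mean mu (fun x => f x ^+ 2) <= A ->
  integ mu (fun x => `|f x|) /\ mean mu (fun x => `|f x|) <= Num.sqrt A.
Proof.
move=> A0 Lf fA; have Ia : integ mu (fun x => `|f x|).
  exact: (integrable_norm (D := setT) (L2_integ Lf)).
split=> //; set m := mean mu _.
have m0 : 0 <= m by apply: mean_ge0.
rewrite -(ger0_norm m0) -sqrtr_sqr ler_wsqrtr//; apply: le_trans fA.
have h : 0 <= mean mu (fun x => (`|f x| - m) ^+ 2) by apply: mean_ge0 => x; exact: sqr_ge0.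
have If2 : integ mu (fun x => f x ^+ 2) by case: Lf.
move: h; rewrite (@eq_mean _ _ _ _ _ (fun x => f x ^+ 2 + ((- 2 * m) * `|f x| + m ^+ 2))); last first.
  by move=> x; rewrite -[f x ^+ 2]real_normK ?num_real//; ring.
rewrite meanD//; last by apply: integD; [exact: integZ|exact: integ_cst].
rewrite meanD ?mean_cst; [|exact: integZ|exact: integ_cst].
rewrite meanZ// -/m; lra.
Qed.

Section fold_weights.
Context {R : realType} (n L : nat) (grp : 'I_n -> 'I_L).

(** The training average for fold [l] is used once for each observation in that
    fold, hence the numerators. *)
Definition fold_weight (j : 'I_n) : R :=
  \sum_(l | l != grp j) #|fold grp l|%:R / #|~: fold grp l|%:R.

Lemma fold_card_sum : (\sum_l #|fold grp l| = n)%N.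
Proof.
rewrite -[RHS]card_ord -sum1_card (partition_big grp xpredT)//=.
by apply: eq_bigr => l _; rewrite -sum1_card; apply: eq_bigl => i; rewrite inE.
Qed.

Lemma fold_cardC l : (#|fold grp l| + #|~: fold grp l| = n)%N.
Proof. by rewrite cardsC card_ord. Qed.

Lemma fold_average (f : 'I_n -> R) :
  \sum_l #|fold grp l|%:R * (#|~: fold grp l|%:R^-1 * \sum_(j in ~: fold grp l) f j) =
  \sum_j fold_weight j * f j.
Proof.
rewrite /fold_weight; under [RHS]eq_bigr do rewrite mulr_suml.
rewrite (exchange_big_dep xpredT)//=; apply: eq_bigr => l _.
rewrite mulrA mulr_sumr; apply: eq_bigl => j.
by rewrite !inE eq_sym.
Qed.

Variable c : R.
Hypothesis c0 : 0 < c.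
Hypothesis n0 : (0 < n)%N.
Hypothesis large : forall l, c * n%:R <= #|~: fold grp l|%:R.

Let n0' : 0 < n%:R :> R. Proof. by rewrite ltr0n. Qed.

Lemma trainset_gt0 l : (0 < #|~: fold grp l|)%N.
Proof.
by rewrite -(ltr0n R); apply: lt_le_trans (large l); rewrite mulr_gt0.
Qed.

Lemma fold_ratio_le l : #|fold grp l|%:R / #|~: fold grp l|%:R <= c^-1 * (#|fold grp l|%:R / n%:R) :> R.
Proof.
rewrite mulrCA ler_wpM2l// -invfM lef_pV2 ?posrE ?mulr_gt0//.
by rewrite ltr0n trainset_gt0.
Qed.

Lemma fold_weight_le j : 0 <= fold_weight j <= c^-1.
Proof.
apply/andP; split; first by apply: sumr_ge0 => l _; rewrite divr_ge0.
apply: (@le_trans _ _ (\sum_l c^-1 * (#|fold grp l|%:R / n%:R))).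
  rewrite /fold_weight big_mkcond; apply: ler_sum => l _; case: ifP => _.
    exact: fold_ratio_le.
  by rewrite mulr_ge0 ?divr_ge0// invr_ge0 ltW.
rewrite -mulr_sumr -mulr_suml -natr_sum fold_card_sum divff ?mulr1//.
by rewrite pnatr_eq0 -lt0n.
Qed.

Hypothesis balanced : forall l l', (#|fold grp l| <= #|fold grp l'| + 1)%N.

(** With folds of equal sizes every observation would be used with total weight
    one; sizes differing by at most one perturb this by [O(1 / n)]. *)
Lemma fold_weight_near1 j : `|fold_weight j - 1| <= L%:R / c / n%:R.
Proof.
have L1 : (1 < L)%N.
  have := trainset_gt0 (grp j); rewrite card_gt0 => /set0Pn[i]; rewrite !inE => ij.
  have := ltn_ord (grp i); have := ltn_ord (grp j).
  move: ij; rewrite -(inj_eq val_inj) /=; lia.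
have L10 : 0 < L%:R - 1 :> R by rewrite subr_gt0 ltr1n.
have cardl : \sum_(l | l != grp j) (1 : R) = L%:R - 1.
  have : \sum_(l < L) (1 : R) = L%:R by rewrite sumr_const card_ord.
  by rewrite (bigD1 (grp j))//= => <-; rewrite addrAC subrr add0r.
have -> : fold_weight j - 1 = \sum_(l | l != grp j)
    (#|fold grp l|%:R / #|~: fold grp l|%:R - (L%:R - 1)^-1).
  rewrite sumrB; congr (_ - _).
  rewrite [RHS](eq_bigr (fun l => (L%:R - 1)^-1 * 1)); last by move=> l _; rewrite mulr1.
  by rewrite -mulr_sumr cardl mulVf// gt_eqF.
apply: (le_trans (ler_norm_sum _ _ _)).
apply: (@le_trans _ _ (\sum_(l | l != grp j) (L%:R / c / n%:R / (L%:R - 1)) * 1)); last first.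
  by rewrite -mulr_sumr cardl divfK// gt_eqF.
apply: ler_sum => l _; rewrite mulr1.
have N0 : 0 < #|~: fold grp l|%:R :> R by rewrite ltr0n trainset_gt0.
have nE : n%:R = #|fold grp l|%:R + #|~: fold grp l|%:R :> R.
  by rewrite -natrD fold_cardC.
have -> : #|fold grp l|%:R / #|~: fold grp l|%:R - (L%:R - 1)^-1 =
    (L%:R * #|fold grp l|%:R - n%:R) / (#|~: fold grp l|%:R * (L%:R - 1)) :> R.
  by rewrite nE; field; rewrite !gt_eqF.
have h : `|L%:R * #|fold grp l|%:R - n%:R| <= L%:R :> R.
  have -> : L%:R * #|fold grp l|%:R - n%:R =
      \sum_l' (#|fold grp l|%:R - #|fold grp l'|%:R) :> R.
    by rewrite sumrB sumr_const card_ord -natr_sum fold_card_sum mulr_natl.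
  apply: (le_trans (ler_norm_sum _ _ _)).
  apply: (@le_trans _ _ (\sum_(l' < L) (1 : R))); last by rewrite sumr_const card_ord.
  apply: ler_sum => l' _; rewrite ler_distl; apply/andP; split.
    by rewrite lerBlDr -[X in _ + X]/(1%:R) -natrD ler_nat.
  by rewrite -[X in _ + X]/(1%:R) -natrD ler_nat.
rewrite normrM normfV (gtr0_norm (x := #|~: fold grp l|%:R * (L%:R - 1))) ?mulr_gt0//.
rewrite invfM mulrA ler_wpM2r ?invr_ge0 ?(ltW L10)//.
rewrite -[leRHS]mulrA -invfM; apply: ler_pM => //.
by rewrite lef_pV2 ?posrE ?mulr_gt0.
Qed.

End fold_weights.

Section remainder_terms.
Context {R : realType} dZ dX (Z : measurableType dZ) (X : measurableType dX).
Variables (F : probability Z R) (x : Z -> X).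
Hypothesis mx : measurable_fun setT x.
Variables (n : nat) (mu : probability (n.-tuple Z) R).
Hypothesis muF : iid_law F mu.
Hypothesis n0 : (0 < n)%N.
Variables (K : nat) (p : X -> 'cV[R]_K) (b : R).
Hypothesis mp : mxmeas p.
Hypothesis b0 : 0 < b.
Hypothesis pb : forall v, sqn (p v) <= b.
Variables (L : nat) (grp : 'I_n -> 'I_L) (cf : R).
Hypothesis cf0 : 0 < cf.
Hypothesis large : forall l, cf * n%:R <= #|~: fold grp l|%:R.
Hypothesis balanced : forall l l', (#|fold grp l| <= #|fold grp l'| + 1)%N.
Variables (t c : R).
Hypothesis c0 : 0 < c.
Local Notation train l := (~: fold grp l).
Local Notation xs := (xsample x).
Local Notation goodl l := (good F x p (train l) t).
Hypothesis good_pd : forall l xi, goodl l xi ->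
  forall u, c * sqn u <= qform (gramhat p (train l) xi) u.

Variables (eps rho al d : Z -> R) (v : Z -> 'cV[R]_K) (da : 'cV[R]_K) (s2 : R).
Hypothesis Leps : L2 F eps.
Hypothesis eps0 : forall (H : X -> R) M, measurable_fun setT H -> (forall w, `|H w| <= M) ->
  mean F (fun u => H (x u) * eps u) = 0.
Hypothesis eps2 : forall (H : X -> R) M, measurable_fun setT H -> (forall w, 0 <= H w <= M) ->
  mean F (fun u => H (x u) * eps u ^+ 2) <= s2 * mean F (fun u => H (x u)).
Hypothesis s2_ge0 : 0 <= s2.
Variables (alf rhof : X -> R).
Hypothesis malf : measurable_fun setT alf.
Hypothesis alE : forall u, al u = alf (x u).
Hypothesis mrhof : measurable_fun setT rhof.
Hypothesis rhoE : forall u, rho u = rhof (x u).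
Variables (A Ma U Mr rg ra rm md Dv : R).
Hypothesis al_le : forall w, `|alf w| <= Ma.
Hypothesis aK_le : forall w, `|dot (p w) da - alf w| <= U.
Hypothesis rho_le : forall w, `|rhof w| <= Mr.
Hypothesis rho_p : forall k, mean F (fun u => rho u * p (x u) k 0) = 0.
Hypothesis rg0 : 0 < rg.
Hypothesis rho2 : mean F (fun u => rho u ^+ 2) <= rg ^+ 2.
Hypothesis A0 : 0 < A.
Hypothesis aK2 : mean F (fun u => dot (p (x u)) da ^+ 2) <= A ^+ 2.
Hypothesis ra0 : 0 <= ra.
Hypothesis aKal2 : mean F (fun u => (dot (p (x u)) da - al u) ^+ 2) <= ra ^+ 2.
Hypothesis Ld : L2 F d.
Hypothesis rm0 : 0 <= rm.
Hypothesis d2 : mean F (fun u => d u ^+ 2) <= rm ^+ 2.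
Hypothesis d1 : `|mean F d| <= md.
Hypothesis Lv : forall k, L2 F (fun u => v u k 0).
Hypothesis v1 : forall k, mean F (fun u => v u k 0) = (gram F x p *m da) k 0.
Hypothesis Dv0 : 0 <= Dv.
Hypothesis v2 : forall e, mean F (fun u => dot (v u) e ^+ 2) <= Dv * sqn e.

(** What [plug_in_remainder] leaves of the estimation error: [v] is the functional at
    the basis functions, [d] its value at the approximation error, [al] is
    [alpha_0], and the coefficients have been estimated from noise [eps] plus
    approximation error [rho]. *)
Definition remainder (o : n.-tuple Z) : R := (Num.sqrt n%:R)^-1 *
  (\sum_l \sum_(i in fold grp l)
     (dot (v (tnth o i)) (coefdev x p (train l) (fun u => eps u + rho u) o) + d (tnth o i))
   - \sum_i al (tnth o i) * eps (tnth o i)).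

Let n0' : 0 < n%:R :> R. Proof. by rewrite ltr0n. Qed.
Let sn0 : 0 < Num.sqrt n%:R :> R. Proof. by rewrite sqrtr_gt0. Qed.
Let tr0 l : (0 < #|train l|)%N. Proof. exact: trainset_gt0 cf0 n0 large l. Qed.

Definition centred_v (u : Z) : 'cV[R]_K := v u - gram F x p *m da.
(** The terms of the remainder: the sampling error of the functional of the
    approximation error; that of the functional of the estimation error, over the
    held-out observations; the error of the sample second moments, acting on the
    noise and on the approximation error; the approximation error of [alpha_0]
    times the noise; the projection of [alpha_0] times the approximation error; and
    the deviation of the weights from one. *)
Definition rem_functional (o : n.-tuple Z) := (Num.sqrt n%:R)^-1 * \sum_i (d (tnth o i) - mean F d).
Definition rem_heldout l (o : n.-tuple Z) := (Num.sqrt n%:R)^-1 * \sum_(i in fold grp l)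
  (goodl l (xs o))%:R * dot (centred_v (tnth o i)) (coefdev x p (train l) (fun u => eps u + rho u) o).
Definition rem_design_noise l (o : n.-tuple Z) := (Num.sqrt n%:R)^-1 * #|fold grp l|%:R *
  ((goodl l (xs o))%:R * dot (dirw F x p (train l) da (xs o)) (pavg x p (train l) eps o)).
Definition rem_design_bias l (o : n.-tuple Z) := (Num.sqrt n%:R)^-1 * #|fold grp l|%:R *
  ((goodl l (xs o))%:R * dot (dirw F x p (train l) da (xs o)) (pavg x p (train l) rho o)).
Definition rem_alpha_noise (o : n.-tuple Z) := \sum_i ((Num.sqrt n%:R)^-1 * fold_weight grp i) *
  ((dot (p (x (tnth o i))) da - al (tnth o i)) * eps (tnth o i)).
Definition rem_alpha_bias (o : n.-tuple Z) := \sum_i ((Num.sqrt n%:R)^-1 * fold_weight grp i) *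
  (dot (p (x (tnth o i))) da * rho (tnth o i)).
Definition rem_weights (o : n.-tuple Z) := \sum_i ((Num.sqrt n%:R)^-1 * (fold_weight grp i - 1)) *
  (al (tnth o i) * eps (tnth o i)).

Lemma gramhat_sym (T : {set 'I_n}) xi : (gramhat p T xi)^T = gramhat p T xi.
Proof.
rewrite /gramhat /sample_gram linearZ /= linear_sum /=; congr (_ *: _).
by apply: eq_bigr => i _; rewrite trmx_mul trmxK.
Qed.

(** The identity behind the expansion: the population functional of the estimation
    error equals its sample analogue on the training set, an average of the noise
    and the approximation error, up to the effect of the deviation of the sample
    second moments. *)
Lemma population_functional (T : {set 'I_n}) o e : gramhat p T (xs o) \in unitmx ->
  dot (gram F x p *m da) (coefdev x p T e o) =
  #|T|%:R^-1 * \sum_(j in T) dot (p (x (tnth o j))) da * e (tnth o j)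
  - dot (dirw F x p T da (xs o)) (pavg x p T e o).
Proof.
move=> uT; have -> : gram F x p = gramhat p T (xs o) - dev F x p T (xs o).
  by rewrite /dev opprB addrCA subrr addr0.
rewrite mulmxBl dotBl; congr (_ - _).
  rewrite -{1}gramhat_sym -dot_mulmx /coefdev adjinvE// mulKVmx//.
  rewrite /pavg /sample_cross dotZr dot_sumr; congr (_ * _).
  by apply: eq_bigr => j _; rewrite dotZr dotC mulrC.
rewrite /coefdev /dirw adjinvE// -[RHS]dotE trmx_mul -mulmxA.
by rewrite trmx_inv gramhat_sym dotE.
Qed.

Lemma remainder_decomposition o : (forall l, goodl l (xs o)) ->
  remainder o = Num.sqrt n%:R * mean F d + rem_functional o + \sum_l rem_heldout l o - \sum_l rem_design_noise l o - \sum_l rem_design_bias l o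
    + rem_alpha_noise o + rem_alpha_bias o + rem_weights o.
Proof.
move=> g.
pose r := (Num.sqrt n%:R)^-1 : R.
have e0 : \sum_l \sum_(i in fold grp l) d (tnth o i) = \sum_i d (tnth o i).
  rewrite [RHS](partition_big grp xpredT)//=; apply: eq_bigr => l _.
  by apply: eq_bigl => i; rewrite inE.
have e1 : r * \sum_i d (tnth o i) = Num.sqrt n%:R * mean F d + rem_functional o.
  rewrite /rem_functional -/r sumrB sumr_const card_ord mulrBr -[mean F d *+ n]mulr_natl mulrA.
  have -> : r * n%:R = Num.sqrt n%:R by rewrite -{1}(sqr_sqrtr (ltW n0')) expr2 mulKf// gt_eqF.
  by rewrite addrCA subrr addr0.
have e2 l : r * \sum_(i in fold grp l) dot (v (tnth o i))
    (coefdev x p (train l) (fun u => eps u + rho u) o) =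
    rem_heldout l o - rem_design_noise l o - rem_design_bias l o + r * (#|fold grp l|%:R * (#|train l|%:R^-1 *
      \sum_(j in train l) dot (p (x (tnth o j))) da * (eps (tnth o j) + rho (tnth o j)))).
  set De := coefdev _ _ _ _ _.
  have -> : \sum_(i in fold grp l) dot (v (tnth o i)) De =
      \sum_(i in fold grp l) dot (centred_v (tnth o i)) De +
      #|fold grp l|%:R * dot (gram F x p *m da) De.
    rewrite mulr_natl -sumr_const -big_split; apply: eq_bigr => i _.
    by rewrite /centred_v /= dotBl subrK.
  rewrite (population_functional _ (good_unit c0 (@good_pd l) (g l))).
  have -> : pavg x p (train l) (fun u => eps u + rho u) o =
      pavg x p (train l) eps o + pavg x p (train l) rho o.
    rewrite /pavg /sample_cross -scalerDr -big_split; congr (_ *: _).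
    by apply: eq_bigr => i _; rewrite scalerDl.
  rewrite dotDr /rem_heldout /rem_design_noise /rem_design_bias -/r -/De (g l) !mul1r.
  under [in RHS]eq_bigr do rewrite mul1r.
  by ring.
have e3 : \sum_l r * \sum_(i in fold grp l) dot (v (tnth o i))
      (coefdev x p (train l) (fun u => eps u + rho u) o) =
    \sum_l rem_heldout l o - \sum_l rem_design_noise l o - \sum_l rem_design_bias l o + r * \sum_j fold_weight grp j *
      (dot (p (x (tnth o j))) da * (eps (tnth o j) + rho (tnth o j))).
  rewrite (eq_bigr _ (fun l _ => e2 l)) big_split /= !sumrB; congr (_ + _).
  by rewrite -mulr_sumr -(fold_average grp (fun j => dot (p (x (tnth o j))) da * (eps (tnth o j) + rho (tnth o j)))).
rewrite -mulr_sumr in e3.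
have e4 : rem_alpha_noise o + rem_alpha_bias o + rem_weights o = r * \sum_j fold_weight grp j *
    (dot (p (x (tnth o j))) da * (eps (tnth o j) + rho (tnth o j))) -
    r * \sum_i al (tnth o i) * eps (tnth o i).
  rewrite /rem_alpha_noise /rem_alpha_bias /rem_weights -/r !mulr_sumr -!big_split -sumrB /=.
  by apply: eq_bigr => i _; ring.
rewrite -!addrA (addrA (rem_alpha_noise o)) e4 /remainder -/r.
have -> : \sum_l \sum_(i in fold grp l) (dot (v (tnth o i))
      (coefdev x p (train l) (fun u => eps u + rho u) o) + d (tnth o i)) =
    \sum_l \sum_(i in fold grp l) dot (v (tnth o i))
      (coefdev x p (train l) (fun u => eps u + rho u) o) + \sum_i d (tnth o i).
  by rewrite -e0 -big_split; apply: eq_bigr => l _; rewrite big_split.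
by rewrite mulrBr mulrDr e1 e3; ring.
Qed.

Lemma mean_sq_wsum_all (w : 'I_n -> R) (f : Z -> R) (W V : R) : L2 F f -> mean F f = 0 ->
  (forall i, w i ^+ 2 <= W / n%:R) -> 0 <= W -> mean F (fun u => f u ^+ 2) <= V ->
  L2 mu (fun o => \sum_i w i * f (tnth o i)) /\
  mean mu (fun o => (\sum_i w i * f (tnth o i)) ^+ 2) <= W * V.
Proof.
move=> Lf f0 wW W0 fV.
have [L1 M1] := mean_sq_wsum muF (finset.setTfor 'I_n) w Lf f0.
have E o : \sum_i w i * f (tnth o i) = \sum_(i in finset.setTfor 'I_n) w i * f (tnth o i).
  by apply: eq_bigl => i; rewrite inE.
split; first by move: L1; congr L2; apply/funext => o; rewrite E.
under eq_mean do rewrite E.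
rewrite M1; apply: ler_pM => //.
- by apply: sumr_ge0 => i _; exact: sqr_ge0.
- by apply: mean_ge0 => u; exact: sqr_ge0.
apply: (@le_trans _ _ (\sum_(i < n) W / n%:R)).
  by rewrite big_mkcond; apply: ler_sum => i _; rewrite inE.
by rewrite sumr_const card_ord -[leLHS]mulr_natl mulrCA divff ?mulr1// gt_eqF.
Qed.

Let mal : measurable_fun setT al.
Proof.
by rewrite (_ : al = alf \o x); [exact: measurableT_comp|apply/funext => u; rewrite alE].
Qed.

Let mrho : measurable_fun setT rho.
Proof.
by rewrite (_ : rho = rhof \o x); [exact: measurableT_comp|apply/funext => u; rewrite rhoE].
Qed.

Let Lrho : L2 F rho.
Proof. by apply: (@L2_bounded _ _ _ _ Mr) => // u; rewrite rhoE. Qed.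

Let eps_sq : mean F (fun u => eps u ^+ 2) <= s2.
Proof.
have := @eps2 (fun=> 1) 1 (measurable_cst _) (fun _ => _).
rewrite mean_cst mulr1; under eq_mean do rewrite mul1r.
by apply => w; rewrite ler01 lexx.
Qed.

Let Ma0 : 0 <= Ma. Proof. exact: le_trans (normr_ge0 _) (al_le point). Qed.
Let U0 : 0 <= U. Proof. exact: le_trans (normr_ge0 _) (aK_le point). Qed.

Lemma moment_functional : integ mu (fun o => `|rem_functional o|) /\ mean mu (fun o => `|rem_functional o|) <= rm.
Proof.
have Lc : L2 F (fun u => d u - mean F d) by apply: L2B => //; exact: L2_cst.
have m0 : mean F (fun u => d u - mean F d) = 0.
  by rewrite meanB ?mean_cst ?subrr//; [exact: L2_integ|exact: integ_cst].
have E : rem_functional = (fun o => \sum_i (Num.sqrt n%:R)^-1 * (d (tnth o i) - mean F d)).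
  by apply/funext => o; rewrite /rem_functional mulr_sumr.
have [||L1 M1] := @mean_sq_wsum_all (fun=> (Num.sqrt n%:R)^-1) _ 1 (rm ^+ 2) Lc m0 _ ler01.
- by move=> i; rewrite exprVn sqr_sqrtr// mul1r.
- exact: le_trans (variance_le Ld) d2.
rewrite mul1r in M1.
have [I1 B1] := mean_abs_le (sqr_ge0 _) L1 M1.
by rewrite E; split=> //; rewrite sqrtr_sqr ger0_norm in B1.
Qed.

Let fold_le_n l : #|fold grp l|%:R <= n%:R :> R.
Proof. by rewrite ler_nat -[leqRHS](fold_cardC grp l) leq_addr. Qed.

Definition heldout_bound : R := Dv * (b * (2 * s2 + 2 * rg ^+ 2) / (cf * n%:R) / c ^+ 2).

Lemma moment_heldout l : integ mu (fun o => `|rem_heldout l o|) /\ mean mu (fun o => `|rem_heldout l o|) <= Num.sqrt heldout_bound.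
Proof.
pose e u := eps u + rho u.
have Le : L2 F e by exact: L2D.
have mpk k : measurable_fun setT (fun w => p w k 0) by exact: mp.
have Iep k : integ F (fun u => eps u * p (x u) k 0) by exact: L2_integ (L2_pM mx mp pb k Leps).
have Irp k : integ F (fun u => rho u * p (x u) k 0) by exact: L2_integ (L2_pM mx mp pb k Lrho).
have e0 k : mean F (fun u => e u * p (x u) k 0) = 0.
  rewrite (@eq_mean _ _ _ _ _ (fun u => eps u * p (x u) k 0 + rho u * p (x u) k 0)); last first.
    by move=> u; rewrite mulrDl.
  rewrite meanD// rho_p addr0 -(eps0 (mpk k) (fun w => p_entry1 pb w k)).
  by apply: eq_mean => u; rewrite mulrC.
have [_ Ie Be] := mean_pavg mx muF mp pb (tr0 l) Le e0.
have e2 : mean F (fun u => e u ^+ 2) <= 2 * s2 + 2 * rg ^+ 2.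
  apply: (le_trans (mean_sqD_le Leps Lrho)); apply: lerD; exact: ler_wpM2l.
have N0 : 0 < #|train l|%:R :> R by rewrite ltr0n.
have Be' : mean mu (fun o => sqn (pavg x p (train l) e o)) <=
    b * (2 * s2 + 2 * rg ^+ 2) / (cf * n%:R).
  apply: (le_trans Be); apply: ler_pM; rewrite ?invr_ge0// ?mulr_ge0 ?(ltW b0)//.
  - by apply: mean_ge0 => u; exact: sqr_ge0.
  - by rewrite ler_wpM2l// ltW.
  - by rewrite lef_pV2 ?posrE// mulr_gt0.
have Lw k : L2 F (fun u => centred_v u k 0).
  have := L2B (Lv k) (L2_cst F ((gram F x p *m da) k 0)).
  by congr L2; apply/funext => u; rewrite !mxE.
have mean_centred_v k : mean F (fun u => centred_v u k 0) = 0.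
  rewrite (@eq_mean _ _ _ _ _ (fun u => v u k 0 - (gram F x p *m da) k 0)); last first.
    by move=> u; rewrite !mxE.
  by rewrite meanB ?mean_cst ?v1 ?subrr//; [exact: L2_integ|exact: integ_cst].
have wd u0 : mean F (fun u => dot (centred_v u) u0 ^+ 2) <= Dv * sqn u0.
  apply: le_trans (v2 u0).
  have Lvd : L2 F (fun u => dot (v u) u0).
    apply: L2_sum => k _; have := L2Z (u0 k 0) (Lv k).
    by congr L2; apply/funext => u; rewrite mulrC.
  apply: le_trans (variance_le Lvd).
  rewrite le_eqVlt; apply/orP; left; apply/eqP; apply: eq_mean => u.
  congr (_ ^+ 2); rewrite /centred_v dotBl; congr (_ - _).
  rewrite mean_sum; last first.
    move=> k _; have := integZ (u0 k 0) (L2_integ (Lv k)).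
    by apply: eq_integ => u'; rewrite mulrC.
  apply: eq_bigr => k _; rewrite -v1 mulrC -meanZ; last exact: L2_integ.
  by apply: eq_mean => u'; rewrite mulrC.
have IT i : i \in fold grp l -> i \notin train l.
  by move=> h; rewrite finset.in_setC negbK.
have [L1 M1] := heldout_term mx muF mp c0 (@good_pd l) IT Dv0 Le Ie Be' Lw mean_centred_v wd.
have LS : L2 mu (rem_heldout l) by exact: L2Z.
have q0 : 0 <= 2 * s2 + 2 * rg ^+ 2 by rewrite addr_ge0// mulr_ge0// sqr_ge0.
have B20 : 0 <= heldout_bound.
  by rewrite /heldout_bound mulr_ge0// divr_ge0 ?sqr_ge0// divr_ge0 ?mulr_ge0// ltW.
have MS : mean mu (fun o => rem_heldout l o ^+ 2) <= heldout_bound.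
  rewrite /rem_heldout; under eq_mean do rewrite exprMn.
  rewrite meanZ; last by case: L1.
  rewrite exprVn sqr_sqrtr ?(ltW n0')// mulrC ler_pdivrMr//.
  apply: (le_trans M1); rewrite mulrC ler_wpM2l//.
exact: mean_abs_le.
Qed.

Definition design_noise_bound : R := s2 * (b * A ^+ 2 / c / (cf ^+ 2 * n%:R)).

Lemma moment_design_noise l : integ mu (fun o => `|rem_design_noise l o|) /\ mean mu (fun o => `|rem_design_noise l o|) <= Num.sqrt design_noise_bound.
Proof.
have [L1 M1] := noise_term mx muF mp pb (tr0 l) c0 (@good_pd l) da Leps eps0 eps2 s2_ge0.
have N0 : 0 < #|train l|%:R :> R by rewrite ltr0n.
have B30 : 0 <= design_noise_bound.
  by rewrite /design_noise_bound mulr_ge0// !divr_ge0 ?mulr_ge0 ?sqr_ge0// ltW.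
have LS : L2 mu (rem_design_noise l) by exact: L2Z.
have MS : mean mu (fun o => rem_design_noise l o ^+ 2) <= design_noise_bound.
  rewrite /rem_design_noise; under eq_mean do rewrite exprMn.
  rewrite meanZ; last by case: L1.
  rewrite exprMn exprVn sqr_sqrtr ?(ltW n0')//.
  apply: (@le_trans _ _ (n%:R^-1 * n%:R ^+ 2 *
      (s2 * (b * A ^+ 2 / (cf * n%:R) / c / (cf * n%:R))))); last first.
    by rewrite le_eqVlt; apply/orP; left; apply/eqP; rewrite /design_noise_bound; field; rewrite !gt_eqF.
  apply: ler_pM; first by rewrite mulr_ge0 ?invr_ge0 ?sqr_ge0.
  - by apply: mean_ge0 => o; exact: sqr_ge0.
  - by rewrite ler_wpM2l ?invr_ge0// ler_pXn2r ?nnegrE.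
  apply: (le_trans M1); rewrite ler_wpM2l//.
  have iN : #|train l|%:R^-1 <= (cf * n%:R)^-1 :> R by rewrite lef_pV2 ?posrE// mulr_gt0.
  have m0 : 0 <= mean F (fun u => dot (p (x u)) da ^+ 2) by apply: mean_ge0 => u; exact: sqr_ge0.
  apply: ler_pM; rewrite ?invr_ge0// ?divr_ge0// ?mulr_ge0 ?(ltW b0) ?(ltW c0)//.
  rewrite ler_wpM2r ?invr_ge0 ?(ltW c0)//.
  apply: ler_pM; rewrite ?invr_ge0// ?mulr_ge0 ?(ltW b0)//.
  by rewrite ler_wpM2l// ltW.
exact: mean_abs_le.
Qed.

Definition design_bias_bound : R := A * rg * b / (cf * c * Num.sqrt n%:R).

Lemma moment_design_bias l : integ mu (fun o => `|rem_design_bias l o|) /\ mean mu (fun o => `|rem_design_bias l o|) <= design_bias_bound.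
Proof.
pose s := Num.sqrt (b / (cf * n%:R)).
have cfn : 0 < cf * n%:R by rewrite mulr_gt0.
have s0 : 0 < s by rewrite sqrtr_gt0 divr_gt0.
have ss : s ^+ 2 = b / (cf * n%:R) by rewrite sqr_sqrtr// ltW// divr_gt0.
have N0 : 0 < #|train l|%:R :> R by rewrite ltr0n.
have iN : #|train l|%:R^-1 <= (cf * n%:R)^-1 :> R by rewrite lef_pV2 ?posrE// mulr_gt0.
have bnd (y Y : R) : 0 <= y -> y <= Y ^+ 2 -> b * y / #|train l|%:R <= (Y * s) ^+ 2.
  move=> y0 yY; rewrite exprMn ss mulrCA [leRHS]mulrA; apply: ler_pM; rewrite ?invr_ge0//.
    by rewrite mulr_ge0// ltW.
  by rewrite ler_wpM2l// ltW.
have [||||I1 M1] := bias_term mx muF mp pb (tr0 l) c0 (@good_pd l) (da := da) (al := A * s)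
  (be := rg * s) Lrho rho_p.
- by rewrite mulr_gt0.
- by rewrite mulr_gt0.
- by apply: bnd => //; apply: mean_ge0 => u; exact: sqr_ge0.
- by apply: bnd => //; apply: mean_ge0 => u; exact: sqr_ge0.
have r0 : 0 <= (Num.sqrt n%:R)^-1 * #|fold grp l|%:R :> R by rewrite mulr_ge0 ?invr_ge0.
have E : (fun o => `|rem_design_bias l o|) = (fun o => (Num.sqrt n%:R)^-1 * #|fold grp l|%:R *
  `|(goodl l (xs o))%:R * dot (dirw F x p (train l) da (xs o)) (pavg x p (train l) rho o)|).
  by apply/funext => o; rewrite /rem_design_bias normrM ger0_norm.
rewrite E; split; first exact: integZ.
rewrite meanZ//.
apply: (@le_trans _ _ ((Num.sqrt n%:R)^-1 * n%:R * (A * s * (rg * s) / c))).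
  apply: ler_pM => //; first by apply: mean_ge0.
  by rewrite ler_wpM2l ?invr_ge0.
rewrite le_eqVlt; apply/orP; left; apply/eqP; rewrite /design_bias_bound.
have -> : A * s * (rg * s) / c = A * rg * s ^+ 2 / c by ring.
rewrite ss; move: sn0 (sqr_sqrtr (ltW n0')); set r := Num.sqrt _ => r0' <-.
by field; rewrite !gt_eqF.
Qed.

Let weight_sq i : ((Num.sqrt n%:R)^-1 * fold_weight grp i) ^+ 2 <= cf^-1 ^+ 2 / n%:R.
Proof.
have /andP[h1 h2] := fold_weight_le cf0 n0 large i.
have -> : ((Num.sqrt n%:R)^-1 * fold_weight grp i) ^+ 2 = fold_weight grp i ^+ 2 / n%:R :> R.
  by rewrite exprMn exprVn sqr_sqrtr ?(ltW n0')// mulrC.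
rewrite ler_wpM2r ?invr_ge0//.
by rewrite ler_pXn2r ?nnegrE ?invr_ge0// ltW.
Qed.

Let noise_mul (h : X -> R) (M : R) : measurable_fun setT h -> (forall w, `|h w| <= M) ->
  [/\ L2 F (fun u => h (x u) * eps u), mean F (fun u => h (x u) * eps u) = 0 &
    mean F (fun u => (h (x u) * eps u) ^+ 2) <= s2 * mean F (fun u => h (x u) ^+ 2)].
Proof.
move=> mh hM; split.
- by apply: (L2Mb Leps) => [|u]; [exact: (measurableT_comp mh mx)|exact: hM].
- exact: eps0 mh hM.
under eq_mean do rewrite exprMn.
apply: (eps2 (M := M ^+ 2) (measurable_funX 2 mh)) => w.
rewrite sqr_ge0 /= -[leLHS]real_normK ?num_real// ler_pXn2r ?nnegrE//.
exact: le_trans (hM w).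
Qed.

Let mpda : measurable_fun setT (fun w => dot (p w) da).
Proof. by apply: measurable_dot => //; exact: mxmeas_cst. Qed.

Lemma moment_alpha_noise : integ mu (fun o => `|rem_alpha_noise o|) /\
  mean mu (fun o => `|rem_alpha_noise o|) <= cf^-1 * Num.sqrt s2 * ra.
Proof.
pose h w := dot (p w) da - alf w.
have mh : measurable_fun setT h by exact: measurable_funB.
have [Lh h0 h2] := noise_mul mh aK_le.
have E : rem_alpha_noise = (fun o => \sum_i (Num.sqrt n%:R)^-1 * fold_weight grp i * (h (x (tnth o i)) * eps (tnth o i))).
  by apply/funext => o; apply: eq_bigr => i _; rewrite alE.
have hra : mean F (fun u => (h (x u) * eps u) ^+ 2) <= s2 * ra ^+ 2.
  apply: (le_trans h2); rewrite ler_wpM2l//; apply: le_trans aKal2.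
  by rewrite le_eqVlt; apply/orP; left; apply/eqP; apply: eq_mean => u; rewrite alE.
have [L1 M1] := mean_sq_wsum_all Lh h0 weight_sq (sqr_ge0 _) hra.
have [I1 B1] := mean_abs_le (mulr_ge0 (sqr_ge0 _) (mulr_ge0 s2_ge0 (sqr_ge0 _))) L1 M1.
rewrite E; split=> //; apply: (le_trans B1).
rewrite sqrtrM ?sqr_ge0// sqrtr_sqr sqrtrM// sqrtr_sqr mulrA.
by rewrite !ger0_norm// invr_ge0 ltW.
Qed.

Lemma moment_alpha_bias : integ mu (fun o => `|rem_alpha_bias o|) /\
  mean mu (fun o => `|rem_alpha_bias o|) <= cf^-1 * ((Ma + U) * rg).
Proof.
pose f u := dot (p (x u)) da * rho u.
have ab w : `|dot (p w) da| <= Ma + U.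
  rewrite -[dot _ _](subrK (alf w)); apply: (le_trans (ler_normD _ _)).
  by rewrite addrC lerD.
have Lf : L2 F f.
  by apply: (L2Mb Lrho) => [|u]; [exact: (measurableT_comp mpda mx)|exact: ab].
have f0 : mean F f = 0.
  rewrite (@eq_mean _ _ _ _ _ (fun u => \sum_k da k 0 * (rho u * p (x u) k 0))); last first.
    by move=> u; rewrite /f /dot mulr_suml; apply: eq_bigr => k _; ring.
  have Irp k : integ F (fun u => rho u * p (x u) k 0) by exact: L2_integ (L2_pM mx mp pb k Lrho).
  rewrite mean_sum; last by move=> k _; exact: integZ.
  by rewrite big1// => k _; rewrite meanZ// rho_p mulr0.
have fV : mean F (fun u => f u ^+ 2) <= ((Ma + U) * rg) ^+ 2.
  apply: (@le_trans _ _ (mean F (fun u => (Ma + U) ^+ 2 * rho u ^+ 2))).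
    apply: le_mean; [by case: Lf|by apply: integZ; case: Lrho|].
    move=> u; rewrite /f exprMn ler_wpM2r ?sqr_ge0//.
    by rewrite -[leLHS]real_normK ?num_real// ler_pXn2r ?nnegrE// addr_ge0.
  rewrite meanZ; last by case: Lrho.
  by rewrite exprMn ler_wpM2l// sqr_ge0.
have [L1 M1] := mean_sq_wsum_all Lf f0 weight_sq (sqr_ge0 _) fV.
have [I1 B1] := mean_abs_le (mulr_ge0 (sqr_ge0 _) (sqr_ge0 _)) L1 M1.
split=> //; apply: (le_trans B1).
rewrite sqrtrM ?sqr_ge0// !sqrtr_sqr.
by rewrite !ger0_norm// ?invr_ge0 ?(ltW cf0)// mulr_ge0 ?addr_ge0// ltW.
Qed.

Definition weights_bound : R := (L%:R / cf / n%:R) * (Num.sqrt s2 * Ma).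

Lemma moment_weights : integ mu (fun o => `|rem_weights o|) /\ mean mu (fun o => `|rem_weights o|) <= weights_bound.
Proof.
have [Lh h0 h2] := noise_mul malf al_le.
have E : rem_weights = (fun o => \sum_i (Num.sqrt n%:R)^-1 * (fold_weight grp i - 1) *
    (alf (x (tnth o i)) * eps (tnth o i))).
  by apply/funext => o; apply: eq_bigr => i _; rewrite alE.
have w1 i : ((Num.sqrt n%:R)^-1 * (fold_weight grp i - 1)) ^+ 2 <= (L%:R / cf / n%:R) ^+ 2 / n%:R.
  have h := fold_weight_near1 cf0 n0 large balanced i.
  rewrite exprMn exprVn sqr_sqrtr ?(ltW n0')// mulrC ler_wpM2r ?invr_ge0//.
  by rewrite -[leLHS]real_normK ?num_real// ler_pXn2r ?nnegrE// !divr_ge0// ltW.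
have hV : mean F (fun u => (alf (x u) * eps u) ^+ 2) <= s2 * Ma ^+ 2.
  apply: (le_trans h2); rewrite ler_wpM2l//.
  rewrite -[leRHS](mean_cst F); apply: le_mean; last 2 first.
  - exact: integ_cst.
  - move=> u; rewrite -[leLHS]real_normK ?num_real// ler_pXn2r ?nnegrE//.
  - apply: (proj2 (@L2_bounded _ _ _ F Ma _ _ _)) => [|u]; last exact: al_le.
    exact: (measurableT_comp malf mx).
have [L1 M1] := mean_sq_wsum_all Lh h0 w1 (sqr_ge0 _) hV.
have [I1 B1] := mean_abs_le (mulr_ge0 (sqr_ge0 _) (mulr_ge0 s2_ge0 (sqr_ge0 _))) L1 M1.
rewrite E; split=> //; apply: (le_trans B1).
rewrite sqrtrM ?sqr_ge0// sqrtr_sqr sqrtrM// sqrtr_sqr !ger0_norm//.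
by rewrite !divr_ge0// ltW.
Qed.

Definition remainder_bound : R := Num.sqrt n%:R * md + rm + L%:R * Num.sqrt heldout_bound + L%:R * Num.sqrt design_noise_bound +
  L%:R * design_bias_bound + cf^-1 * Num.sqrt s2 * ra + cf^-1 * ((Ma + U) * rg) + weights_bound.

(** The sum of the absolute values of the terms. A bound in mean is enough for
    Markov's inequality, and a dominating function allows the remainder itself to
    be nonmeasurable off the good event. *)
Lemma remainder_dominated : exists Q : n.-tuple Z -> R,
  [/\ integ mu Q, forall o, 0 <= Q o, mean mu Q <= remainder_bound &
    forall o, (forall l, goodl l (xs o)) -> `|remainder o| <= Q o].
Proof.
have [I1 M1] := moment_functional; have [I5 M5] := moment_alpha_noise.
have [I6 M6] := moment_alpha_bias; have [I7 M7] := moment_weights.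
have I2 l := proj1 (moment_heldout l); have M2 l := proj2 (moment_heldout l).
have I3 l := proj1 (moment_design_noise l); have M3 l := proj2 (moment_design_noise l).
have I4 l := proj1 (moment_design_bias l); have M4 l := proj2 (moment_design_bias l).
have md0 : 0 <= md by exact: le_trans (normr_ge0 _) d1.
have IS (S : 'I_L -> n.-tuple Z -> R) : (forall l, integ mu (fun o => `|S l o|)) ->
  integ mu (fun o => \sum_l `|S l o|) by move=> h; apply: integ_sum.
have MS (S : 'I_L -> n.-tuple Z -> R) (B : R) : (forall l, integ mu (fun o => `|S l o|)) ->
    (forall l, mean mu (fun o => `|S l o|) <= B) ->
    mean mu (fun o => \sum_l `|S l o|) <= L%:R * B.
  move=> h hB; rewrite mean_sum//; apply: (@le_trans _ _ (\sum_(l < L) B)).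
    by apply: ler_sum => l _.
  by rewrite sumr_const card_ord mulr_natl.
exists (fun o => Num.sqrt n%:R * md + `|rem_functional o| + (\sum_l `|rem_heldout l o|) + (\sum_l `|rem_design_noise l o|) +
  (\sum_l `|rem_design_bias l o|) + `|rem_alpha_noise o| + `|rem_alpha_bias o| + `|rem_weights o|).
have Ic : integ mu (fun=> Num.sqrt n%:R * md) by exact: integ_cst.
have J2 := IS _ I2; have J3 := IS _ I3; have J4 := IS _ I4.
have K1 := integD Ic I1; have K2 := integD K1 J2; have K3 := integD K2 J3.
have K4 := integD K3 J4; have K5 := integD K4 I5; have K6 := integD K5 I6.
split.
- exact: (integD K6 I7).
- by move=> o; rewrite !addr_ge0 ?sumr_ge0// mulr_ge0.
- rewrite meanD// meanD// meanD// meanD// meanD// meanD// meanD// mean_cst /remainder_bound.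
  by rewrite !lerD//; apply: MS.
move=> o g; rewrite (remainder_decomposition g).
have t1 : `|Num.sqrt n%:R * mean F d| <= Num.sqrt n%:R * md.
  by rewrite normrM ger0_norm// ler_wpM2l.
do 3 (apply: (le_trans (ler_normD _ _)); apply: lerD => //).
do 2 (apply: (le_trans (ler_normB _ _)); apply: lerD; last exact: ler_norm_sum).
apply: (le_trans (ler_normD _ _)); apply: lerD; last exact: ler_norm_sum.
by apply: (le_trans (ler_normD _ _)); apply: lerD.
Qed.

End remainder_terms.

(** * The law of the sample and least squares projections *)

Section almost_everywhere.
Context {R : realType} d (T : measurableType d) (mu : probability T R).
Implicit Types f g : T -> R.

Lemma mean_ae f g : measurable_fun setT f -> measurable_fun setT g ->
  {ae mu, forall u, f u = g u} -> mean mu f = mean mu g.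
Proof.
move=> mf mg fg; congr fine; apply: ae_eq_integral => //.
- exact/measurable_EFinP.
- exact/measurable_EFinP.
- by apply: filterS fg => u fgu _; rewrite fgu.
Qed.

Lemma integ_ae f g : measurable_fun setT f -> {ae mu, forall u, f u = g u} ->
  integ mu g -> integ mu f.
Proof.
move=> mf fg /integrableP[mg fin]; apply/integrableP; split; first exact/measurable_EFinP.
rewrite (ae_eq_integral (fun u => `|(EFin \o g) u|%E))//.
- by apply: measurableT_comp => //; exact/measurable_EFinP.
- exact: measurableT_comp.
- by apply: filterS fg => u fgu _ /=; rewrite fgu.
Qed.

Lemma le_mean_ae f g : integ mu f -> integ mu g -> {ae mu, forall u, f u <= g u} ->
  mean mu f <= mean mu g.
Proof.
move=> If Ig fg; have mf := integ_meas If; have mg := integ_meas Ig.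
have mM : measurable_fun setT (fun u => Num.max (f u) (g u)) by exact: measurable_maxr.
rewrite -(@mean_ae (fun u => Num.max (f u) (g u)) g)//; last first.
  by apply: filterS fg => u; rewrite maxEle => ->.
apply: le_mean => //; last by move=> u; rewrite le_max lexx.
apply: (integ_ae mM _ Ig).
by apply: filterS fg => u; rewrite maxEle => ->.
Qed.

End almost_everywhere.

Section sample.
Context {R : realType} d dZ (Om : measurableType d) (Z : measurableType dZ).
Variables (P : probability Om R) (F0 : probability Z R) (z : nat -> {mfun Om >-> Z}).
Hypothesis z_iid : iid P F0 z.

Definition sample n (o : Om) : n.-tuple Z := [tuple z i o | i < n].

Lemma measurable_sample n : measurable_fun setT (@sample n).
Proof.
apply/measurable_fun_tnthP => i.
by rewrite (_ : _ \o _ = z i)//; apply/funext => o /=; rewrite tnth_mktuple.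
Qed.

HB.instance Definition _ n := isMeasurableFun.Build _ _ _ _ (@sample n) (@measurable_sample n).

Definition sample_law n : probability (n.-tuple Z) R := distribution P (@sample n).

Lemma sample_lawE n B : sample_law n B = P (@sample n @^-1` B).
Proof. by []. Qed.

Lemma sample_iid_law n : iid_law F0 (sample_law n).
Proof.
move=> A mA; rewrite sample_lawE; case: z_iid => zF zprod.
pose A' i := match ltnP i n with LtnNotGeq h => A (Ordinal h) | _ => setT end.
have mA' i : measurable (A' i) by rewrite /A'; case: ltnP => // h; exact: mA.
have A'E (i : 'I_n) : A' i = A i.
  rewrite /A'; case: ltnP => [h|]; last by rewrite leqNgt ltn_ord.
  by congr A; apply: val_inj.
have -> : \prod_i fine (F0 (A i)) = \prod_(i < n) fine (P (z i @^-1` A' i)).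
  by apply: eq_bigr => i _; rewrite zF// A'E.
rewrite -(zprod n _ mA'); congr (P _); apply/seteqP; split => o /=.
  by move=> h i /= ilt; have := h (Ordinal ilt); rewrite tnth_mktuple -A'E.
by move=> h i; rewrite tnth_mktuple -A'E; exact: h (ltn_ord i).
Qed.

End sample.

Section projection.
Context {R : realType} dZ dX (Z : measurableType dZ) (X : measurableType dX).
Variables (F : probability Z R) (x : Z -> X).
Hypothesis mx : measurable_fun setT x.

(** Where [g] is not close to [h], put [h] in its place. *)
Lemma modify_near (g h : X -> R) (del : R) : 0 <= del ->
  measurable_fun setT g -> measurable_fun setT h ->
  {ae F, forall u, `|g (x u) - h (x u)| <= del} ->
  exists gf : X -> R, [/\ measurable_fun setT gf,
    forall v, `|gf v - h v| <= del & {ae F, forall u, gf (x u) = g (x u)}].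
Proof.
move=> del0 mg mh gh.
exists (fun v => if `|g v - h v| <= del then g v else h v); split.
- apply: measurable_fun_ifT => //.
  apply: measurable_fun_ler; last exact: measurable_cst.
  by apply: measurableT_comp => //; exact: measurable_funB.
- by move=> v; case: ifP => //; rewrite subrr normr0.
- by apply: filterS gh => u ->.
Qed.

Variables (K : nat) (p : X -> 'cV[R]_K) (b c : R).
Hypothesis mp : mxmeas p.
Hypothesis pb : forall v, sqn (p v) <= b.
Hypothesis c0 : 0 < c.
Hypothesis gram_pd : forall u, c * sqn u <= qform (gram F x p) u.

Definition proj_coef (g : X -> R) : 'cV[R]_K :=
  invmx (gram F x p) *m \col_k mean F (fun u => g (x u) * p (x u) k 0).

Variables (g : X -> R) (e : 'cV[R]_K) (del : R).
Hypothesis mg : measurable_fun setT g.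
Hypothesis ge : forall v, `|g v - dot (p v) e| <= del.
Local Notation dd := (proj_coef g).

Let L2res : L2 F (fun u => g (x u) - dot (p (x u)) e).
Proof.
apply: (@L2_bounded _ _ _ _ del); last by move=> u; exact: ge.
apply: measurable_funB; first exact: measurableT_comp.
by case: (L2_dot F mx mp pb e).
Qed.

Lemma L2_near : L2 F (fun u => g (x u)).
Proof.
have := L2D L2res (L2_dot F mx mp pb e).
by congr L2; apply/funext => u; rewrite subrK.
Qed.

Lemma gram_proj_coef k : (gram F x p *m dd) k 0 = mean F (fun u => g (x u) * p (x u) k 0).
Proof.
by rewrite /proj_coef mulKVmx ?mxE//; exact: posdef_unitmx c0 gram_pd.
Qed.

Let L2pr : L2 F (fun u => g (x u) - dot (p (x u)) dd).
Proof. by apply: L2B; [exact: L2_near|exact: (L2_dot F mx mp pb _)]. Qed.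

Lemma proj_orthogonal k : mean F (fun u => (g (x u) - dot (p (x u)) dd) * p (x u) k 0) = 0.
Proof.
rewrite (@eq_mean _ _ _ _ _ (fun u => g (x u) * p (x u) k 0 - dot (p (x u)) dd * p (x u) k 0)); last first.
  by move=> u; rewrite mulrBl.
have Lp := L2_p F mx mp pb k.
rewrite meanB; [|exact: (L2M L2_near Lp)|exact: (L2M (L2_dot F mx mp pb _) Lp)].
by rewrite -gram_proj_coef (gram_apply F mx mp pb) subrr.
Qed.

Lemma proj_orthogonal_dot f : mean F (fun u => (g (x u) - dot (p (x u)) dd) * dot (p (x u)) f) = 0.
Proof.
rewrite (@eq_mean _ _ _ _ _ (fun u => \sum_k f k 0 * ((g (x u) - dot (p (x u)) dd) * p (x u) k 0))); last first.
  by move=> u; rewrite /dot mulr_sumr; apply: eq_bigr => k _; ring.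
have Ip k : integ F (fun u => (g (x u) - dot (p (x u)) dd) * p (x u) k 0).
  exact: (L2M L2pr (L2_p F mx mp pb k)).
rewrite mean_sum; last by move=> k _; exact: integZ.
by rewrite big1// => k _; rewrite meanZ// proj_orthogonal mulr0.
Qed.

Lemma pythagoras f : mean F (fun u => (g (x u) - dot (p (x u)) f) ^+ 2) =
  mean F (fun u => (g (x u) - dot (p (x u)) dd) ^+ 2) + qform (gram F x p) (dd - f).
Proof.
rewrite (qform_gram F mx mp pb).
have Lf := L2_dot F mx mp pb (dd - f).
rewrite (@eq_mean _ _ _ _ _ (fun u => (g (x u) - dot (p (x u)) dd) ^+ 2 +
   (2 * ((g (x u) - dot (p (x u)) dd) * dot (p (x u)) (dd - f)) + dot (p (x u)) (dd - f) ^+ 2))); last first.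
  by move=> u; rewrite dotBr; ring.
have I1 : integ F (fun u => 2 * ((g (x u) - dot (p (x u)) dd) * dot (p (x u)) (dd - f))).
  by apply: integZ; exact: (L2M L2pr Lf).
rewrite meanD; [|by case: L2pr|by apply: integD => //; case: Lf].
rewrite meanD//; last by case: Lf.
rewrite meanZ; last exact: (L2M L2pr Lf).
by rewrite proj_orthogonal_dot mulr0 add0r.
Qed.

Lemma gram_psd f : 0 <= qform (gram F x p) f.
Proof. by apply: le_trans (gram_pd f); rewrite mulr_ge0 ?sqn_ge0// ltW. Qed.

Let del0 : 0 <= del. Proof. exact: le_trans (normr_ge0 _) (ge point). Qed.

Let mean_res : mean F (fun u => (g (x u) - dot (p (x u)) e) ^+ 2) <= del ^+ 2.
Proof.
rewrite -[leRHS](mean_cst F); apply: le_mean; [by case: L2res|exact: integ_cst|].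
by move=> u; rewrite -[leLHS]real_normK ?num_real// ler_pXn2r ?nnegrE//; exact: ge.
Qed.

Lemma proj_error : mean F (fun u => (g (x u) - dot (p (x u)) dd) ^+ 2) <= del ^+ 2.
Proof.
by apply: le_trans mean_res; rewrite (pythagoras e) lerDl gram_psd.
Qed.

Lemma proj_contract : mean F (fun u => dot (p (x u)) dd ^+ 2) <= mean F (fun u => g (x u) ^+ 2).
Proof.
have -> : mean F (fun u => g (x u) ^+ 2) = mean F (fun u => (g (x u) - dot (p (x u)) 0) ^+ 2).
  by apply: eq_mean => u; rewrite -[X in dot _ X](subrr 0) dotBr subrr subr0.
rewrite (pythagoras 0) subr0 (qform_gram F mx mp pb) lerDr.
by apply: mean_ge0 => u; exact: sqr_ge0.
Qed.

(** By [pythagoras] the coefficients are at distance at most [del / sqrt c] from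
    those of the given approximation. *)
Lemma proj_sup_error v : `|g v - dot (p v) dd| <= del * (1 + Num.sqrt (b / c)).
Proof.
have b0 : 0 <= b by exact: le_trans (sqn_ge0 _) (pb point).
have h : c * sqn (dd - e) <= del ^+ 2.
  apply: (le_trans (gram_pd _)); apply: le_trans mean_res.
  by rewrite (pythagoras e) lerDr; apply: mean_ge0 => u; exact: sqr_ge0.
have h1 : sqn (dd - e) <= del ^+ 2 / c by rewrite ler_pdivlMr// mulrC.
have -> : g v - dot (p v) dd = (g v - dot (p v) e) - dot (p v) (dd - e).
  by rewrite dotBr; ring.
apply: (le_trans (ler_normB _ _)); rewrite mulrDr mulr1 lerD//.
rewrite -(sqrtr_sqr (dot _ _)) -{1}(ger0_norm del0) -(sqrtr_sqr del) -sqrtrM ?sqr_ge0// ler_wsqrtr//.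
apply: (le_trans (dot_sq_le _ _)); have -> : del ^+ 2 * (b / c) = b * (del ^+ 2 / c) by ring.
by apply: ler_pM; rewrite ?sqn_ge0.
Qed.

End projection.

(** * Regressors proportional to splines *)

Lemma sqn0 {R : realType} n : sqn (0 : 'cV[R]_n) = 0.
Proof. by apply/eqP; rewrite sqn_eq0. Qed.

Section boxes.
Context {R : realType} {r : nat}.
Implicit Types (lo hi : 'I_r -> R) (v : r.-tuple R).

Definition inbox lo hi v : bool := [forall j, lo j <= tnth v j <= hi j].

Lemma measurable_inbox lo hi : measurable_fun setT (fun v => (inbox lo hi v)%:R : R).
Proof.
rewrite (_ : (fun _ => _) =
    fun v => \prod_j (((lo j <= tnth v j) && (tnth v j <= hi j) : bool)%:R : R)).
  apply: measurable_prod => j _; apply: measurable_nat_of_bool; apply: measurable_and.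
  - by apply: measurable_fun_ler => //; exact: measurable_tnth.
  - by apply: measurable_fun_ler => //; exact: measurable_tnth.
apply/funext => v; rewrite /inbox.
case: (boolP [forall j, _]) => [/forallP h|]; first by rewrite big1// => j _; rewrite h.
rewrite negb_forall => /existsP[j /negbTE h].
by rewrite (bigD1 j)//= h mul0r.
Qed.

Lemma measurable_box lo hi : measurable [set v | inbox lo hi v].
Proof.
rewrite [X in measurable X](_ : _ = setT `&` (fun v => (inbox lo hi v)%:R : R) @^-1` [set 1]).
  by apply: measurable_inbox => //; exact: measurable_set1.
apply/seteqP; split => v /=; first by move=> ->.
by case: inbox => // -[_] /eqP; rewrite eq_sym oner_eq0.
Qed.

Definition cubeb : r.-tuple R -> bool := inbox (fun=> 0) (fun=> 1).

Lemma cubeP v : reflect (cube v) (cubeb v).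
Proof. exact: forallP. Qed.

End boxes.

Section spline_regressors.
Context {R : realType} dZ (Z : measurableType dZ) (F : probability Z R).
Variables (r : nat) (a : {mfun Z >-> R}) (w : {mfun Z >-> r.-tuple R}).
Local Notation X := (regressor R r).
Local Notation x := (fun u : Z => (a u, w u) : X).
Variables (f : r.-tuple R -> R) (cf Cf : R).
Hypothesis cf0 : 0 < cf.
Hypothesis f_cube : forall v, cube v -> cf <= f v <= Cf.
Hypothesis f_off : forall v, ~ cube v -> f v = 0.
Hypothesis f_law : forall A, measurable A ->
  F (w @^-1` A) = lebesgue_iint (fun v => (f v * \1_A v)%:E).

Let f_ge0 v : 0 <= f v.
Proof.
have [/f_cube/andP[h _]|/f_off->//] := pselect (cube v); exact: le_trans (ltW cf0) h.
Qed.

Let Cf0 : 0 <= Cf.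
Proof.
have /f_cube/andP[h1 h2] : cube ([tuple 0 | i < r] : r.-tuple R).
  by move=> j; rewrite tnth_mktuple lexx ler01.
exact: le_trans (ltW cf0) (le_trans h1 h2).
Qed.

Lemma box_prob lo hi : (forall j, 0 <= lo j /\ lo j <= hi j) -> (forall j, hi j <= 1) ->
  (F (w @^-1` [set v | inbox lo hi v]) <= (Cf * \prod_j (hi j - lo j))%:E)%E.
Proof.
move=> lh h1; rewrite f_law; last exact: measurable_box.
apply: lebesgue_iint_box_le => //.
- by move=> j; case: (lh j).
- by move=> v; rewrite lee_fin mulr_ge0.
- move=> v; rewrite lee_fin; have [/f_cube/andP[_ h]|/f_off->] := pselect (cube v); last by rewrite mul0r.
  rewrite indicE; case: (v \in _); first by rewrite mulr1.
  by rewrite mulr0.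
- move=> v nv; rewrite indicE memNset ?mulr0// => /forallP h.
  by apply: nv.
Qed.

Lemma cube_ae : {ae F, forall u, cube (w u)}.
Proof.
have mC : measurable (w @^-1` ~` [set v | cubeb v]).
  rewrite -[X in measurable X]setTI; apply: (measurable_funPT w) => //.
  by apply: measurableC; exact: measurable_box.
exists (w @^-1` ~` [set v | cubeb v]); split => //.
  apply/eqP; rewrite eq_le measure_ge0 andbT f_law; last by apply: measurableC; exact: measurable_box.
  apply: (@le_trans _ _ (0 * \prod_(j < r) ((fun=> 1) j - (fun=> 0) j : R))%:E); last by rewrite mul0r.
  have z v : (f v * \1_(~` [set v | cubeb v]) v)%:E = 0 :> \bar R.
    have [c|/f_off->] := pselect (cube v); last by rewrite mul0r.
    by rewrite indicE memNset ?mulr0// => /(_ (introT (cubeP v) c)).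
  apply: lebesgue_iint_box_le => // v; by rewrite z.
by move=> u nc /= /cubeP cu; exact: nc.
Qed.

Variables (K : nat) (q : r.-tuple R -> 'cV[R]_K) (kap : nat) (cS CS : R).
Hypothesis r0 : (0 < r)%N.
Hypothesis K0 : (0 < K)%N.
Hypothesis cS0 : 0 < cS.
Hypothesis q_spline : tensor_bspline kap cS CS q.
Local Notation p := (fun v : X => v.1 *: q v.2).
Variables (ce Cb Ca ch : R) (h : r.-tuple R -> R).
Hypothesis ce0 : 0 < ce.
Hypothesis q_eigen : ce <= lambda_min (expectation_mx F (fun u => q (w u) *m (q (w u))^T)).
Hypothesis Cb0 : 0 < Cb.
Hypothesis q_bound : forall v, cube v -> enorm (q v) <= Cb * Num.sqrt K%:R.
Hypothesis Ca0 : 0 < Ca.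
Hypothesis a_bound : {ae F, forall u, `|a u| <= Ca}.
Hypothesis h_cond : is_cond_mean F (fun u => a u ^+ 2) w h.
Hypothesis ch0 : 0 < ch.
Hypothesis h_ge : {ae F, forall u, ch <= h (w u)}.

Definition inrange (v : X) : bool := (`|v.1| <= Ca) && cubeb v.2.

(** Bounded everywhere, and almost surely equal to the basis. *)
Definition cutbasis (v : X) : 'cV[R]_K := (inrange v)%:R *: (v.1 *: q v.2).

Lemma measurable_regressor : measurable_fun setT x.
Proof. exact: measurable_fun_pair. Qed.

Lemma measurable_q : mxmeas q.
Proof. by move=> i j; rewrite ord1; exact: measurable_tensor_bspline q_spline. Qed.

Lemma measurable_basis : mxmeas p.
Proof.
apply: mxmeasZ => //.
move=> i j; exact: (measurableT_comp (measurable_q i j) measurable_snd).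
Qed.

Lemma measurable_cutbasis : mxmeas cutbasis.
Proof.
apply: mxmeasZ; last exact: measurable_basis.
rewrite (_ : (fun _ => _) = fun v : X => ((`|v.1| <= Ca)%R : bool)%:R * (cubeb v.2)%:R : R); last first.
  by apply/funext => v; rewrite /inrange; case: (_ <= _); rewrite ?mul1r ?mul0r.
apply: measurable_funM.
  apply: measurable_nat_of_bool; apply: measurable_fun_ler => //.
  exact: measurableT_comp.
exact: (measurableT_comp (measurable_inbox _ _) measurable_snd).
Qed.

Lemma inrange_ae : {ae F, forall u, inrange (x u)}.
Proof.
by apply: filterS2 a_bound cube_ae => u h1 h2; apply/andP; split => //; apply/cubeP.
Qed.

Lemma cutbasis_ae : {ae F, forall u, cutbasis (x u) = p (x u)}.
Proof. by apply: filterS inrange_ae => u h1; rewrite /cutbasis h1 scale1r. Qed.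

Lemma sqn_q v : cube v -> sqn (q v) <= Cb ^+ 2 * K%:R.
Proof.
move=> /q_bound; have -> : enorm (q v) = Num.sqrt (sqn (q v)).
  by congr Num.sqrt; apply: eq_bigr => i _; rewrite big_ord1.
move=> hq; rewrite -[leLHS]sqr_sqrtr ?sqn_ge0// -[K%:R]sqr_sqrtr// -exprMn.
by rewrite ler_pXn2r ?nnegrE ?mulr_ge0// ltW.
Qed.

Lemma sqn_cutbasis v : sqn (cutbasis v) <= Ca ^+ 2 * Cb ^+ 2 * K%:R.
Proof.
rewrite /cutbasis /inrange; case: (boolP (_ && _)) => [/andP[h1 /cubeP h2]|_]; last first.
  by rewrite mulr0n scale0r sqn0 !mulr_ge0 ?(ltW Ca0) ?(ltW Cb0).
rewrite scale1r sqnZ -mulrA; apply: ler_pM; rewrite ?sqr_ge0 ?sqn_ge0//.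
  by rewrite -[leLHS]real_normK ?num_real// ler_pXn2r ?nnegrE// ltW.
exact: sqn_q.
Qed.

Let qc (v : r.-tuple R) : 'cV[R]_K := (cubeb v)%:R *: q v.

Let mqc : mxmeas qc.
Proof. by apply: mxmeasZ; [exact: measurable_inbox|exact: measurable_q]. Qed.

Let sqn_qc v : sqn (qc v) <= Cb ^+ 2 * K%:R.
Proof.
rewrite /qc; case: (boolP (cubeb v)) => [/cubeP|_]; first by rewrite scale1r; exact: sqn_q.
by rewrite mulr0n scale0r sqn0 !mulr_ge0 ?(ltW Cb0).
Qed.

Let qc_ae : {ae F, forall u, qc (w u) = q (w u)}.
Proof. by apply: filterS cube_ae => u /cubeP h1; rewrite /qc h1 scale1r. Qed.

Let mw : measurable_fun setT w. Proof. by []. Qed.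

Lemma gram_qc : gram F w qc = expectation_mx F (fun u => q (w u) *m (q (w u))^T).
Proof.
apply/matrixP => i j; rewrite !mxE.
transitivity (mean F (fun u => (q (w u) *m (q (w u))^T) i j)); last by rewrite unlock.
have E u : (q (w u) *m (q (w u))^T) i j = q (w u) i 0 * q (w u) j 0.
  by rewrite mxE big_ord1 !mxE.
rewrite (eq_mean _ E); apply: mean_ae.
- by apply: measurable_funM; [exact: (measurableT_comp (mqc i 0) mw)|exact: (measurableT_comp (mqc j 0) mw)].
- by apply: measurable_funM; [exact: (measurableT_comp (measurable_q i 0) mw)|exact: (measurableT_comp (measurable_q j 0) mw)].
by apply: filterS qc_ae => u ->.
Qed.

Lemma gram_qc_pd u : ce * sqn u <= qform (gram F w qc) u.
Proof.
apply: le_trans (lambda_min_le u _); last exact: gram_sym.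
by rewrite ler_wpM2r ?sqn_ge0// gram_qc.
Qed.

(** A basis function that vanishes on the cube would give the second moment matrix a
    zero on the diagonal. *)
Lemma basis_nonzero l : exists2 v, cube v & q v l 0 != 0.
Proof.
apply: contrapT => hn.
have z v : qc v l 0 = 0.
  rewrite /qc mxE; case: (boolP (cubeb v)) => [/cubeP cv|]; last by rewrite mul0r.
  by apply/eqP; apply/negPn/negP => nz; apply: hn; exists v => //; move: nz; rewrite mul1r.
have := gram_qc_pd (delta_mx l 0); rewrite (qform_gram F mw mqc sqn_qc).
rewrite (@eq_mean _ _ _ _ _ (fun=> 0)); last first.
  move=> u; rewrite /dot (bigD1 l)//= z mul0r add0r big1 ?expr0n// => i il.
  by rewrite [delta_mx _ _ _ _]mxE (negbTE il) mulr0.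
rewrite mean_cst /sqn (bigD1 l)//= mxE !eqxx expr1n big1 ?addr0 ?mulr1; last first.
  by move=> i il; rewrite mxE (negbTE il) expr0n.
by rewrite leNgt ce0.
Qed.

Let mx := measurable_regressor.
Let mp := measurable_cutbasis.

(** Given [w], the factor [a ^ 2] may be replaced by its conditional mean, which is
    at least [ch]. *)
Lemma gram_cutbasis_pd u : ch * ce * sqn u <= qform (gram F x cutbasis) u.
Proof.
rewrite (qform_gram F mx mp sqn_cutbasis).
pose H v := dot (qc v) u ^+ 2.
have mH : measurable_fun setT H.
  by apply: measurable_funX; apply: measurable_dot => //; exact: mxmeas_cst.
have HM v : `|H v| <= Cb ^+ 2 * K%:R * sqn u.
  rewrite ger0_norm ?sqr_ge0//; apply: (le_trans (dot_sq_le _ _)).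
  by rewrite ler_wpM2r ?sqn_ge0//; exact: sqn_qc.
have IH : integ F (fun v => H (w v)).
  by apply: (@integ_bounded _ _ _ _ (Cb ^+ 2 * K%:R * sqn u)) => //; exact: measurableT_comp.
case: (h_cond) => Ia2 mh Ih _.
have IHa : integ F (fun v => H (w v) * a v ^+ 2).
  by apply: (integMb Ia2) => [|v]; [exact: (measurableT_comp mH mw)|exact: HM].
have IHh : integ F (fun v => H (w v) * h (w v)).
  by apply: (integMb Ih) => [|v]; [exact: (measurableT_comp mH mw)|exact: HM].
have -> : mean F (fun v => dot (cutbasis (x v)) u ^+ 2) = mean F (fun v => H (w v) * a v ^+ 2).
  apply: mean_ae; last 1 first.
  - apply: filterS2 cutbasis_ae qc_ae => v /= e1 e2.
    by rewrite e1 /H e2 dotZl exprMn mulrC.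
  - apply: measurable_funX; exact: (integ_meas (L2_integ (L2_dot F mx mp sqn_cutbasis u))).
  - exact: integ_meas IHa.
have eH := cond_mean_bounded mw h_cond mH HM.
have -> : mean F (fun v => H (w v) * a v ^+ 2) = mean F (fun v => H (w v) * h (w v)).
  apply/eqP; rewrite -subr_eq0 -meanB// -{}eH; apply/eqP; apply: eq_mean => v.
  by rewrite mulrBr.
apply: (@le_trans _ _ (ch * mean F (fun v => H (w v)))).
  rewrite -mulrA ler_wpM2l ?(ltW ch0)//; apply: (le_trans (gram_qc_pd u)).
  by rewrite (qform_gram F mw mqc sqn_qc).
rewrite -meanZ//; apply: le_mean_ae => //; first exact: integZ.
by apply: filterS h_ge => v hv; rewrite mulrC ler_wpM2l// sqr_ge0.
Qed.

Definition overlap_bound : nat := (kap.*2.+1 ^ r)%N.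

Lemma cutbasis_overlap : exists ov : rel 'I_K, [/\ symmetric ov,
  forall l, (#|ov l| <= overlap_bound)%N &
  forall l l' v, ~~ ov l l' -> cutbasis v l 0 * cutbasis v l' 0 = 0].
Proof.
have [ov [lo [hi [sym card ovE _ _]]]] := tensor_bspline_local cS0 r0 q_spline.
exists ov; split => // l l' v nov; rewrite /cutbasis !mxE /inrange.
case: (boolP (_ && _)) => [/andP[_ /cubeP cv]|_]; last by rewrite !mul0r.
by rewrite !mul1r mulrACA ovE// mulr0.
Qed.

Definition moment_const : R :=
  Ca ^+ 2 * Cb ^+ 2 * (Ca ^+ 2 * (Cb ^+ 2 * (Cf * (kap.+1%:R * (CS * (1 + kap%:R))) ^+ r))).

(** A basis function is of size [sqrt K] on a box of volume [1 / K], so its second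
    moment is bounded and its fourth moment is of order [K]. *)
Lemma cutbasis_moment k l :
  mean F (fun u => (cutbasis (x u) k 0 * cutbasis (x u) l 0) ^+ 2) <= moment_const * K%:R.
Proof.
have [ov [lo [hi [_ _ _ bx sup]]]] := tensor_bspline_local cS0 r0 q_spline.
pose b := Ca ^+ 2 * Cb ^+ 2 * K%:R.
have bE v i : cutbasis v i 0 ^+ 2 <= b by exact: (p_entry sqn_cutbasis).
pose B := [set v | inbox (lo k) (hi k) v].
have mB : measurable (w @^-1` B).
  rewrite -[X in measurable X]setTI; apply: (measurable_funPT w) => //.
  exact: measurable_box.
have pw u : (cutbasis (x u) k 0 * cutbasis (x u) l 0) ^+ 2 <=
    b * (Ca ^+ 2 * (Cb ^+ 2 * K%:R)) * \1_(w @^-1` B) u.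
  rewrite exprMn mulrC.
  have b0 : 0 <= b by rewrite /b !mulr_ge0 ?(ltW Ca0) ?(ltW Cb0).
  have [z|nz] := eqVneq (cutbasis (x u) k 0) 0.
    by rewrite z expr0n mulr0 mulr_ge0// !mulr_ge0 ?(ltW Ca0) ?(ltW Cb0).
  rewrite indicE mem_set ?mulr1.
    apply: ler_pM; rewrite ?sqr_ge0//.
    by rewrite mulrA; exact: bE.
  rewrite /B /=; apply/forallP; apply: sup.
  - by move: nz; rewrite /cutbasis mxE /inrange /=; case: (boolP (_ && _)) => [/andP[_ /cubeP]//|]; rewrite mul0r eqxx.
  - by move: nz; rewrite /cutbasis !mxE /= !mulf_eq0 !negb_or => /andP[_ /andP[]].
have mI : measurable_fun setT (\1_(w @^-1` B) : Z -> R) by exact: measurable_indic.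
have I1 : integ F (\1_(w @^-1` B)).
  by apply: (@integ_bounded _ _ _ _ 1) => // u; rewrite indicE; case: (_ \in _); rewrite ?normr1 ?normr0.
have mean1 : mean F (\1_(w @^-1` B)) = fine (F (w @^-1` B)).
  by rewrite /mean integral_indic// setIT.
have prodw : \prod_j (hi k j - lo k j) <= (kap.+1%:R * (CS * (1 + kap%:R))) ^+ r / K%:R.
  apply: (@le_trans _ _ (\prod_(j < r) (kap.+1%:R * (CS * (1 + kap%:R) * K%:R `^ (- r%:R^-1))))).
    by apply: ler_prod => j _; have [h1 h2 h3 h4] := bx k j; rewrite subr_ge0 h2.
  rewrite prodr_const card_ord mulrA exprMn.
  rewrite le_eqVlt; apply/orP; left; apply/eqP; congr (_ * _).
  rewrite -powR_mulrn ?powR_ge0// -powRrM mulNr mulVf ?pnatr_eq0 -?lt0n//.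
  by rewrite powR_inv1// ler0n.
have PB : fine (F (w @^-1` B)) <= Cf * ((kap.+1%:R * (CS * (1 + kap%:R))) ^+ r / K%:R).
  apply: (@le_trans _ _ (Cf * \prod_j (hi k j - lo k j))); last by rewrite ler_wpM2l.
  rewrite -lee_fin fineK ?fin_num_measure//; apply: box_prob => j; by case: (bx k j).
have Lp : integ F (fun u => (cutbasis (x u) k 0 * cutbasis (x u) l 0) ^+ 2).
  apply: (@integ_bounded _ _ _ _ (b ^+ 2)).
    by apply: measurable_funX; apply: measurable_funM; exact: (measurable_p mx mp).
  move=> u; rewrite ger0_norm ?sqr_ge0// -real_normK ?num_real// ler_pXn2r ?nnegrE//.
    exact: (p_entry2 sqn_cutbasis).
  by rewrite !mulr_ge0 ?(ltW Ca0) ?(ltW Cb0).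
apply: (le_trans (le_mean Lp (integZ _ I1) pw)).
rewrite meanZ// mean1.
apply: (@le_trans _ _ (b * (Ca ^+ 2 * (Cb ^+ 2 * K%:R)) * (Cf * ((kap.+1%:R * (CS * (1 + kap%:R))) ^+ r / K%:R)))).
  by rewrite ler_wpM2l// !mulr_ge0 ?(ltW Ca0) ?(ltW Cb0).
rewrite /moment_const /b le_eqVlt; apply/orP; left; apply/eqP.
by field; rewrite pnatr_eq0 -lt0n.
Qed.

Variables (g0 : X -> R) (gh : 'rV[R]_r -> R) (s : R) (Mg D : R) (e : 'cV[R]_K).
Hypothesis mg0 : measurable_fun setT g0.
Hypothesis g0E : {ae F, forall u, g0 (a u, w u) = a u * gh (tuple_row (w u))}.
Hypothesis gh_bound : forall v, cube v -> `|gh (tuple_row v)| <= Mg.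
Hypothesis Mg0 : 0 <= Mg.
Hypothesis D0 : 0 <= D.
Hypothesis gh_approx : forall v, cube v -> `|gh (tuple_row v) - dot (q v) e| <= D.

(** By [modify_near] with the approximating spline as reference. *)
Lemma cut_regression : exists gf : X -> R, [/\ measurable_fun setT gf,
  forall v, `|gf v - dot (cutbasis v) e| <= Ca * D,
  forall v, `|gf v| <= Ca * (Mg + 2 * D) &
  {ae F, forall u, gf (x u) = g0 (x u)}].
Proof.
have [||||gf [mgf gfe gfae]] := @modify_near _ _ _ _ _ F x g0 (fun v => dot (cutbasis v) e) (Ca * D).
- by rewrite mulr_ge0// ltW.
- exact: mg0.
- by apply: measurable_dot => //; exact: mxmeas_cst.
- apply: filterS2 g0E (filterI inrange_ae cutbasis_ae) => u /= -> [/andP[/= h1 /cubeP h2]] ->.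
  rewrite dotZl -mulrBr normrM; apply: ler_pM => //; exact: gh_approx.
exists gf; split => // v.
rewrite -[gf v](subrK (dot (cutbasis v) e)); apply: (le_trans (ler_normD _ _)).
have -> : Ca * (Mg + 2 * D) = Ca * D + Ca * (Mg + D) by ring.
apply: lerD => //; rewrite /cutbasis dotZl /inrange.
case: (boolP (_ && _)) => [/andP[h1 /cubeP h2]|_]; last first.
  by rewrite mul0r normr0 mulr_ge0 ?addr_ge0// ltW.
rewrite mul1r dotZl normrM; apply: ler_pM => //.
have -> : dot (q v.2) e = gh (tuple_row v.2) - (gh (tuple_row v.2) - dot (q v.2) e) by ring.
by apply: (le_trans (ler_normB _ _)); apply: lerD; [exact: gh_bound|exact: gh_approx].
Qed.

End spline_regressors.

(** * The expansion at a fixed sample size *)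

Lemma Lnorm2_le {R : realType} d (T : measurableType d) (mu : probability T R)
    (f : T -> R) (C : R) : measurable_fun setT f -> ('N[mu]_2%:E [EFin \o f] <= C%:E)%E ->
  [/\ 0 <= C, L2 mu f & mean mu (fun u => f u ^+ 2) <= C ^+ 2].
Proof.
move=> mf fC; have C0 : 0 <= C by rewrite -lee_fin (le_trans _ fC)// Lnorm_ge0.
have I2 : (\int[mu]_u (f u ^+ 2)%:E <= (C ^+ 2)%:E)%E.
  have -> : (\int[mu]_u (f u ^+ 2)%:E = 'N[mu]_2%:E [EFin \o f] `^ 2)%E.
    rewrite powR_Lnorm//; apply: eq_integral => u _ /=.
    by rewrite powR_mulrn// real_normK// num_real.
  have -> : (C ^+ 2)%:E = (C%:E `^ 2)%E by rewrite poweR_EFin powR_mulrn.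
  by apply: gt0_ler_poweR => //; rewrite in_itv /= leey andbT ?lee_fin ?Lnorm_ge0.
have I : integ mu (fun u => f u ^+ 2).
  apply/integrableP; split; first by apply/measurable_EFinP; exact: measurable_funX.
  apply: (@le_lt_trans _ _ (C ^+ 2)%:E); last exact: ltry.
  apply: le_trans I2; rewrite le_eqVlt; apply/orP; left; apply/eqP.
  by apply: eq_integral => u _ /=; rewrite ger0_norm// sqr_ge0.
by split => //; rewrite -lee_fin -meanE.
Qed.

Section plug_in.
Context {R : realType} dZ dX (Z : measurableType dZ) (X : measurableType dX).
Variables (F : probability Z R) (x : Z -> X).
Hypothesis mx : measurable_fun setT x.

Lemma sq_integrableP (g : X -> R) :
  sq_integrable F x g <-> measurable_fun setT g /\ L2 F (g \o x).
Proof.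
split=> -[mg Lg]; split=> //; last by case: Lg.
by split => //; exact: measurableT_comp.
Qed.

Variable m : Z -> (X -> R) -> R.
Hypothesis m_affine : forall u (c : R) (g1 g2 : X -> R),
  sq_integrable F x g1 -> sq_integrable F x g2 ->
  m u (fun v => c * g1 v + g2 v) - m u (fun=> 0) =
  c * (m u g1 - m u (fun=> 0)) + (m u g2 - m u (fun=> 0)).
Variables (K : nat) (p : X -> 'cV[R]_K).
Hypothesis p_sq : forall k, sq_integrable F x (fun v => p v k 0).

Lemma sq_integrable_span (s : seq 'I_K) (e : 'cV[R]_K) :
  sq_integrable F x (fun v => \sum_(k <- s) e k 0 * p v k 0).
Proof.
apply/sq_integrableP; split.
  apply: measurable_sum => k; apply: measurable_funM => //; exact: (proj1 (p_sq k)).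
apply: (@L2_sum _ _ _ F _ s xpredT (fun k u => e k 0 * p (x u) k 0)) => k _.
by apply: L2Z; case/sq_integrableP: (p_sq k).
Qed.

Lemma series_funE e : series_fun p e = fun v => \sum_k e k 0 * p v k 0.
Proof.
by apply/funext => v; rewrite /series_fun dotE; apply: eq_bigr => k _; rewrite mulrC.
Qed.

Lemma sq_integrable_series e : sq_integrable F x (series_fun p e).
Proof. by rewrite series_funE; exact: sq_integrable_span. Qed.

(** The functional is linear up to its value at zero, and [series_fun p e] is a
    combination of the basis functions. *)
Lemma m_series u e : m u (series_fun p e) - m u (fun=> 0) = dot (m_basis m p u) e.
Proof.
rewrite series_funE /dot; elim: (index_enum _) => [|k s IH].
  by under eq_fun do rewrite big_nil; rewrite big_nil subrr.
under eq_fun do rewrite big_cons.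
rewrite m_affine//; last exact: sq_integrable_span.
by rewrite IH big_cons /m_basis mxE mulrC.
Qed.

Variables (y : Z -> R) (gam0 alp0 : X -> R).
Hypothesis my : measurable_fun setT y.
Hypothesis gam0E : is_cond_mean F y x gam0.
Hypothesis alp0_meas : measurable_fun setT alp0.
Hypothesis alp0E : forall g : X -> R, sq_integrable F x g ->
  F.-integrable setT (EFin \o (fun u => m u g - m u (fun=> 0))) /\
  ('E_F[fun u => (m u g - m u (fun=> 0))%R] = 'E_F[fun u => (alp0 (x u) * g (x u))%R])%E.

Variables (pc : X -> 'cV[R]_K) (b c : R).
Hypothesis mp : mxmeas p.
Hypothesis mpc : mxmeas pc.
Hypothesis b0 : 0 < b.
Hypothesis pcb : forall v, sqn (pc v) <= b.
Hypothesis pc_ae : {ae F, forall u, pc (x u) = p (x u)}.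
Hypothesis c0 : 0 < c.
Hypothesis gram_pd : forall u, c * sqn u <= qform (gram F x pc) u.
Variables (ov : rel 'I_K) (N : nat).
Hypothesis N0 : (0 < N)%N.
Hypothesis ov_sym : symmetric ov.
Hypothesis ov_card : forall l, (#|ov l| <= N)%N.
Hypothesis ovE : forall l l' v, ~~ ov l l' -> pc v l 0 * pc v l' 0 = 0.
Variables (gf af : X -> R) (eg ea : 'cV[R]_K) (dg dal Ma : R).
Hypothesis mgf : measurable_fun setT gf.
Hypothesis gfE : forall v, `|gf v - dot (pc v) eg| <= dg.
Hypothesis gf_ae : {ae F, forall u, gf (x u) = gam0 (x u)}.
Hypothesis dg0 : 0 < dg.
Hypothesis maf : measurable_fun setT af.
Hypothesis afE : forall v, `|af v - dot (pc v) ea| <= dal.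
Hypothesis af_ae : {ae F, forall u, af (x u) = alp0 (x u)}.
Hypothesis dal0 : 0 < dal.
Hypothesis Ma0 : 0 < Ma.
Hypothesis af_le : forall v, `|af v| <= Ma.
Hypothesis K0 : (0 < K)%N.
Variables (Dv rm s2 : R) (hy : X -> R).
Hypothesis v_sq : forall i j : 'I_K, F.-integrable setT
  (EFin \o (fun u => m_basis m p u i 0 * m_basis m p u j 0)).
Hypothesis v_eigen : lambda_max (expectation_mx F
  (fun u => m_basis m p u *m (m_basis m p u)^T)) <= Dv.
Hypothesis m_approx : ('N[F]_2%:E [EFin \o (fun u =>
  (m u (population_fit F x p gam0) - m u gam0)%R)] <= rm%:E)%E.
Hypothesis y_var : is_cond_mean F (fun u => (y u - gam0 (x u)) ^+ 2) x hy.
Hypothesis hy_le : {ae F, forall u, hy (x u) <= s2}.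
Hypothesis s20 : 0 <= s2.
Hypothesis gam0_sq : sq_integrable F x gam0.

Local Notation d0 := (proj_coef F x pc gf).
Local Notation da := (proj_coef F x pc af).
Definition noise u : R := y u - gam0 (x u).
Definition bias v : R := gf v - dot (pc v) d0.
Definition m_bias u : R := m u (population_fit F x p gam0) - m u gam0.
Local Notation v := (m_basis m p).

Let lin u g := m u g - m u (fun=> 0).

Let mgam0 : measurable_fun setT gam0. Proof. by case: gam0E. Qed.

Let meanfE (f : Z -> R) : fine ('E_F[f])%E = mean F f.
Proof. by rewrite unlock. Qed.

Let p_mul_mean (f g : Z -> R) k : measurable_fun setT f -> measurable_fun setT g ->
  {ae F, forall u, g u = f u} ->
  mean F (fun u => f u * p (x u) k 0) = mean F (fun u => g u * pc (x u) k 0).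
Proof.
move=> mf mg fg; apply: mean_ae.
- by apply: measurable_funM => //; exact: (measurableT_comp (mp k 0) mx).
- by apply: measurable_funM => //; exact: (measurableT_comp (mpc k 0) mx).
by apply: filterS2 fg pc_ae => u -> ->.
Qed.

Lemma population_fitE : population_fit F x p gam0 = series_fun p d0.
Proof.
rewrite /population_fit; congr (series_fun p _); rewrite /proj_coef; congr (invmx _ *m _).
  apply/matrixP => i j; rewrite !mxE meanfE.
  rewrite -(@p_mul_mean (fun u => p (x u) i 0) (fun u => pc (x u) i 0)).
  - by apply: eq_mean => u; rewrite mxE big_ord1 !mxE.
  - exact: (measurableT_comp (mp i 0) mx).
  - exact: (measurableT_comp (mpc i 0) mx).
  - by apply: filterS pc_ae => u ->.
apply/matrixP => i j; rewrite !mxE meanfE ord1.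
rewrite -(@p_mul_mean (gam0 \o x) (gf \o x)).
- by apply: eq_mean => u; rewrite mxE.
- exact: measurableT_comp.
- exact: measurableT_comp.
- exact: gf_ae.
Qed.

Let lin_integ g : sq_integrable F x g -> integ F (fun u => lin u g).
Proof. by move=> /alp0E[]. Qed.

Let lin_mean g : sq_integrable F x g -> mean F (fun u => lin u g) = mean F (fun u => af (x u) * g (x u)).
Proof.
move=> sg; have [_ e] := alp0E sg; rewrite -meanfE e meanfE; apply: mean_ae.
- by apply: measurable_funM; apply: measurableT_comp => //; case: sg.
- by apply: measurable_funM; apply: measurableT_comp => //; case: sg.
by apply: filterS af_ae => u ->.
Qed.

Lemma L2_v k : L2 F (fun u => v u k 0).
Proof.
split; last by have := v_sq k k; congr integrable; apply/funext => u /=; rewrite expr2.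
have := integ_meas (lin_integ (p_sq k)); congr measurable_fun.
by apply/funext => u; rewrite mxE.
Qed.

Lemma mean_v k : mean F (fun u => v u k 0) = (gram F x pc *m da) k 0.
Proof.
rewrite (gram_proj_coef c0 gram_pd).
rewrite (@eq_mean _ _ _ _ _ (fun u => lin u (fun v => p v k 0))); last by move=> u; rewrite mxE.
rewrite lin_mean// ; apply: (@p_mul_mean (af \o x) (af \o x)); first exact: measurableT_comp.
  exact: measurableT_comp.
by apply: aeW.
Qed.

Lemma v_moment e : mean F (fun u => dot (v u) e ^+ 2) <= Dv * sqn e.
Proof.
set M := expectation_mx F (fun u => v u *m (v u)^T).
have ME i j : M i j = mean F (fun u => v u i 0 * v u j 0).
  by rewrite mxE meanfE; apply: eq_mean => u; rewrite mxE big_ord1 !mxE.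
have symM : M^T = M.
  by apply/matrixP => i j; rewrite mxE !ME; apply: eq_mean => u; rewrite mulrC.
have -> : mean F (fun u => dot (v u) e ^+ 2) = qform M e.
  rewrite qformE (@eq_mean _ _ _ _ _ (fun u => \sum_i \sum_j (e i 0 * e j 0) * (v u i 0 * v u j 0))); last first.
    move=> u; rewrite expr2 /dot mulr_suml; apply: eq_bigr => i _.
    by rewrite mulr_sumr; apply: eq_bigr => j _; ring.
  rewrite mean_sum; last first.
    by move=> i _; apply: integ_sum => j _; apply: integZ; exact: v_sq.
  apply: eq_bigr => i _; rewrite mean_sum; last by move=> j _; apply: integZ; exact: v_sq.
  by apply: eq_bigr => j _; rewrite meanZ ?ME 1?mulrC//; exact: v_sq.
apply: (le_trans (lambda_max_ge _ symM)).
by rewrite ler_wpM2r ?sqn_ge0.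
Qed.

Lemma Dv_ge0 : 0 <= Dv.
Proof.
have := v_moment (delta_mx (Ordinal K0) 0).
have -> : sqn (delta_mx (Ordinal K0) 0 : 'cV[R]_K) = 1.
  rewrite /sqn (bigD1 (Ordinal K0))//= mxE !eqxx expr1n big1 ?addr0// => i il.
  by rewrite mxE (negbTE il) expr0n.
by rewrite mulr1; apply: le_trans; apply: mean_ge0 => u; exact: sqr_ge0.
Qed.

Lemma m_bias_lin u : m_bias u = lin u (series_fun p d0) - lin u gam0.
Proof. by rewrite /m_bias population_fitE /lin; ring. Qed.

Let m_bias_integ : integ F m_bias.
Proof.
apply: (@eq_integ _ _ _ _ (fun u => lin u (series_fun p d0) - lin u gam0)).
  by move=> u; rewrite m_bias_lin.
by apply: integB; apply: lin_integ => //; exact: sq_integrable_series.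
Qed.

Lemma m_bias_norm : [/\ 0 <= rm, L2 F m_bias & mean F (fun u => m_bias u ^+ 2) <= rm ^+ 2].
Proof. exact: (Lnorm2_le (integ_meas m_bias_integ) m_approx). Qed.

Local Notation projE := (proj_error mx mpc pcb c0 gram_pd).
Local Notation projO := (proj_orthogonal mx mpc pcb c0 gram_pd).

Let L2bias : L2 F (fun u => bias (x u)).
Proof. by apply: L2B; [exact: (L2_near F mx mpc pcb mgf gfE)|exact: (L2_dot F mx mpc pcb)]. Qed.

Let L2alpha : L2 F (fun u => dot (pc (x u)) da - af (x u)).
Proof. by apply: L2B; [exact: (L2_dot F mx mpc pcb)|exact: (L2_near F mx mpc pcb maf afE)]. Qed.

Let mean_alpha : mean F (fun u => (dot (pc (x u)) da - af (x u)) ^+ 2) <= dal ^+ 2.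
Proof.
apply: le_trans (projE maf afE); rewrite le_eqVlt; apply/orP; left; apply/eqP.
by apply: eq_mean => u; rewrite -sqrrN opprB.
Qed.

(** The approximation errors of [gam0] and [alp0] enter the mean of the bias as a
    product, by orthogonality of the projections. *)
Lemma mean_m_bias : `|mean F m_bias| <= dal * dg.
Proof.
have E : mean F m_bias = mean F (fun u => (dot (pc (x u)) da - af (x u)) * bias (x u)).
  transitivity (mean F (fun u => lin u (series_fun p d0)) - mean F (fun u => lin u gam0)).
    rewrite -meanB; [|apply: lin_integ; exact: sq_integrable_series|exact: lin_integ].
    by apply: eq_mean => u; rewrite m_bias_lin.
  rewrite !lin_mean//; last exact: sq_integrable_series.
  have Laf := L2_near F mx mpc pcb maf afE.
  have -> : mean F (fun u => af (x u) * series_fun p d0 (x u)) = mean F (fun u => af (x u) * dot (pc (x u)) d0).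
    apply: mean_ae.
    - by apply: measurable_funM; apply: measurableT_comp => //; case: (sq_integrable_series d0).
    - apply: measurable_funM; first exact: measurableT_comp.
      by case: (L2_dot F mx mpc pcb d0).
    by apply: filterS pc_ae => u ->; rewrite /series_fun dotE.
  have -> : mean F (fun u => af (x u) * gam0 (x u)) = mean F (fun u => af (x u) * gf (x u)).
    apply: mean_ae.
    - by apply: measurable_funM; exact: measurableT_comp.
    - by apply: measurable_funM; exact: measurableT_comp.
    by apply: filterS gf_ae => u ->.
  have I1 : integ F (fun u => af (x u) * dot (pc (x u)) d0) := L2M Laf (L2_dot F mx mpc pcb d0).
  have I2 : integ F (fun u => af (x u) * gf (x u)) := L2M Laf (L2_near F mx mpc pcb mgf gfE).
  have I3 : integ F (fun u => dot (pc (x u)) da * bias (x u)).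
    by apply: L2M => //; exact: (L2_dot F mx mpc pcb).
  have I4 : integ F (fun u => af (x u) * bias (x u)) by exact: L2M.
  rewrite (@eq_mean _ _ _ _ (fun u => (dot (pc (x u)) da - af (x u)) * bias (x u))
    (fun u => dot (pc (x u)) da * bias (x u) - af (x u) * bias (x u))); last first.
    by move=> u; rewrite mulrBl.
  rewrite meanB//.
  have -> : mean F (fun u => dot (pc (x u)) da * bias (x u)) = 0.
    rewrite -(proj_orthogonal_dot mx mpc pcb c0 gram_pd mgf gfE da).
    by apply: eq_mean => u; rewrite mulrC.
  rewrite sub0r -meanB// -meanN; last exact: I4.
  by apply: eq_mean => u; rewrite /bias; ring.
rewrite E; apply: le_trans (norm_mean _) _; first exact: L2M.
by apply: mean_prod_le => //; exact: (projE mgf gfE).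
Qed.

Let y_sq_integ : integ F (fun u => noise u ^+ 2). Proof. by case: y_var. Qed.

Lemma L2_noise : L2 F noise.
Proof. by split => //; apply: measurable_funB => //; exact: measurableT_comp. Qed.

Lemma noise_orthogonal (H : X -> R) M : measurable_fun setT H -> (forall w, `|H w| <= M) ->
  mean F (fun u => H (x u) * noise u) = 0.
Proof. move=> mH HM; exact: (cond_mean_bounded mx gam0E mH HM). Qed.

Lemma noise_variance (H : X -> R) M : measurable_fun setT H -> (forall w, 0 <= H w <= M) ->
  mean F (fun u => H (x u) * noise u ^+ 2) <= s2 * mean F (fun u => H (x u)).
Proof.
move=> mH HM; have Hn w : `|H w| <= M by case/andP: (HM w) => h1 h2; rewrite ger0_norm.
have mHx : measurable_fun setT (fun u => H (x u)) by exact: measurableT_comp.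
have IH : integ F (fun u => H (x u)) by apply: (@integ_bounded _ _ _ _ M).
case: (y_var) => Iy mh Ih _.
have I1 : integ F (fun u => H (x u) * noise u ^+ 2) by apply: (integMb Iy).
have I2 : integ F (fun u => H (x u) * hy (x u)) by apply: (integMb Ih).
have e := cond_mean_bounded mx y_var mH Hn.
have -> : mean F (fun u => H (x u) * noise u ^+ 2) = mean F (fun u => H (x u) * hy (x u)).
  apply/eqP; rewrite -subr_eq0 -meanB// -{}e; apply/eqP; apply: eq_mean => u.
  by rewrite mulrBr.
rewrite -meanZ//; apply: le_mean_ae => //; first exact: integZ.
apply: filterS hy_le => u hu; rewrite mulrC ler_wpM2r//.
by case/andP: (HM (x u)).
Qed.

Lemma bias_le w : `|bias w| <= dg * (1 + Num.sqrt (b / c)).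
Proof. exact: (proj_sup_error mx mpc pcb c0 gram_pd mgf gfE). Qed.

Lemma alpha_le w : `|dot (pc w) da - af w| <= dal * (1 + Num.sqrt (b / c)).
Proof. by rewrite distrC; exact: (proj_sup_error mx mpc pcb c0 gram_pd maf afE). Qed.

Lemma alpha_norm : mean F (fun u => dot (pc (x u)) da ^+ 2) <= Ma ^+ 2.
Proof.
apply: (le_trans (proj_contract mx mpc pcb c0 gram_pd maf afE)).
rewrite -[leRHS](mean_cst F); apply: le_mean; last 2 first.
- exact: integ_cst.
- move=> u; rewrite -[leLHS]real_normK ?num_real// ler_pXn2r ?nnegrE// ltW//.
- by case: (L2_near F mx mpc pcb maf afE).
Qed.

Variables (n : nat) (mu : probability (n.-tuple Z) R).
Hypothesis muF : iid_law F mu.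
Hypothesis n0 : (0 < n)%N.
Variables (L : nat) (grp : 'I_n -> 'I_L) (cf : R).
Hypothesis cf0 : 0 < cf.
Hypothesis large : forall l, cf * n%:R <= #|~: fold grp l|%:R.
Hypothesis balanced : forall l l', (#|fold grp l| <= #|fold grp l'| + 1)%N.
Local Notation train l := (~: fold grp l).
Local Notation xs := (xsample x).
(** Entries within [tol] keep the smallest eigenvalue above [c / 2] when each row has
    at most [N] nonzero entries. *)
Definition tol : R := c / (2 * N%:R).
Local Notation goodl l := (good F x pc (train l) tol).

Let NR0 : 0 < N%:R :> R. Proof. by rewrite ltr0n. Qed.

(** Only boundedly many splines overlap with a given one, so a uniform bound on the
    entries of the deviation of the sample second moments bounds its eigenvalues. *)
Lemma good_gramhat l xi : goodl l xi -> forall u,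
  c / 2 * sqn u <= qform (gramhat pc (train l) xi) u.
Proof.
move=> g u; have tr0 : (0 < #|train l|)%N by exact: trainset_gt0 cf0 n0 large l.
have gE i j : `|dev F x pc (train l) xi i j| <= tol.
  by move/forallP: g => /(_ i)/forallP/(_ j).
have gz i j : ~~ ov i j -> dev F x pc (train l) xi i j = 0.
  move=> nij; rewrite /dev /gramhat /sample_gram /gram !mxE.
  rewrite (@eq_mean _ _ _ _ _ (fun=> 0)) ?mean_cst ?subr0; last by move=> u'; rewrite ovE.
  rewrite summxE big1 ?mulr0// => k _; rewrite mxE big_ord1 !mxE; exact: ovE.
have t0 : 0 <= tol by rewrite /tol divr_ge0 ?mulr_ge0// ltW.
have := sparse_qform_le u t0 ov_sym ov_card gE gz.
have -> : N%:R * tol = c / 2 by rewrite /tol; field; rewrite gt_eqF.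
have -> : dev F x pc (train l) xi = gramhat pc (train l) xi - gram F x pc by [].
rewrite qformB ler_norml => /andP[h _].
have := gram_pd u; lra.
Qed.

Local Notation rem_o := (remainder x pc grp noise (fun u => bias (x u)) (fun u => af (x u)) m_bias v).

(** On the good event the generalized inverse is the inverse, so the estimated
    coefficients differ from those of the projection by [coefdev] of the noise plus
    the approximation error; the rest is linearity of the functional. *)
Lemma plug_in_remainder o (beta0 : R) (G : 'I_L -> 'M[R]_K) :
  (forall i, [/\ pc (x (tnth o i)) = p (x (tnth o i)), gf (x (tnth o i)) = gam0 (x (tnth o i)) &
    af (x (tnth o i)) = alp0 (x (tnth o i))]) ->
  (forall l, goodl l (xs o)) ->
  (forall l, generalized_inverse (sample_gram p (xs o) (train l)) (G l)) ->
  Num.sqrt n%:R * (cross_fit_plugin m (tnth o) grp (fun l =>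
     series_fun p (G l *m sample_cross p (xs o) (fun i => y (tnth o i)) (train l))) - beta0)
  - (Num.sqrt n%:R)^-1 * \sum_(i < n) (m (tnth o i) gam0 - beta0 +
      alp0 (x (tnth o i)) * (y (tnth o i) - gam0 (x (tnth o i)))) = rem_o o.
Proof.
move=> oE g Ginv.
have n0' : 0 < n%:R :> R by rewrite ltr0n.
have sn0 : 0 < Num.sqrt n%:R :> R by rewrite sqrtr_gt0.
have c20 : 0 < c / 2 by rewrite divr_gt0.
pose dh l := G l *m sample_cross p (xs o) (fun i => y (tnth o i)) (train l).
have dhE l : dh l - d0 = coefdev x pc (train l) (fun u => noise u + bias (x u)) o.
  have Sg : sample_gram p (xs o) (train l) = gramhat pc (train l) (xs o).
    rewrite /gramhat /sample_gram; congr (_ *: _); apply: eq_bigr => i _.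
    by rewrite /xsample; case: (oE i) => ->.
  have gu : gramhat pc (train l) (xs o) \in unitmx.
    exact: (good_unit c20 (@good_gramhat l) (g l)).
  have GE : G l = invmx (gramhat pc (train l) (xs o)).
    by apply: generalized_inverse_unit => //; rewrite -Sg; exact: Ginv.
  rewrite /coefdev adjinvE// /dh GE.
  rewrite -{1}[d0](mulKmx gu) -mulmxBr; congr (_ *m _).
  rewrite /gramhat /sample_gram /pavg /sample_cross -scalemxAl -scalerBr; congr (_ *: _).
  rewrite mulmx_suml -sumrB; apply: eq_bigr => i _.
  rewrite -mulmxA /xsample; case: (oE i) => -> e _.
  have -> : (p (x (tnth o i)))^T *m d0 = (dot (p (x (tnth o i))) d0)%:M.
    by rewrite -dotE -mx11_scalar.
  rewrite mul_mx_scalar -scalerBl /noise /bias e; congr (_ *: _).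
  by case: (oE i) => -> _ _; ring.
have mE u l : m u (series_fun p (dh l)) = m u gam0 + (dot (v u) (dh l - d0) + m_bias u).
  have h := m_series u (dh l); have h0 := m_series u d0.
  rewrite m_bias_lin /lin h0 dotBr -h; ring.
have S1 : \sum_(l < L) \sum_(i in fold grp l) m (tnth o i) (series_fun p (dh l)) =
   \sum_i m (tnth o i) gam0 + \sum_l \sum_(i in fold grp l)
      (dot (v (tnth o i)) (coefdev x pc (train l) (fun u => noise u + bias (x u)) o) + m_bias (tnth o i)).
  have -> : \sum_i m (tnth o i) gam0 = \sum_(l < L) \sum_(i in fold grp l) m (tnth o i) gam0.
    rewrite (partition_big grp xpredT)//=; apply: eq_bigr => l _.
    by apply: eq_bigl => i; rewrite inE.
  rewrite -big_split; apply: eq_bigr => l _; rewrite -big_split; apply: eq_bigr => i _.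
  by rewrite mE dhE.
rewrite /cross_fit_plugin S1 /remainder.
have -> : \sum_(i < n) (m (tnth o i) gam0 - beta0 +
      alp0 (x (tnth o i)) * (y (tnth o i) - gam0 (x (tnth o i)))) =
  \sum_i m (tnth o i) gam0 - n%:R * beta0 + \sum_i af (x (tnth o i)) * noise (tnth o i).
  rewrite big_split /= sumrB sumr_const card_ord -[beta0 *+ n]mulr_natl; congr (_ + _).
  by apply: eq_bigr => i _; case: (oE i) => _ _ ->.
set A := \sum_i m _ _; set B := \sum_l _; set C := \sum_i _.
move: sn0 (sqr_sqrtr (ltW n0')); set s := Num.sqrt _ => s0 <-.
by field; rewrite gt_eqF.
Qed.

(** The null set is where the cut off basis and the modified regression functions
    differ from the original ones. *)
Lemma plug_in_expansion : exists N1 : set Z, [/\ measurable N1, F N1 = 0 &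
  exists Q : n.-tuple Z -> R, [/\ integ mu Q, forall o, 0 <= Q o,
    mean mu Q <= remainder_bound n b L cf (c / 2) s2 Ma Ma (dal * (1 + Num.sqrt (b / c)))
      dg dal rm (dal * dg) Dv &
  forall o (beta0 : R) (G : 'I_L -> 'M[R]_K), (forall i, ~ N1 (tnth o i)) ->
  (forall l, goodl l (xs o)) ->
  (forall l, generalized_inverse (sample_gram p (xs o) (train l)) (G l)) ->
  `|Num.sqrt n%:R * (cross_fit_plugin m (tnth o) grp (fun l =>
     series_fun p (G l *m sample_cross p (xs o) (fun i => y (tnth o i)) (train l))) - beta0)
  - (Num.sqrt n%:R)^-1 * \sum_(i < n) (m (tnth o i) gam0 - beta0 +
      alp0 (x (tnth o i)) * (y (tnth o i) - gam0 (x (tnth o i))))| <= Q o]].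
Proof.
have [N1 [mN1 FN1 sub]] := filterI pc_ae (filterI gf_ae af_ae).
exists N1; split => //.
have c20 : 0 < c / 2 by rewrite divr_gt0.
have [rm0 Lm m2] := m_bias_norm.
have mbias : measurable_fun setT bias.
  by apply: measurable_funB => //; apply: measurable_dot => //; exact: mxmeas_cst.
have [Q [IQ Q0 MQ QE]] := remainder_dominated mx muF n0 mpc b0 pcb cf0 large balanced c20 good_gramhat
  L2_noise noise_orthogonal noise_variance s20 maf (fun u => erefl (af (x u))) mbias
  (fun u => erefl (bias (x u))) af_le alpha_le bias_le (projO mgf gfE) dg0 (projE mgf gfE) Ma0
  alpha_norm (ltW dal0) mean_alpha Lm rm0 m2 mean_m_bias L2_v mean_v Dv_ge0 v_moment.
exists Q; split => // o beta0 G oN g Ginv.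
rewrite plug_in_remainder//; first exact: QE.
move=> i; have := oN i; apply: contra_notP => h; apply: sub => /= -[h1 [h2 h3]].
exact: h.
Qed.

(** The parameter of the exponential moment is [eta / K], since products of two basis
    functions are of order [K] and so are their second moments. *)
Lemma not_good_prob (vv eta : R) : 0 < eta -> eta * (2 * b) <= 2^-1 * K%:R ->
  (forall k l, mean F (fun u => (pc (x u) k 0 * pc (x u) l 0) ^+ 2) <= vv * K%:R) ->
  2 * eta * vv <= tol / 2 ->
  measurable [set o | exists l, ~~ goodl l (xs o)] /\
  (mu [set o | exists l, ~~ goodl l (xs o)] <=
    (L%:R * ((K * K)%:R * (2 * expR (- (cf * eta * tol / 2) * (n%:R / K%:R)))))%:E)%E.
Proof.
move=> eta0 etab hv etav.
have KR0 : 0 < K%:R :> R by rewrite ltr0n.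
have t0 : 0 < tol by rewrite /tol divr_gt0 ?mulr_gt0.
have one l : (mu [set o | ~~ goodl l (xs o)] <=
    ((K * K)%:R * (2 * expR (- (cf * eta * tol / 2) * (n%:R / K%:R))))%:E)%E.
  have tr0 : (0 < #|train l|)%N by exact: trainset_gt0 cf0 n0 large l.
  apply: (le_trans (@good_prob _ _ _ _ _ F x mx n mu muF K pc b mpc pcb (train l) tr0 tol (eta / K%:R) (vv * K%:R) _ _ hv)).
  - by rewrite divr_gt0.
  - by rewrite mulrAC ler_pdivrMr.
  rewrite lee_fin ler_wpM2l// ler_wpM2l// ler_expR.
  have e1 : 2 * (eta / K%:R) ^+ 2 * (vv * K%:R) - eta / K%:R * tol <= - (eta * tol / 2 / K%:R).
    have -> : 2 * (eta / K%:R) ^+ 2 * (vv * K%:R) - eta / K%:R * tol =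
      (eta / K%:R) * (2 * eta * vv - tol) by field; rewrite gt_eqF.
    have -> : - (eta * tol / 2 / K%:R) = (eta / K%:R) * (- (tol / 2)) by field; rewrite gt_eqF.
    by rewrite ler_wpM2l ?divr_ge0 ?(ltW eta0)//; lra.
  apply: (le_trans (ler_wpM2l _ e1)) => //.
  have -> : - (cf * eta * tol / 2) * (n%:R / K%:R) = (cf * n%:R) * (- (eta * tol / 2 / K%:R)) by ring.
  by rewrite ler_wnM2r// oppr_le0 !divr_ge0// mulr_ge0// ltW.
have mg l : measurable [set o | ~~ goodl l (xs o)].
  have mgl : measurable_fun setT (fun o => (goodl l (xs o))%:R : R).
    by apply: measurable_good => //; exact: measurable_xsample.
  rewrite [X in measurable X](_ : _ = setT `&` (fun o => (goodl l (xs o))%:R : R) @^-1` [set 0]).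
    by apply: mgl => //; exact: measurable_set1.
  apply/seteqP; split => o /=; first by move=> /negbTE ->.
  by case: (good _ _ _ _ _ _) => // -[_] /eqP; rewrite oner_eq0.
by have := prob_exists_le mg one; rewrite card_ord.
Qed.

End plug_in.

(** * Rates *)

Section rates.
Context {R : realType}.

Lemma zeta_ge0 k r (s : R) : 0 < s -> 0 <= zeta k r s.
Proof. by move=> s0; rewrite /zeta divr_ge0// le_min addr_ge0//= ltW. Qed.

Lemma powRN_le1 (k : nat) (s : R) : (0 < k)%N -> 0 <= s -> 0 < (k%:R `^ (- s) : R) <= 1.
Proof.
move=> k0 s0; rewrite powR_gt0 ?ltr0n//= -[leRHS](powRr0 k%:R).
by rewrite ler_powR ?oppr_le0// ler1n.
Qed.

Lemma ln_nat_ge1 (k : nat) : (4 <= k)%N -> 1 <= ln k%:R :> R.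
Proof.
move=> k4; rewrite -ler_expR lnK ?posrE ?ltr0n; last by apply: leq_trans k4.
apply: (@le_trans _ _ 4); last by rewrite (ler_nat _ 4).
have h : expR 2^-1 <= 2 :> R by apply: (le_trans (expR_le_quadratic (lexx _))); lra.
have -> : expR 1 = expR 2^-1 * expR 2^-1 :> R by rewrite -expRD; congr expR; lra.
have := expR_ge0 (2^-1 : R); nra.
Qed.

(** Each summand is a multiple of one term of the rate. The bound [1 <= ln K] absorbs
    the effect of the second moments on the approximation error into [Delta_bar],
    and [K <= n] absorbs the sup norm error of [alpha_K], of order
    [sqrt K * K ^ (- za)], into the first term of [Delta_star]. *)
Lemma remainder_bound_rate (L : nat) (cf c c' s2 Ma Cb Dg Da Cm Cd : R) :
  0 < cf -> 0 < c -> 0 < c' -> 0 <= s2 -> 0 < Ma -> 0 < Cb -> 0 < Dg -> 0 < Da -> 0 < Cd ->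
  exists2 C : R, 0 < C & forall (zg za zm : R) (K : nat -> nat) (dK : nat -> R) (n : nat),
    0 <= zg -> 0 <= za -> 0 <= Cm * (K n)%:R `^ (- zm) -> 0 <= Cd * dK (K n) ->
    (4 <= K n)%N -> (K n <= n)%N ->
    remainder_bound n (Cb * (K n)%:R) L cf c s2 Ma Ma
      (Da * (K n)%:R `^ (- za) * (1 + Num.sqrt (Cb * (K n)%:R / c'))) (Dg * (K n)%:R `^ (- zg))
      (Da * (K n)%:R `^ (- za)) (Cm * (K n)%:R `^ (- zm))
      (Da * (K n)%:R `^ (- za) * (Dg * (K n)%:R `^ (- zg))) (Cd * dK (K n)) <=
    C * (Delta_star zg za K n + Delta_m zm dK K n + Delta_bar zg K n).
Proof.
move=> cf0 c0 c'0 s20 Ma0 Cb0 Dg0 Da0 Cd0.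
pose k2 := Num.sqrt (Cd * (Cb * (2 * s2 + 2 * Dg ^+ 2) / cf / c ^+ 2)).
pose k3 := Num.sqrt (s2 * (Cb * Ma ^+ 2 / c / cf ^+ 2)).
pose k4 := Ma * Dg * Cb / (cf * c).
pose k7 := L%:R / cf * (Num.sqrt s2 * Ma).
pose k6 := cf^-1 * (Da * Dg * (1 + Num.sqrt (Cb / c'))).
pose C := Da * Dg + `|Cm| + L%:R * k2 + L%:R * k3 + L%:R * k4 + cf^-1 * Num.sqrt s2 * Da +
  cf^-1 * Ma * Dg + k6 + k7.
have k20 : 0 <= k2 by exact: sqrtr_ge0.
have k30 : 0 <= k3 by exact: sqrtr_ge0.
have k40 : 0 <= k4 by rewrite /k4 !mulr_ge0 ?invr_ge0 ?mulr_ge0// ltW.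
have k70 : 0 <= k7 by rewrite /k7 !mulr_ge0 ?invr_ge0 ?sqrtr_ge0// ltW.
have k60 : 0 <= k6 by rewrite /k6 !mulr_ge0 ?invr_ge0 ?addr_ge0 ?sqrtr_ge0// ltW.
have t1 : 0 < Da * Dg by exact: mulr_gt0.
have Lk2 : 0 <= L%:R * k2 by exact: mulr_ge0.
have Lk3 : 0 <= L%:R * k3 by exact: mulr_ge0.
have Lk4 : 0 <= L%:R * k4 by exact: mulr_ge0.
have t5 : 0 <= cf^-1 * Num.sqrt s2 * Da by rewrite !mulr_ge0 ?invr_ge0 ?sqrtr_ge0// ltW.
have t6 : 0 <= cf^-1 * Ma * Dg by rewrite !mulr_ge0 ?invr_ge0// ltW.
exists C.
  have := normr_ge0 Cm; rewrite /C; lra.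
move=> zg za zm K dK n zg0 za0 Cm0 Dv0 K4 Kn.
have n0 : (0 < n)%N by exact: leq_trans (leq_trans _ K4) Kn.
have K0 : (0 < K n)%N by exact: leq_trans K4.
have nR : 0 < n%:R :> R by rewrite ltr0n.
have KR : 0 < (K n)%:R :> R by rewrite ltr0n.
have /andP[x0 x1] := powRN_le1 K0 zg0; have /andP[y0 y1] := powRN_le1 K0 za0.
have xy : (K n)%:R `^ (- zg - za) = (K n)%:R `^ (- zg) * (K n)%:R `^ (- za) :> R.
  by rewrite powRD// pnatr_eq0 -lt0n K0 implybT.
have xh : (K n)%:R `^ (1 / 2 - zg) = Num.sqrt (K n)%:R * (K n)%:R `^ (- zg) :> R.
  by rewrite powRD ?pnatr_eq0 -?lt0n ?K0 ?implybT// div1r powR12_sqrt.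
have K1 : 1 <= ln (K n)%:R :> R by exact: ln_nat_ge1.
have n1 : 1 <= n%:R :> R by rewrite ler1n.
have KnR : (K n)%:R <= n%:R :> R by rewrite ler_nat.
have K1R : 1 <= (K n)%:R :> R by rewrite ler1n.
have s1 : 1 <= Num.sqrt n%:R :> R by rewrite -[leLHS]sqrtr1 ler_wsqrtr.
have sK : Num.sqrt (K n)%:R <= Num.sqrt n%:R :> R by rewrite ler_wsqrtr.
have sn0 : 0 < Num.sqrt n%:R :> R by rewrite sqrtr_gt0.
have d0 : 0 <= dK (K n) by rewrite -(pmulr_rge0 _ Cd0).
rewrite /Delta_star /Delta_m /Delta_bar xy xh.
set x := _ `^ (- zg) in x0 x1 *; set yy := _ `^ (- za) in y0 y1 *.
set T4 := Num.sqrt ((K n)%:R / n%:R).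
set T5 := Num.sqrt ((dK (K n) + 1) * (K n)%:R / n%:R).
set T6 := _ `^ (- zm) in Cm0 *.
set T7 := _ * (Num.sqrt (K n)%:R * x).
have T40 : 0 <= T4 by exact: sqrtr_ge0.
have T50 : 0 <= T5 by exact: sqrtr_ge0.
have T60 : 0 <= T6 by exact: powR_ge0.
have T70 : 0 <= T7 by rewrite /T7 !mulr_ge0 ?sqrtr_ge0// ltW.
have T10 : 0 <= Num.sqrt n%:R * (x * yy) by rewrite !mulr_ge0 ?sqrtr_ge0// ltW.
set rho := _ + (T5 + T6) + T7.
have r1 : Num.sqrt n%:R * (x * yy) <= rho by rewrite /rho; lra.
have r2 : x <= rho by rewrite /rho; lra.
have r3 : yy <= rho by rewrite /rho; lra.
have r4 : T4 <= rho by rewrite /rho; lra.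
have r5 : T5 <= rho by rewrite /rho; lra.
have r6 : T6 <= rho by rewrite /rho; lra.
have r7 : T7 <= rho by rewrite /rho; lra.
have e1 : Num.sqrt n%:R * (Da * yy * (Dg * x)) <= Da * Dg * rho.
  have -> : Num.sqrt n%:R * (Da * yy * (Dg * x)) = Da * Dg * (Num.sqrt n%:R * (x * yy)) by ring.
  by rewrite ler_wpM2l// ltW.
have e2 : Cm * T6 <= `|Cm| * rho.
  by apply: (@le_trans _ _ (`|Cm| * T6)); [rewrite ler_wpM2r// ler_norm|rewrite ler_wpM2l].
have e3 : L%:R * Num.sqrt (heldout_bound n (Cb * (K n)%:R) cf c s2 (Dg * x) (Cd * dK (K n))) <= L%:R * k2 * rho.
  rewrite -mulrA ler_wpM2l//; apply: (@le_trans _ _ (k2 * T5)); last by rewrite ler_wpM2l.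
  rewrite /k2 /T5 -sqrtrM; last by rewrite !mulr_ge0 ?invr_ge0 ?addr_ge0 ?mulr_ge0 ?sqr_ge0// ltW.
  rewrite ler_wsqrtr// /heldout_bound.
  have -> : Cd * (Cb * (2 * s2 + 2 * Dg ^+ 2) / cf / c ^+ 2) * ((dK (K n) + 1) * (K n)%:R / n%:R) =
     (dK (K n) + 1) * (2 * s2 + 2 * Dg ^+ 2) * (Cd * Cb * (K n)%:R / (cf * n%:R) / c ^+ 2).
    by field; rewrite !gt_eqF.
  have -> : Cd * dK (K n) * (Cb * (K n)%:R * (2 * s2 + 2 * (Dg * x) ^+ 2) / (cf * n%:R) / c ^+ 2) =
     dK (K n) * (2 * s2 + 2 * (Dg * x) ^+ 2) * (Cd * Cb * (K n)%:R / (cf * n%:R) / c ^+ 2).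
    by field; rewrite !gt_eqF.
  rewrite ler_wpM2r//.
    by rewrite !divr_ge0 ?mulr_ge0 ?exprn_ge0// ltW.
  apply: ler_pM => //.
    by apply: addr_ge0; [exact: mulr_ge0|rewrite pmulr_rge0// sqr_ge0].
    by rewrite lerDl.
  rewrite lerD2l ler_wpM2l// ler_pXn2r ?nnegrE ?mulr_ge0 ?(ltW Dg0) ?(ltW x0)//.
  by rewrite ler_piMr// ltW.
have e4 : L%:R * Num.sqrt (design_noise_bound n (Cb * (K n)%:R) cf c s2 Ma) <= L%:R * k3 * rho.
  rewrite -mulrA ler_wpM2l//; apply: (@le_trans _ _ (k3 * T4)); last by rewrite ler_wpM2l.
  rewrite /k3 /T4 -sqrtrM; last by rewrite !mulr_ge0 ?invr_ge0 ?exprn_ge0// ltW.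
  rewrite ler_wsqrtr// /design_noise_bound le_eqVlt; apply/orP; left; apply/eqP.
  by field; rewrite !gt_eqF.
have e5 : L%:R * design_bias_bound n (Cb * (K n)%:R) cf c Ma (Dg * x) <= L%:R * k4 * rho.
  rewrite -mulrA ler_wpM2l//; apply: (@le_trans _ _ (k4 * T7)); last by rewrite ler_wpM2l.
  have -> : design_bias_bound n (Cb * (K n)%:R) cf c Ma (Dg * x) = k4 * ((K n)%:R / Num.sqrt n%:R * x).
    by rewrite /design_bias_bound /k4; field; rewrite !gt_eqF.
  rewrite ler_wpM2l// /T7 mulrA ler_wpM2r ?(ltW x0)//.
  rewrite -{1}(sqr_sqrtr (ltW KR)) expr2 mulrAC ler_wpM2r ?sqrtr_ge0//.
  rewrite -sqrtrV ?ler0n// -sqrtrM ?ler0n// ler_wsqrtr// ler_wpM2r ?invr_ge0//.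
  by rewrite ler_peMr// ltW.
have e6 : cf^-1 * Num.sqrt s2 * (Da * yy) <= cf^-1 * Num.sqrt s2 * Da * rho.
  by rewrite mulrA ler_wpM2l.
have e7 : cf^-1 * ((Ma + Da * yy * (1 + Num.sqrt (Cb * (K n)%:R / c'))) * (Dg * x)) <=
    cf^-1 * Ma * Dg * rho + k6 * rho.
  have -> : cf^-1 * ((Ma + Da * yy * (1 + Num.sqrt (Cb * (K n)%:R / c'))) * (Dg * x)) =
    cf^-1 * Ma * Dg * x + cf^-1 * (Da * Dg * ((1 + Num.sqrt (Cb * (K n)%:R / c')) * (x * yy))) by ring.
  apply: lerD; first by rewrite ler_wpM2l.
  have -> : k6 * rho = cf^-1 * (Da * Dg * ((1 + Num.sqrt (Cb / c')) * rho)) by rewrite /k6; ring.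
  rewrite ler_wpM2l ?invr_ge0 ?(ltW cf0)// ler_wpM2l ?(ltW t1)//.
  apply: (@le_trans _ _ ((1 + Num.sqrt (Cb / c')) * (Num.sqrt n%:R * (x * yy)))); last first.
    by rewrite ler_wpM2l// addr_ge0// sqrtr_ge0.
  rewrite mulrA ler_wpM2r ?mulr_ge0 ?(ltW x0) ?(ltW y0)// mulrDl mul1r lerD//.
  have -> : Cb * (K n)%:R / c' = Cb / c' * (K n)%:R by rewrite mulrAC.
  by rewrite sqrtrM ?divr_ge0 ?(ltW Cb0) ?(ltW c'0)// ler_wpM2l ?sqrtr_ge0.
have e8 : weights_bound n L cf s2 Ma <= k7 * rho.
  have -> : weights_bound n L cf s2 Ma = k7 * n%:R^-1 by rewrite /weights_bound /k7; ring.
  rewrite ler_wpM2l//; apply: le_trans r4; rewrite /T4.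
  rewrite -[leLHS]ger0_norm ?invr_ge0// -sqrtr_sqr.
  rewrite ler_wsqrtr// expr2 ler_wpM2r ?invr_ge0//.
  by apply: le_trans K1R; rewrite invf_le1.
rewrite /remainder_bound /C !mulrDl; lra.
Qed.

Section growth.
Variables (K : nat -> nat).
Hypothesis K_oo : K @ \oo --> \oo.
Hypothesis K_rate : (fun n => (K n)%:R * ln (K n)%:R / n%:R : R) @ \oo --> (0 : R).

Lemma near_K_ge (M : nat) : \forall n \near \oo, (M <= K n)%N.
Proof. by move/cvgnyPge : K_oo; apply. Qed.

Lemma near_rate (e : R) : 0 < e -> \forall n \near \oo, (K n)%:R * ln (K n)%:R <= e * n%:R.
Proof.
move=> e0; move/cvgrPdist_le : K_rate => /(_ e e0) h.
near=> n; have n0 : 0 < n%:R :> R by rewrite ltr0n; near: n; exact: nbhs_infty_gt.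
have : `|0 - (K n)%:R * ln (K n)%:R / n%:R| <= e by near: n.
rewrite sub0r normrN => /(le_trans (ler_norm _)).
by rewrite ler_pdivrMr.
Unshelve. all: by end_near. Qed.

Lemma near_K_le : \forall n \near \oo, (K n <= n)%N.
Proof.
near=> n; have K4 : (4 <= K n)%N by near: n; exact: near_K_ge.
rewrite -(ler_nat R); apply: (@le_trans _ _ ((K n)%:R * ln (K n)%:R)).
  by rewrite ler_peMr// ln_nat_ge1.
rewrite -[leRHS]mul1r; near: n; exact: near_rate.
Unshelve. all: by end_near. Qed.

(** Since [K ln K = o(n)], the exponential is at most [K ^ (- 4)], against [K ^ 2]
    entries. *)
Lemma near_union_bound (L : nat) (A e : R) : 0 < A -> 0 < e -> \forall n \near \oo,
  L%:R * ((K n * K n)%:R * (2 * expR (- A * (n%:R / (K n)%:R)))) <= e.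
Proof.
move=> A0 e0; near=> n.
have K4 : (4 <= K n)%N by near: n; exact: near_K_ge.
have KL : 2 * L%:R / e <= (K n)%:R.
  apply: (@le_trans _ _ (Num.bound (2 * L%:R / e))%:R).
    by apply/ltW/archi_boundP; rewrite divr_ge0 ?mulr_ge0// ltW.
  by rewrite ler_nat; near: n; exact: near_K_ge.
have KR : 0 < (K n)%:R :> R by rewrite ltr0n; exact: leq_trans K4.
have K1 : 1 <= (K n)%:R :> R by rewrite ler1n; exact: leq_trans K4.
have h : (K n)%:R * ln (K n)%:R <= A / 4 * n%:R by near: n; apply: near_rate; rewrite divr_gt0.
have h4 : expR (- A * (n%:R / (K n)%:R)) <= (K n)%:R ^- 4.
  rewrite -{2}(@lnK _ (K n)%:R) ?posrE// -expRM_natl -expRN ler_expR.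
  rewrite mulNr lerN2 mulrA ler_pdivlMr//.
  by rewrite -mulrA [ln _ * _]mulrC; lra.
apply: (@le_trans _ _ (L%:R * ((K n * K n)%:R * (2 * (K n)%:R ^- 4)))).
  by rewrite ler_wpM2l// ler_wpM2l// ler_wpM2l.
have -> : L%:R * ((K n * K n)%:R * (2 * (K n)%:R ^- 4)) = 2 * L%:R / (K n)%:R ^+ 2 :> R.
  by rewrite natrM; field; rewrite gt_eqF.
rewrite ler_pdivrMr ?exprn_gt0// -ler_pdivrMl// mulrC.
apply: (le_trans KL); rewrite expr2 ler_peMr// ltW.
Unshelve. all: by end_near. Qed.

End growth.

Lemma Delta_m_le (zg za : R) (K : nat -> nat) (d : nat -> R) : (exists M : R, forall k, `|d k| <= M) ->
  exists2 C : R, 0 < C & forall n, Delta_m zg d K n <= C * Delta_star zg za K n.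
Proof.
move=> [M dM]; have M0 : 0 <= M by exact: le_trans (normr_ge0 _) (dM 0%N).
exists (1 + Num.sqrt (M + 1)) => [|n]; first by rewrite ltr_pwDl// sqrtr_ge0.
rewrite /Delta_m /Delta_star.
set T4 := Num.sqrt ((K n)%:R / n%:R).
have h : Num.sqrt ((d (K n) + 1) * (K n)%:R / n%:R) <= Num.sqrt (M + 1) * T4.
  rewrite -sqrtrM ?addr_ge0// ler_wsqrtr// -mulrA ler_wpM2r ?divr_ge0//.
  by rewrite lerD2r; exact: le_trans (ler_norm _) (dM _).
have x0 : 0 <= (K n)%:R `^ (- zg) :> R by exact: powR_ge0.
have y0 : 0 <= (K n)%:R `^ (- za) :> R by exact: powR_ge0.
have z0 : 0 <= Num.sqrt n%:R * (K n)%:R `^ (- zg - za) :> R by rewrite mulr_ge0 ?sqrtr_ge0 ?powR_ge0.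
have w0 : 0 <= T4 by exact: sqrtr_ge0.
have s0 : 0 <= Num.sqrt (M + 1) by exact: sqrtr_ge0.
apply: (le_trans (lerD h (lexx _))).
rewrite mulrDl mul1r -!addrA [leLHS]addrC.
have : Num.sqrt (M + 1) * T4 <= Num.sqrt (M + 1) * (Num.sqrt n%:R * (K n)%:R `^ (- zg - za) +
  ((K n)%:R `^ (- zg) + ((K n)%:R `^ (- za) + T4))) by rewrite ler_wpM2l//; lra.
lra.
Qed.

End rates.

(** * The asymptotic expansion *)

(** The constants are fixed before the number of splines. They include a positive
    approximation constant, since [mean_prod_le] is used with it as a scale. *)
Lemma holder_regression_constants {R : realType} dZ (Z : measurableType dZ)
    (F : probability Z R) r (a : Z -> R) (w : Z -> r.-tuple R) (s : R)
    (gam : regressor R r -> R) (k : nat) (c C : R) :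
  0 < c -> (0 < r)%N -> 0 < s -> holder_regression F a w s gam ->
  exists (g : 'rV[R]_r -> R) (M D : R),
    [/\ {ae F, forall u, gam (a u, w u) = a u * g (tuple_row (w u))},
      0 <= M, 0 < D, forall v, cube v -> `|g (tuple_row v)| <= M &
      forall K (q : r.-tuple R -> 'cV[R]_K), tensor_bspline k c C q ->
        (forall l, exists2 v, cube v & q v l 0 != 0) ->
        exists e : 'cV[R]_K, forall v, cube v ->
          `|g (tuple_row v) - dot (q v) e| <= D * K%:R `^ (- zeta k r s)].
Proof.
move=> c0 r0 s0 [g [gs gE]]; have [_ gc _] := gs.
have [M M0 gM] := bounded_on_cube (gc [::] (leq0n _)).
have [D D0 gD] := tensor_bspline_approximation k C c0 r0 s0 gs.
exists g, M, (D + 1); split => //.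
- by rewrite ltr_wpDl.
- move=> v cv; have -> : tuple_row v = rowf (tnth v) by [].
  exact: gM.
move=> K q hq nz; have [e he] := gD K q hq nz; exists e => v cv.
by apply: (le_trans (he v cv)); rewrite ler_wpM2r ?powR_ge0// lerDl.
Qed.

(** In dimension 0 the only product is the empty one, so a growing basis forces
    [0 < r]. *)
Lemma tensor_bspline_dim0 {R : realType} k (c C : R) K (q : 0.-tuple R -> 'cV[R]_K) :
  tensor_bspline k c C q -> K = 1%N.
Proof.
by move=> [J [tau [e [scale [_ _ be _]]]]]; rewrite (card_basis be) big_ord0.
Qed.


Theorem theorem4 (R : realType)
  (* sampling *)
  (d dZ : measure_display) (Om : measurableType d) (Z : measurableType dZ)
  (P : probability Om R) (F0 : probability Z R)
  (z : nat -> {mfun Om >-> Z}) (z_iid : iid P F0 z)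
  (* components y and x = (a, w) of a data value *)
  (r : nat) (y a : {mfun Z >-> R}) (w : {mfun Z >-> r.-tuple R})
  (x := fun u : Z => (a u, w u) : regressor R r)
  (* gamma_0 = E[y | x] *)
  (gam0 : regressor R r -> R) (gam0E : is_cond_mean F0 y x gam0)
  (* m(z, gamma) and beta_0 *)
  (m : Z -> (regressor R r -> R) -> R)
  (m_affine : forall u (c : R) (g1 g2 : regressor R r -> R),
     sq_integrable F0 x g1 -> sq_integrable F0 x g2 ->
     m u (fun v => c * g1 v + g2 v) - m u (fun=> 0) =
     c * (m u g1 - m u (fun=> 0)) + (m u g2 - m u (fun=> 0)))
  (m_gam0_int : F0.-integrable setT (EFin \o (fun u => m u gam0)))
  (beta0 : R := fine ('E_F0[fun u => m u gam0]))
  (* (A1) *)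
  (alp0 : regressor R r -> R) (alp0_sq : sq_integrable F0 x alp0)
  (alp0E : forall g : regressor R r -> R, sq_integrable F0 x g ->
     F0.-integrable setT (EFin \o (fun u => m u g - m u (fun=> 0))) /\
     ('E_F0[fun u => (m u g - m u (fun=> 0))%R] =
      'E_F0[fun u => (alp0 (x u) * g (x u))%R])%E)
  (* (A2) *)
  (L : nat) (grp : forall n, 'I_n -> 'I_L)
  (folds_large : exists2 C : R, 0 < C &
     \forall n \near \oo, forall l : 'I_L,
       C * n%:R <= #|fold (grp n) l|%:R /\
       C * n%:R <= #|~: fold (grp n) l|%:R)
  (folds_balanced : forall n (l l' : 'I_L),
     (#|fold (grp n) l| <= #|fold (grp n) l'| + 1)%N)
  (* (A3) *)
  (kap : nat) (K : nat -> nat) (q : forall n, r.-tuple R -> 'cV[R]_(K n))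
  (p := fun n (v : regressor R r) => v.1 *: q n v.2)
  (w_density : bounded_density_on_cube F0 w)
  (q_spline : exists c C : R, 0 < c /\ forall n, tensor_bspline kap c C (q n))
  (q_eigen : exists2 C : R, 0 < C & forall n,
     C <= lambda_min (expectation_mx F0 (fun u => q n (w u) *m (q n (w u))^T)))
  (q_bound : exists C : R, forall n v, cube v ->
     enorm (q n v) <= C * Num.sqrt (K n)%:R)
  (a_bound : exists C : R, {ae F0, forall u, `|a u| <= C})
  (a_cond : exists h : r.-tuple R -> R,
     is_cond_mean F0 (fun u => a u ^+ 2) w h /\
     exists2 c : R, 0 < c & {ae F0, forall u, c <= h (w u)})
  (* (A4) *)
  (sgam salp : R) (sgam_gt0 : 0 < sgam) (salp_gt0 : 0 < salp)
  (gam0_holder : holder_regression F0 a w sgam gam0)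
  (alp0_holder : holder_regression F0 a w salp alp0)
  (* (A5) *)
  (y_var : exists h : regressor R r -> R,
     is_cond_mean F0 (fun u => (y u - gam0 (x u)) ^+ 2) x h /\
     exists C : R, {ae F0, forall u, h (x u) <= C})
  (K_oo : K @ \oo --> \oo)
  (K_rate : (fun n => (K n)%:R * ln (K n)%:R / n%:R : R) @ \oo --> (0 : R))
  (* (A6) *)
  (dK : nat -> R) (zm : R)
  (v_sq : forall n (i j : 'I_(K n)), F0.-integrable setT
     (EFin \o (fun u => m_basis m (p n) u i 0 * m_basis m (p n) u j 0)))
  (v_eigen : exists2 C : R, 0 < C & forall n,
     lambda_max (expectation_mx F0
       (fun u => m_basis m (p n) u *m (m_basis m (p n) u)^T)) <= C * dK (K n))
  (m_approx : exists C : R, \forall n \near \oo,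
     ('N[F0]_2%:E [EFin \o (fun u =>
        (m u (population_fit F0 x (p n) gam0) - m u gam0)%R)]
      <= (C * (K n)%:R `^ (- zm))%:E)%E)
  (* the estimator, for arbitrary generalized inverses *)
  (xs := fun n o (i : 'I_n) => x (z i o))
  (ys := fun n o (i : 'I_n) => y (z i o))
  (Sig := fun n o (l : 'I_L) =>
     sample_gram (p n) (xs n o) (~: fold (grp n) l))
  (hhat := fun n o (l : 'I_L) =>
     sample_cross (p n) (xs n o) (ys n o) (~: fold (grp n) l))
  (G : forall n, Om -> 'I_L -> 'M[R]_(K n))
  (G_inv : forall n o l, generalized_inverse (Sig n o l) (G n o l))
  (gamhat := fun n o l => series_fun (p n) (G n o l *m hhat n o l))
  (betahat := fun n o =>
     cross_fit_plugin m (fun i : 'I_n => z i o) (grp n) (gamhat n o))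
  (* influence function and rates *)
  (psi := fun u => m u gam0 - beta0 + alp0 (x u) * (y u - gam0 (x u)))
  (zg := zeta kap r sgam) (za := zeta kap r salp) :
  is_Op P
    (fun n o => Num.sqrt n%:R * (betahat n o - beta0)
                - (Num.sqrt n%:R)^-1 * \sum_(i < n) psi (z i o))
    (fun n => Delta_star zg za K n + Delta_m zm dK K n + Delta_bar zg K n)
  /\
  ((exists M : R, forall k, `|dK k| <= M) -> zm = zg ->
   exists2 C : R, 0 < C & forall n,
     Delta_m zm dK K n <= C * Delta_star zg za K n).
Proof.
split; last by move=> dM ->; exact: Delta_m_le.
case: a_bound => Ca_ Ca_ae; pose Ca := `|Ca_| + 1.
have Ca0 : 0 < Ca by rewrite ltr_wpDl.
have aCa : {ae F0, forall u, `|a u| <= Ca}.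
  apply: filterS Ca_ae => u h; apply: (le_trans h).
  by apply: (le_trans (ler_norm _)); rewrite lerDl.
case: q_bound => Cb_ Cb_q; pose Cb := `|Cb_| + 1.
have Cb0 : 0 < Cb by rewrite ltr_wpDl.
have qCb n v : cube v -> enorm (q n v) <= Cb * Num.sqrt (K n)%:R.
  move=> cv; apply: (le_trans (Cb_q n v cv)); rewrite ler_wpM2r ?sqrtr_ge0//.
  by apply: (le_trans (ler_norm _)); rewrite lerDl.
case: q_eigen => ce ce0 q_ce.
case: a_cond => h [h_cond [ch ch0 h_ge]].
case: w_density => f [cd [Cf [cd0 mf f_cube f_off f_law]]].
case: q_spline => cS [CS [cS0 q_sp]].
case: folds_large => cf cf0 large.
case: v_eigen => Cd Cd0 v_Cd.
case: m_approx => Cm m_Cm.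
case: y_var => hy [hy_cond [s2_ hy_s2]]; pose s2 := `|s2_|.
have s20 : 0 <= s2 by exact: normr_ge0.
have hy_le : {ae F0, forall u, hy (x u) <= s2}.
  by apply: filterS hy_s2 => u hu; apply: (le_trans hu); exact: ler_norm.
have r0 : (0 < r)%N.
  rewrite lt0n; apply/negP => /eqP r0.
  have [N _ /(_ N (leqnn N)) /= KN] := near_K_ge K_oo 4.
  have : K N = 1%N.
    clear -q_sp r0; move: q_sp => /(_ N); move: (q N); rewrite r0 => q' /tensor_bspline_dim0.
    by [].
  by move=> KN1; rewrite KN1 in KN.
have [gg [Mg [Dg [gamE Mg0 Dg0 gg_le gg_approx]]]] :=
  holder_regression_constants kap CS cS0 r0 sgam_gt0 gam0_holder.
have [ga [Ma_ [Da [alpE Ma_0 Da0 ga_le ga_approx]]]] :=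
  holder_regression_constants kap CS cS0 r0 salp_gt0 alp0_holder.
have zg0 : 0 <= zg by exact: zeta_ge0.
have za0 : 0 <= za by exact: zeta_ge0.
pose N := overlap_bound r kap.
have N0 : (0 < N)%N by rewrite expn_gt0.
pose c := ch * ce; have c0 : 0 < c by exact: mulr_gt0.
pose Ma := Ca * (Ma_ + 2 * Da).
have Ma0 : 0 < Ma by rewrite mulr_gt0// ltr_wpDl// mulr_gt0.
pose B := Ca ^+ 2 * Cb ^+ 2.
have B0 : 0 < B by rewrite mulr_gt0 ?exprn_gt0.
pose t := tol c N.
have t0 : 0 < t by rewrite /t /tol divr_gt0// mulr_gt0// ltr0n.
pose vv := `|moment_const r Cf kap CS Cb Ca| + 1.
have vv0 : 0 < vv by rewrite ltr_wpDl.
(* The two conditions of [not_good_prob] on the exponential parameter. *)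
pose eta := Num.min (1 / (4 * B)) (t / (4 * vv)).
have eta0 : 0 < eta by rewrite lt_min; apply/andP; split; apply: divr_gt0 => //; apply: mulr_gt0.
have CaDg : 0 < Ca * Dg by exact: mulr_gt0.
have CaDa : 0 < Ca * Da by exact: mulr_gt0.
have c20 : 0 < c / 2 by exact: divr_gt0.
have [C C0 rate] := @remainder_bound_rate R L cf (c / 2) c s2 Ma B (Ca * Dg) (Ca * Da) Cm Cd
  cf0 c20 c0 s20 Ma0 B0 CaDg CaDa Cd0.
(* Markov's inequality then bounds one of the two exceptional events by [eps / 2]. *)
move=> eps eps0; pose M := 2 * C / eps.
have M0 : 0 < M by rewrite divr_gt0// mulr_gt0.
exists M; split => //.
have rate_t : 0 < cf * eta * t / 2 by apply: divr_gt0 => //; apply: mulr_gt0 => //; exact: mulr_gt0.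
have eps20 : 0 < eps / 2 by exact: divr_gt0.
near=> n.
have K4 : (4 <= K n)%N by near: n; exact: near_K_ge.
have Kn : (K n <= n)%N by near: n; exact: near_K_le K_oo K_rate.
have n0 : (0 < n)%N by exact: leq_trans (leq_trans _ K4) Kn.
have K0 : (0 < K n)%N by exact: leq_trans K4.
have KR : 0 < (K n)%:R :> R by rewrite ltr0n.
have large_n : forall l : 'I_L, cf * n%:R <= #|fold (grp n) l|%:R /\ cf * n%:R <= #|~: fold (grp n) l|%:R.
  by near: n; exact: large.
have m_n : ('N[F0]_2%:E [EFin \o (fun u => (m u (population_fit F0 x (p n) gam0) - m u gam0)%R)]
      <= (Cm * (K n)%:R `^ (- zm))%:E)%E by near: n; exact: m_Cm.
have union_n : L%:R * ((K n * K n)%:R * (2 * expR (- (cf * eta * t / 2) * (n%:R / (K n)%:R)))) <= eps / 2.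
  by near: n; exact: near_union_bound K_oo K_rate _ _ _ rate_t eps20.
have mx : measurable_fun setT x by exact: measurable_regressor.
pose pc := cutbasis (q n) Ca.
have mp : mxmeas (p n) by exact: measurable_basis (q_sp n).
have mpc : mxmeas pc by exact: measurable_cutbasis (q_sp n) Ca.
have pcb v : sqn (pc v) <= B * (K n)%:R by exact: (sqn_cutbasis Cb0 (qCb n) Ca0).
have b0 : 0 < B * (K n)%:R by exact: mulr_gt0.
have pc_ae : {ae F0, forall u, pc (x u) = p n (x u)}.
  exact: (cutbasis_ae f_off f_law (q n) aCa).
have gram_pd u : c * sqn u <= qform (gram F0 x pc) u.
  exact: (gram_cutbasis_pd f_off f_law (q_sp n) (q_ce n) Cb0 (qCb n) Ca0 aCa h_cond ch0 h_ge).
have [ov [ov_sym ov_card ovE]] := cutbasis_overlap r0 cS0 (q_sp n) Ca.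
have nz := basis_nonzero f_off f_law (q_sp n) ce0 (q_ce n) Cb0 (qCb n).
have [eg egE] := gg_approx _ _ (q_sp n) nz.
have [ea eaE] := ga_approx _ _ (q_sp n) nz.
have mgam0 : measurable_fun setT gam0 by case: gam0E.
have malp0 : measurable_fun setT alp0 by case: alp0_sq.
have Dgn0 : 0 <= Dg * (K n)%:R `^ (- zg) by rewrite mulr_ge0 ?powR_ge0// ltW.
have Dan0 : 0 <= Da * (K n)%:R `^ (- za) by rewrite mulr_ge0 ?powR_ge0// ltW.
have [gf [mgf gfE _ gf_ae]] := cut_regression f_off f_law (q_sp n) Ca0 aCa mgam0 gamE gg_le Mg0 Dgn0 egE.
have [af [maf afE af_le af_ae]] := cut_regression f_off f_law (q_sp n) Ca0 aCa malp0 alpE ga_le Ma_0 Dan0 eaE.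
rewrite -/pc in gfE afE.
have gfE' v : `|gf v - dot (pc v) eg| <= Ca * Dg * (K n)%:R `^ (- zg).
  by rewrite -mulrA; exact: gfE.
have afE' v : `|af v - dot (pc v) ea| <= Ca * Da * (K n)%:R `^ (- za).
  by rewrite -mulrA; exact: afE.
have af_le' v : `|af v| <= Ma.
  apply: (le_trans (af_le v)); rewrite ler_wpM2l ?(ltW Ca0)// lerD2l ler_wpM2l//.
  by rewrite ler_piMr ?(ltW Da0)//; case/andP: (powRN_le1 K0 za0).
have dg0 : 0 < Ca * Dg * (K n)%:R `^ (- zg) by rewrite mulr_gt0// powR_gt0.
have dal0 : 0 < Ca * Da * (K n)%:R `^ (- za) by rewrite mulr_gt0// powR_gt0.
have p_sq k : sq_integrable F0 x (fun v => p n v k 0).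
  split; first exact: mp.
  have [_ I] := L2_p F0 mx mpc pcb k.
  apply: (integ_ae _ _ I); first exact: (measurable_funX 2 (measurableT_comp (mp k 0) mx)).
  by apply: filterS pc_ae => u ->.
have gam0_sq : sq_integrable F0 x gam0.
  split=> //; have [_ I] := L2_near F0 mx mpc pcb mgf gfE'.
  apply: (integ_ae _ _ I); first exact: (measurable_funX 2 (measurableT_comp mgam0 mx)).
  by apply: filterS gf_ae => u ->.
have [mu muF muE] : exists2 mu : probability (n.-tuple Z) R,
    iid_law F0 mu & forall B', mu B' = P (@sample _ _ _ _ z n @^-1` B').
  by exists (sample_law P z n) => //; exact: sample_iid_law.
have my : measurable_fun setT y by [].
have [N1 [mN1 FN1 [Q [IQ Q0 MQ QE]]]] := plug_in_expansion mx m_affine p_sq my gam0E malp0 alp0E mp mpc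
  b0 pcb pc_ae c0 gram_pd N0 ov_sym ov_card ovE mgf gfE' gf_ae dg0 maf afE' af_ae dal0 Ma0 af_le'
  K0 (v_sq n) (v_Cd n) m_n hy_cond hy_le s20 gam0_sq muF n0 cf0 (fun l => (large_n l).2) (folds_balanced n).
have etab : eta * (2 * (B * (K n)%:R)) <= 2^-1 * (K n)%:R.
  have h1 : eta <= 1 / (4 * B) by rewrite ge_min lexx.
  apply: (@le_trans _ _ (1 / (4 * B) * (2 * (B * (K n)%:R)))).
    by rewrite ler_wpM2r// mulr_ge0// ltW.
  by rewrite le_eqVlt; apply/orP; left; apply/eqP; field; rewrite gt_eqF.
have etav : 2 * eta * vv <= t / 2.
  have h1 : eta <= t / (4 * vv) by rewrite ge_min lexx orbT.
  apply: (@le_trans _ _ (2 * (t / (4 * vv)) * vv)).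
    by rewrite ler_wpM2r ?(ltW vv0)// ler_wpM2l.
  by rewrite le_eqVlt; apply/orP; left; apply/eqP; field; rewrite gt_eqF.
have mom k l : mean F0 (fun u => (pc (x u) k 0 * pc (x u) l 0) ^+ 2) <= vv * (K n)%:R.
  have h1 := @cutbasis_moment _ _ _ F0 _ a w f cd Cf cd0 f_cube f_off f_law _ _ _ _ _ r0 K0 cS0 (q_sp n) _ _ Cb0 (qCb n) Ca0 k l.
  apply: (le_trans h1).
  by rewrite ler_wpM2r// (le_trans (ler_norm _))// lerDl.
have [mbad pbad] := not_good_prob mx mpc pcb c0 N0 K0 muF n0 cf0 (fun l => (large_n l).2) eta0 etab mom etav.
set bad := [set o | _] in mbad pbad.
have pbad' : (mu bad <= (eps / 2)%:E)%E.
  by apply: (le_trans pbad); rewrite lee_fin; exact: union_n.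
pose rho := Delta_star zg za K n + Delta_m zm dK K n + Delta_bar zg K n.
have [rm0 _ _] : [/\ 0 <= Cm * (K n)%:R `^ (- zm), True & True].
  by split => //; rewrite -lee_fin; apply: le_trans m_n; exact: Lnorm_ge0.
have Dv0 : 0 <= Cd * dK (K n).
  exact: (Dv_ge0 K0 (v_sq n) (v_Cd n)).
have MQ' : mean mu Q <= C * rho by apply: (le_trans MQ); exact: rate.
have rho0 : 0 < rho.
  have h1 : 0 < Delta_star zg za K n.
    by rewrite /Delta_star ltr_wpDl ?addr_ge0 ?mulr_ge0 ?sqrtr_ge0 ?powR_ge0// sqrtr_gt0 divr_gt0// ltr0n.
  have h2 : 0 <= Delta_m zm dK K n by rewrite /Delta_m addr_ge0 ?sqrtr_ge0 ?powR_ge0.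
  have h3 : 0 <= Delta_bar zg K n by rewrite /Delta_bar mulr_ge0 ?sqrtr_ge0 ?powR_ge0.
  exact: ltr_wpDr h3 (ltr_wpDr h2 h1).
have Mrho0 : 0 < M * rho by exact: mulr_gt0.
have mQ : measurable [set o | (M * rho < Q o)%R].
  rewrite [X in measurable X](_ : _ = setT `&` Q @^-1` `]M * rho, +oo[%classic); last first.
    by apply/seteqP; split => o /=; rewrite in_itv/= andbT => // -[].
  by apply: (integ_meas IQ) => //; exact: measurable_itv.
have pQ : (mu [set o | (M * rho < Q o)%R] <= (eps / 2)%:E)%E.
  apply: (le_trans (markov IQ Q0 Mrho0)); rewrite lee_fin ler_pdivrMr//.
  apply: (le_trans MQ'); rewrite le_eqVlt; apply/orP; left; apply/eqP.
  by rewrite /M; field; rewrite gt_eqF.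
have pN (i : 'I_n) : measurable (z i @^-1` N1) /\ (P (z i @^-1` N1) <= 0%:E)%E.
  split; last by case: z_iid => zF _; rewrite zF// FN1.
  by rewrite -[X in measurable X]setTI; exact: (measurable_funPT (z i)).
have [mnull pnull] := prob_exists_le (fun i => (pN i).1) (fun i => (pN i).2).
have ms B' : measurable B' -> measurable (@sample _ _ _ _ z n @^-1` B').
  by move=> mB; rewrite -[X in measurable X]setTI; exact: measurable_sample.
(* A null event, the event that some training set is not good, and the event that
   the dominating function is large. *)
exists ([set o | exists i : 'I_n, (z i @^-1` N1) o] `|` (@sample _ _ _ _ z n @^-1` bad `|`
  @sample _ _ _ _ z n @^-1` [set o | (M * rho < Q o)%R])); split.
- by apply: measurableU => //; apply: measurableU; exact: ms.
- apply: (le_trans (measureU2 _ _ _)) => //; first by apply: measurableU; exact: ms.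
  have -> : eps%:E = (0%:E + ((eps / 2)%:E + (eps / 2)%:E))%E by rewrite -!EFinD add0r -splitr.
  apply: leeD; first by rewrite (le_trans pnull)// mulr0.
  apply: (le_trans (measureU2 _ _ _)); [exact: ms|exact: ms|].
  apply: leeD.
    by move: pbad'; rewrite muE.
  by move: pQ; rewrite muE.
move=> o /= Vo; apply: contrapT => no; move: Vo; apply/negP; rewrite -leNgt.
have zE : (fun i : 'I_n => z i o) = tnth (sample z n o).
  by apply/funext => i; rewrite tnth_mktuple.
have oN i : ~ N1 (tnth (sample z n o) i).
  by move=> hN; apply: no; left; exists i; rewrite -[z i o]/((fun i : 'I_n => z i o) i) zE.
have og l : good F0 x pc (~: fold (grp n) l) t (xsample x (sample z n o)).
  by apply: contrapT => /negP ng; apply: no; right; left; exists l.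
have oQ : Q (sample z n o) <= M * rho.
  by rewrite leNgt; apply/negP => hQ; apply: no; right; right.
have xsE : xs n o = xsample x (sample z n o).
  by apply/funext => i; rewrite /xs /xsample -zE.
have ysE : ys n o = (fun i => y (tnth (sample z n o) i)).
  by apply/funext => i; rewrite /ys -zE.
apply: le_trans oQ.
have := QE (sample z n o) beta0 (G n o) oN og.
rewrite -ysE -xsE -zE; apply; exact: G_inv.
Unshelve. all: by end_near. Qed.
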